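(* Let $\alpha\in(0,1)$. For each $N$ let $u^N$ solve $$\partial_tu^N=L^N_{a(t)}u^N+g(t,\tfrac xN)\quad\text{on }[0,T]\times\tfrac1N\mathbb T_N^n,$$ with $a(t)$ and $g(t,\cdot)$ continuous in $t$, and assume, with constants independent of $N$: $a(t)\in\mathcal A(c_-,c_+)$ for all $t$; $\|g\|_\infty\le G_\infty<\infty$; $\sup_N\|u^N\|_\infty<\infty$; and $$\sup_N\|u^N(0)\|_{C_N^2}\le C_0<\infty,$$ $$|a_{x_1,e}(t_1)-a_{x_2,e}(t_2)|\le B\big\{|t_2-t_1|^{\frac\alpha2}+|\tfrac{x_1}N-\tfrac{x_2}N|^\alpha\big\}\quad\text{for all }t_1,t_2\in[0,T],\ x_1,x_2\in\mathbb T^n_N,\ |e|=1,$$ $$\sup_{N,x,e}|\nabla^{N,*}_ea_{x,e}(0)|\le C_1<\infty,$$ with $B<\infty$. Put $C_2=n(C_1C_0+c_+C_0)$. Then $$|\tilde u^N|_{1+\alpha}\le C\big[(B+1)^{1+\frac1\alpha}\|u^N\|_\infty+G_\infty+C_2\big].$$ In particular, for all $|e|=1$, $t\in[0,T]$, $x\in\mathbb T_N^n$, $$|\nabla^N_eu^N(t,\tfrac xN)|\le C\big[(B+1)^{\frac1\alpha}\|u^N\|_\infty+(B+1)^{-1}(G_\infty+C_2)\big],$$ and the $\alpha$-Hölder seminorm satisfies $$[\nabla^N_e\tilde u^N]_\alpha\le C\big[(B+1)^{1+\frac1\alpha}\|u^N\|_\infty+G_\infty+C_2\big].$$ Here $C=C(n,c_\pm,T,\alpha)$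 (independent of $N$).
   Context: Lattice notation. $N\in\mathbb N$, $T>0$ fixed, $\mathbb T^n=\mathbb R^n/\mathbb Z^n$, $\mathbb T_N^n=(\mathbb Z/N\mathbb Z)^n$; functions on $\frac1N\mathbb T^n_N\subset\mathbb T^n$ are written $u(\frac xN)$. For $e\in\mathbb Z^n$, $|e|=1$: $\nabla_e^Nu(\frac xN)=N(u(\frac{x+e}N)-u(\frac xN))$, $\nabla^{N,*}_e=\nabla^N_{-e}$ (acting on the variable $x$ in $\nabla^{N,*}_ea_{x,e}=N(a_{x-e,e}-a_{x,e})$). ''$e>0$'' means that the nonzero component of $e$ is $1$. $\|u\|_{C^k_N}=\sum_{i=0}^k\sum_{e_1,\dots,e_i}\max_{x}|\nabla^N_{e_1}\cdots\nabla^N_{e_i}u(\frac xN)|$ (sum over unit vectors $|e_j|=1$). Suprema: $\|u^N\|_\infty$, $\|g\|_\infty$ are over $[0,T]\times\frac1N\mathbb T^n_N$. $|\frac{x_1}N-\frac{x_2}N|$ is the Euclidean distance on the torus $\mathbb T^n$. Operators. For $0<c_-<c_+<\infty$, $\mathcal A(c_-,c_+)$ is the set of $a=\{a_{x,e}\}_{x\in\mathbb T_N^n,|e|=1}$ with $a_{x,e}=a_{x+e,-e}$ and $c_-\le a_{x,e}\le c_+$. $L^N_au(\frac xN)=N^2\sum_{|e|=1}a_{x,e}\{u(\frac{x+e}N)-u(\frac xN)\}$. Norms. $\Omega=[0,T]\times\mathbb T^n$. For $X=(t,z)$, $Y=(s,y)\in\Omega$: $|X-Y|=\max\{|t-s|^{1/2},|z-y|\}$.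 For $F$ on $\Omega$, $\nabla^N_eF(t,z)=N(F(t,z+\frac eN)-F(t,z))$, and $|\nabla^NF(X)-\nabla^NF(Y)|=\max_{|e|=1,e>0}|\nabla^N_eF(X)-\nabla_e^NF(Y)|$. The polylinear interpolation in space of a function $u$ on $[0,T]\times\frac1N\mathbb T_N^n$ is $\tilde u(t,z)=\sum_{v\in\{0,1\}^n}\prod_{i=1}^n\vartheta(v_i,z_i)\,u(t,\frac{[Nz]+v}N)$, where $\vartheta(1,b)=\{Nb\}$, $\vartheta(0,b)=1-\{Nb\}$ and $[\cdot],\{\cdot\}$ are (componentwise) integer and fractional parts. Unweighted (semi)norms: $[F]_\alpha=\sup_{X\neq Y\in\Omega}\frac{|F(X)-F(Y)|}{|X-Y|^\alpha}$, $[F]_{1+\alpha}=\sup_{X\neq Y\in\Omega}\frac{|\nabla^NF(X)-\nabla^NF(Y)|}{|X-Y|^\alpha}$, $\langle F\rangle_{1+\alpha}=\sup_{(t,z)\ne(s,z)\in\Omega}\frac{|F(t,z)-F(s,z)|}{|t-s|^{(1+\alpha)/2}}$, $|F|_0=\sup_\Omega|F|$, $|F|_{1+\alpha}=[F]_{1+\alpha}+\langle F\rangle_{1+\alpha}+|F|_0$. *)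

(* Defs.v *)
From mathcomp Require Import all_boot all_order all_algebra.
From mathcomp Require Import generic_quotient.
From mathcomp Require Import all_classical all_reals all_analysis.

Set Implicit Arguments.
Unset Strict Implicit.
Unset Printing Implicit Defensive.

Import Order.TTheory GRing.Theory Num.Theory.
Import numFieldNormedType.Exports.

Local Open Scope classical_set_scope.
Local Open Scope ring_scope.
Local Open Scope quotient_scope.

(* The vectors e in Z^n with |e| = 1: (i, true) is the i-th basis vector and
   (i, false) is its opposite, so that "e > 0" reads e.2. *)
Notation dir n := ('I_n * bool)%type.

Definition dopp n (e : dir n) : dir n := (e.1, ~~ e.2).

Definition dvec n (e : dir n) : 'rV[int]_n :=
  \row_j (if j == e.1 then (if e.2 then 1 else -1) else 0).

(* (Z/NZ)^n.  'I_m.+1 is a zmodType for every m, and N.-1.+1 = N for 0 < N;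
   the value N = 0 is meaningless and is always excluded by a hypothesis. *)
Notation lattice n N := 'rV['I_N.-1.+1]_n.

Definition modN (N : nat) (k : int) : 'I_N.-1.+1 :=
  inZp `|(k %% N%:Z)%Z|%N.

Definition latt n N (k : 'rV[int]_n) : lattice n N := map_mx (modN N) k.

Definition lat_shift n N (x : lattice n N) (e : dir n) : lattice n N :=
  x + latt N (dvec e).

Definition lgrad (R : realType) n N (e : dir n) (u : lattice n N -> R)
    (x : lattice n N) : R :=
  N%:R * (u (lat_shift x e) - u x).

(* nabla^{N,*}_e a_{x,e} = N (a_{x-e,e} - a_{x,e}) *)
Definition lgrad_star_coef (R : realType) n N (a : lattice n N -> dir n -> R)
    (x : lattice n N) (e : dir n) : R :=
  lgrad (dopp e) (a ^~ e) x.

Definition CkN_norm (R : realType) n N (k : nat) (u : lattice n N -> R) : R :=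
  \sum_(i < k.+1) \sum_(es : i.-tuple (dir n))
    \big[Num.max/0]_(x : lattice n N) `|foldr (@lgrad R n N) u es x|.

Definition elliptic_class (R : realType) n N (cm cp : R)
    (a : lattice n N -> dir n -> R) : Prop :=
  (forall x e, a x e = a (lat_shift x e) (dopp e)) /\
  (forall x e, cm <= a x e <= cp).

Definition LN (R : realType) n N (a : lattice n N -> dir n -> R)
    (u : lattice n N -> R) (x : lattice n N) : R :=
  N%:R ^+ 2 * \sum_(e : dir n) a x e * (u (lat_shift x e) - u x).

(* f'(t) = l relative to [0, T]: one-sided at the end points. *)
Definition has_deriv_on (R : realType) (T : R) (f : R -> R) (t l : R) : Prop :=
  (fun s => (f s - f t) / (s - t)) @ within `[0, T] t^' --> l.

Definition solves (R : realType) n N (T : R)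
    (a : R -> lattice n N -> dir n -> R) (g u : R -> lattice n N -> R) : Prop :=
  forall t x, t \in `[0, T] ->
    has_deriv_on T (u ^~ x) t (LN (a t) (u t) x + g t x).

Definition lsup_norm (R : realType) n N (T : R) (u : R -> lattice n N -> R)
    : \bar R :=
  ereal_sup [set `|u p.1 p.2|%:E | p in [set p | p.1 \in `[0, T]]].

Definition Zn_equiv (R : realType) n : rel 'rV[R]_n := fun p q =>
  `[< exists k : 'rV[int]_n, p = q + map_mx intr k >].

Lemma Zn_equiv_refl (R : realType) n : reflexive (@Zn_equiv R n).
Proof.
move=> p; apply/asboolP; exists 0.
by apply/rowP => i; rewrite !mxE addr0.
Qed.

Lemma Zn_equiv_sym (R : realType) n : symmetric (@Zn_equiv R n).
Proof.
suff H p q : @Zn_equiv R n p q -> Zn_equiv q p by move=> p q; apply/idP/idP; exact: H.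
move=> /asboolP[k ->]; apply/asboolP; exists (- k).
by apply/rowP => i; rewrite !mxE rmorphN addrK.
Qed.

Lemma Zn_equiv_trans (R : realType) n : transitive (@Zn_equiv R n).
Proof.
move=> q p r /asboolP[k ->] /asboolP[l ->]; apply/asboolP; exists (l + k).
by apply/rowP => i; rewrite !mxE rmorphD addrA.
Qed.

Canonical Zn_equiv_rel (R : realType) n :=
  EquivRel (@Zn_equiv R n) (@Zn_equiv_refl R n) (@Zn_equiv_sym R n)
    (@Zn_equiv_trans R n).

Definition torus (R : realType) n := {eq_quot (Zn_equiv_rel R n)}.

Definition to_torus (R : realType) n (p : 'rV[R]_n) : torus R n :=
  \pi_(torus R n) p.

Definition enorm (R : realType) n (p : 'rV[R]_n) : R :=
  Num.sqrt (\sum_(i < n) p 0 i ^+ 2).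

Definition tdist (R : realType) n (z y : torus R n) : R :=
  inf [set enorm (pq.1 - pq.2) | pq in
        [set pq : 'rV[R]_n * 'rV[R]_n | to_torus pq.1 = z /\ to_torus pq.2 = y]].

Definition tshift (R : realType) n (z : torus R n) (h : 'rV[R]_n) : torus R n :=
  to_torus (repr z + h).

Definition lpoint (R : realType) n N (x : lattice n N) : torus R n :=
  to_torus (\row_i ((x 0 i : nat)%:R / N%:R)).

Definition pdist (R : realType) n (X Y : R * torus R n) : R :=
  Num.max (`|X.1 - Y.1| `^ 2^-1) (tdist X.2 Y.2).

Definition tgrad (R : realType) n (N : nat) (e : dir n)
    (F : R * torus R n -> R) (X : R * torus R n) : R :=
  N%:R * (F (X.1, tshift X.2 (N%:R^-1 *: map_mx intr (dvec e))) - F X).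

Definition fracpart (R : realType) (r : R) : R := r - (Num.floor r)%:~R.

Definition theta (R : realType) (N : nat) (v : bool) (b : R) : R :=
  if v then fracpart (N%:R * b) else 1 - fracpart (N%:R * b).

Definition polylin (R : realType) n N (u : lattice n N -> R) (p : 'rV[R]_n) : R :=
  \sum_(v : {ffun 'I_n -> bool})
    (\prod_(i < n) theta N (v i) (p 0 i)) *
    u (latt N (\row_i (Num.floor (N%:R * p 0 i) + (v i : nat)%:Z))).

(* polylin u is Z^n-periodic, so the choice of representative is immaterial:
   see interpE below. *)
Definition interp (R : realType) n N (u : R -> lattice n N -> R)
    (X : R * torus R n) : R :=
  polylin (u X.1) (repr X.2).

Lemma polylin_periodic (R : realType) n N (u : lattice n N -> R)
    (p : 'rV[R]_n) (k : 'rV[int]_n) :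
  polylin u (p + map_mx intr k) = polylin u p.
Proof.
have E i : N%:R * (p + map_mx intr k) 0 i =
    N%:R * p 0 i + (N%:Z * k 0 i)%:~R :> R.
  by rewrite !mxE mulrDr intrM.
have F i : Num.floor (N%:R * (p + map_mx intr k) 0 i) =
    Num.floor (N%:R * p 0 i) + N%:Z * k 0 i.
  by rewrite E floorDrz ?intr_int // intrKfloor.
apply: eq_bigr => v _; congr (_ * u _).
  apply: eq_bigr => i _; rewrite /theta /fracpart F E intrD.
  by rewrite opprD addrACA subrr addr0.
apply/rowP => i; rewrite !mxE.
have -> : N%:R * (p 0 i + (k 0 i)%:~R) = N%:R * (p + map_mx intr k) 0 i :> R.
  by rewrite !mxE.
by rewrite F /modN addrAC addrC [N%:Z * _]mulrC modzMDl.
Qed.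

Lemma to_torus_repr (R : realType) n (p : 'rV[R]_n) :
  exists k : 'rV[int]_n, repr (to_torus p) = p + map_mx intr k.
Proof.
have /eqmodP/asboolP// : repr (to_torus p) = p %[mod torus R n].
by rewrite reprK.
Qed.

Lemma interpE (R : realType) n N (u : R -> lattice n N -> R) t (p : 'rV[R]_n) :
  interp u (t, to_torus p) = polylin (u t) p.
Proof. by rewrite /interp /=; have [k ->] := to_torus_repr p; exact: polylin_periodic. Qed.

Lemma tshiftE (R : realType) n (p h : 'rV[R]_n) :
  tshift (to_torus p) h = to_torus (p + h).
Proof.
rewrite /tshift; have [k ->] := to_torus_repr p.
by apply/eqmodP/asboolP; exists k; rewrite addrAC.
Qed.

Definition Omega (R : realType) n (T : R) : set (R * torus R n) :=
  [set X | X.1 \in `[0, T]].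

Definition Omega_pairs (R : realType) n (T : R)
    : set ((R * torus R n) * (R * torus R n)) :=
  [set XY | [/\ Omega T XY.1, Omega T XY.2 & XY.1 <> XY.2]].

Local Open Scope ereal_scope.

(* [F]_alpha *)
Definition holder (R : realType) n (T alpha : R) (F : R * torus R n -> R)
    : \bar R :=
  ereal_sup [set (`|F XY.1 - F XY.2| / pdist XY.1 XY.2 `^ alpha)%R%:E
            | XY in @Omega_pairs R n T].

(* [F]_{1+alpha} *)
Definition holder1 (R : realType) n (N : nat) (T alpha : R)
    (F : R * torus R n -> R) : \bar R :=
  ereal_sup [set ((\big[Num.max/0]_(e : dir n | e.2)
                     `|tgrad N e F XY.1 - tgrad N e F XY.2|)
                  / pdist XY.1 XY.2 `^ alpha)%R%:E
            | XY in @Omega_pairs R n T].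

(* <F>_{1+alpha} *)
Definition holder1_time (R : realType) n (T alpha : R)
    (F : R * torus R n -> R) : \bar R :=
  ereal_sup [set (`|F XY.1 - F XY.2|
                  / `|XY.1.1 - XY.2.1| `^ ((1 + alpha) / 2))%R%:E
            | XY in @Omega_pairs R n T `&` [set XY | XY.1.2 = XY.2.2]].

Definition sup_norm (R : realType) n (T : R) (F : R * torus R n -> R)
    : \bar R :=
  ereal_sup [set (`|F X|)%R%:E | X in @Omega R n T].

(* |F|_{1+alpha} *)
Definition norm1 (R : realType) n (N : nat) (T alpha : R)
    (F : R * torus R n -> R) : \bar R :=
  holder1 N T alpha F + holder1_time T alpha F + sup_norm T F.

(* Main.v *)
(* Extend u to negative times by u(0): this adds only a source bounded by C_2,
   and interior estimates suffice.  Freezing the coefficients at a point (t, x),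
   u is represented by Duhamel's formula for explicit Euler steps of the
   constant-coefficient equation, with fluxes (a - a_{t,x}) grad u and a bounded
   source.  For small time steps each step is a lazy random walk A, which commutes
   with difference quotients, so the discrete Bakry-Emery inequality gives, after
   j steps of length h, |grad^k A^j v|^2 <= C (j h)^{-k} A^{j+k}(v^2).  Since
   A^j dist(x, .)^2 (x) <= C j h, differentiating A^j k times costs (j h)^{-k/2}
   and a flux vanishing to order alpha at (t, x) gains (j h)^{alpha/2}.  Summing over
   a time of order (B + 1)^{-2/alpha} and absorbing gives the gradient bound, then
   the Hoelder bound; regularity in time follows by interpolation.  None of the
   bounds depends on the time step, so no heat kernel on the lattice is needed. *)
Require Import Defs.
From mathcomp Require Import all_boot all_order all_algebra.
From mathcomp Require Import all_classical all_reals all_analysis.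
From mathcomp Require Import ring lra zify.
Set Implicit Arguments.
Unset Strict Implicit.
Unset Printing Implicit Defensive.
Import Order.TTheory GRing.Theory Num.Theory.
Import numFieldNormedType.Exports.
Import Defs.
Local Open Scope classical_set_scope.
Local Open Scope ring_scope.

(** * Gradient estimates for random walks on abelian groups *)

(** Extending to all negative times makes the absorption elementary: every time up to T has the same
    past, so both sides of an estimate contain one and the same supremum over all t <= T, and
    neither cut-offs nor shrinking domains occur. For fixed N that supremum is finite beforehand,
    with a bound that may depend on N. Up to constants, the powers of B + 1 are powers of the
    look-back time s = (B+1)^(-2/alpha), for which B s^(alpha/2) is of order one. In the gradient
    bound u is weighted by s^(-1/2) = (B+1)^(1/alpha) and the source by s^(1/2) = (B+1)^(-1/alpha)
    <= (B+1)^(-1); in the Hoelder bounds u is weighted by s^(-(1+alpha)/2) = (B+1)^(1+1/alpha). The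
    differential equation enters the interior estimates only as an inequality for forward Euler
    steps, with defect at most h (G + C_2 + eps) for all h below a threshold depending on N and eps.
    As the constants see neither h nor eps, eps is sent to 0 at the end. *)

Section Walk.
Variables (R : realFieldType) (X : zmodType) (I : finType).
Variables (s : I -> X) (p : I -> R) (sc kappa : R).
Hypothesis p_ge0 : forall i, 0 <= p i.
Hypothesis p_half : \sum_i p i <= 2^-1.
Hypothesis kappa_ge0 : 0 <= kappa.
Hypothesis kappa_le : forall i, kappa * sc ^+ 2 <= p i / 2.

Definition walk (v : X -> R) (x : X) : R :=
  v x + \sum_i p i * (v (x + s i) - v x).

Definition wgrad (i : I) (v : X -> R) (x : X) : R := sc * (v (x + s i) - v x).

Local Notation A := walk.
Local Notation sq v := (fun x => v x ^+ 2).

Lemma walkE v x : A v x = (1 - \sum_i p i) * v x + \sum_i p i * v (x + s i).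
Proof.
rewrite /walk mulrBl mul1r -addrA; congr (_ + _).
under eq_bigr do rewrite mulrBr.
by rewrite sumrB -mulr_suml addrC.
Qed.

Lemma walk_le v w x : (forall y, v y <= w y) -> A v x <= A w x.
Proof.
move=> vw; rewrite !walkE lerD ?ler_wpM2l//.
  by have := p_half; lra.
by apply: ler_sum => i _; rewrite ler_wpM2l.
Qed.

Lemma iter_walk_le j v w x : (forall y, v y <= w y) -> iter j A v x <= iter j A w x.
Proof. by move=> vw; elim: j x => [//|j IH] x /=; apply: walk_le. Qed.

Lemma walkD v w : A (fun x => v x + w x) = (fun x => A v x + A w x).
Proof.
apply/funext => x; rewrite /walk addrACA -big_split/=; congr (_ + _).
by apply: eq_bigr => i _; ring.
Qed.

Lemma walkZ c v : A (fun x => c * v x) = (fun x => c * A v x).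
Proof.
apply/funext => x; rewrite /walk mulrDr mulr_sumr; congr (_ + _).
by apply: eq_bigr => i _; ring.
Qed.

Lemma walkC c : A (fun=> c) = (fun=> c).
Proof.
by apply/funext => x; rewrite /walk big1 ?addr0// => i _; rewrite subrr mulr0.
Qed.

Lemma walkT v y : A (fun x => v (x + y)) = (fun x => A v (x + y)).
Proof.
apply/funext => x; rewrite /walk; congr (_ + _).
by apply: eq_bigr => i _; rewrite addrAC.
Qed.

Lemma iter_walkD j v w :
  iter j A (fun x => v x + w x) = (fun x => iter j A v x + iter j A w x).
Proof. by elim: j => [//|j /= ->]; rewrite walkD. Qed.

Lemma iter_walkZ j c v : iter j A (fun x => c * v x) = (fun x => c * iter j A v x).
Proof. by elim: j => [//|j /= ->]; rewrite walkZ. Qed.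

Lemma iter_walkC j c : iter j A (fun=> c) = (fun=> c).
Proof. by elim: j => [//|j /= ->]; rewrite walkC. Qed.

Lemma iter_walkT j v y :
  iter j A (fun x => v (x + y)) = (fun x => iter j A v (x + y)).
Proof. by elim: j => [//|j /= ->]; rewrite walkT. Qed.

Lemma iter_walk_sum (J : Type) (r : seq J) (P : pred J) (F : J -> X -> R) j :
  iter j A (fun x => \sum_(k <- r | P k) F k x) =
  (fun x => \sum_(k <- r | P k) iter j A (F k) x).
Proof.
elim: r => [|k r IH].
  under eq_fun do rewrite big_nil.
  by rewrite iter_walkC; apply/funext => x; rewrite big_nil.
under eq_fun do rewrite big_cons.
apply/funext => x; rewrite big_cons; case: (P k); last by rewrite IH.
by rewrite iter_walkD IH.
Qed.

Lemma iter_walk_wgrad j i v : iter j A (wgrad i v) = wgrad i (iter j A v).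
Proof.
have -> : wgrad i v = (fun x => sc * (v (x + s i) + -1 * v x)).
  by apply/funext => x; rewrite mulN1r.
rewrite iter_walkZ iter_walkD iter_walkZ iter_walkT; apply/funext => x.
by rewrite /wgrad mulN1r.
Qed.

Lemma iter_walk_foldr j v es :
  iter j A (foldr wgrad v es) = foldr wgrad (iter j A v) es.
Proof. by elim: es => [//|e es /= <-]; rewrite iter_walk_wgrad. Qed.

(** Laziness is the point. The variance is S - m^2 with S = sum p d^2 and m = sum p d; as the jumps
    have total mass at most 1/2, Cauchy-Schwarz gives m^2 <= S / 2, and the remaining S / 2
    dominates each single p_i d_i^2 / 2. *)
Lemma walk_variance i v x :
  kappa * wgrad i v x ^+ 2 <= A (sq v) x - A v x ^+ 2.
Proof.
pose d i := v (x + s i) - v x; pose m := \sum_i p i * d i.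
pose S := \sum_i p i * d i ^+ 2; pose P := \sum_i p i.
have P0 : 0 <= P by apply: sumr_ge0.
have -> : A (sq v) x - A v x ^+ 2 = S - m ^+ 2.
  have -> : A (sq v) x = v x ^+ 2 + (2 * v x * m + S).
    rewrite /walk /m /S mulr_sumr -big_split/=; congr (_ + _).
    by apply: eq_bigr => k _; rewrite /d; ring.
  by have -> : A v x = v x + m by []; ring.
(* Cauchy-Schwarz written as a nonnegative sum of squares; with P <= 1/2 it reads 2 m^2 <= S. *)
have : 0 <= S - 4 * m ^+ 2 + 4 * m ^+ 2 * P.
  have -> : S - 4 * m ^+ 2 + 4 * m ^+ 2 * P = \sum_i p i * (d i - 2 * m) ^+ 2.
    rewrite (eq_bigr (fun i => p i * d i ^+ 2 + (- 4 * m) * (p i * d i) +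
      4 * m ^+ 2 * p i)); last by move=> k _; ring.
    by rewrite !big_split/= -!mulr_sumr -/m -/S -/P; ring.
  by apply: sumr_ge0 => k _; rewrite mulr_ge0 ?sqr_ge0.
have : m ^+ 2 * P <= m ^+ 2 * 2^-1 by rewrite ler_wpM2l ?sqr_ge0.
have : p i * d i ^+ 2 <= S.
  rewrite /S (bigD1 i)//= lerDl; apply: sumr_ge0 => k _.
  by rewrite mulr_ge0 ?sqr_ge0.
have : kappa * wgrad i v x ^+ 2 <= p i * d i ^+ 2 / 2.
  by rewrite /wgrad -/(d i) exprMn mulrA [leRHS]mulrAC ler_wpM2r ?sqr_ge0.
lra.
Qed.

Lemma walk_sq v x : A v x ^+ 2 <= A (sq v) x.
Proof.
case: (pickP (@predT I)) => [i _|I0].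
  rewrite -subr_ge0; apply: le_trans (walk_variance i v x).
  by rewrite mulr_ge0 ?sqr_ge0.
by rewrite /walk !big_pred0// ?addr0// => i; have := I0 i.
Qed.

Lemma iter_walk_sq j v x : iter j A v x ^+ 2 <= iter j A (sq v) x.
Proof.
elim: j x => [//|j IH] x /=; apply: le_trans (walk_sq _ _) _.
exact: walk_le.
Qed.

(* The Bakry-Emery argument: [wgrad i] commutes with the walk, so that by
   convexity the variance created at each of the [j] steps is at least the
   square of the gradient after all of them. *)
Lemma walk_gradient j i v x :
  j.+1%:R * kappa * wgrad i (iter j A v) x ^+ 2 <=
  iter j.+1 A (sq v) x - iter j.+1 A v x ^+ 2.
Proof.
elim: j x => [|j IH] x.
  by rewrite mul1r; exact: walk_variance.
have H1 := walk_variance i (iter j.+1 A v) x.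
have H2 : j.+1%:R * kappa * wgrad i (iter j.+1 A v) x ^+ 2 <=
    A (fun y => iter j.+1 A (sq v) y - iter j.+1 A v y ^+ 2) x.
  apply: le_trans (walk_le x IH); rewrite walkZ ler_wpM2l ?mulr_ge0//.
  have -> : wgrad i (iter j.+1 A v) = A (wgrad i (iter j A v)).
    exact: esym (iter_walk_wgrad 1 i (iter j A v)).
  exact: walk_sq.
move: H2; have -> : (fun y => iter j.+1 A (sq v) y - iter j.+1 A v y ^+ 2) =
   (fun y => iter j.+1 A (sq v) y + -1 * iter j.+1 A v y ^+ 2).
  by apply/funext => y; rewrite mulN1r.
rewrite walkD walkZ [j.+2%:R]mulrS => H2.
rewrite 2!mulrDl mul1r; move: H1 H2 => /=; lra.
Qed.

(** [walk_gradient] is applied once per difference, each time with [q] steps of its own. It bounds a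
    gradient after [q] steps by a mean over [q + 1] steps, whence the [size es] additional steps on
    the right. *)
Lemma walk_gradients q es v x :
  (q.+1%:R * kappa) ^+ size es *
    foldr wgrad (iter (size es * q) A v) es x ^+ 2 <=
  iter (size es * q + size es) A (sq v) x.
Proof.
elim: es x => [|e es IH] x; first by rewrite /= mul1r.
rewrite (_ : size (e :: es) = (size es).+1)//.
move: IH; set k := size es => IH.
rewrite mulSn iterD [foldr _ _ _]/= -iter_walk_foldr.
rewrite (_ : (q + k * q + k.+1 = q.+1 + (k * q + k))%N); last by lia.
move: IH; set W := foldr _ _ _ => IH.
rewrite iterD exprS.
have : iter q.+1 A (fun y => (q.+1%:R * kappa) ^+ k * W y ^+ 2) x <=
   iter q.+1 A (iter (k * q + k) A (sq v)) x by apply: iter_walk_le.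
rewrite iter_walkZ; apply: le_trans.
rewrite mulrAC mulrC ler_wpM2l ?exprn_ge0 ?mulr_ge0//.
apply: le_trans (walk_gradient q e W x) _.
by rewrite gerBl sqr_ge0.
Qed.

(** The [j] steps are shared equally among the k differences, [q = j %/ k] each; the remaining
    [j %% k] steps are moved onto the square of [v] by Jensen's inequality. The weight is right
    because q + 1 >= (j + 1) / k. *)
Lemma walk_gradients_all j es v x : (0 < size es)%N ->
  (j.+1%:R * kappa / (size es)%:R) ^+ size es *
    foldr wgrad (iter j A v) es x ^+ 2 <=
  iter (j + size es) A (sq v) x.
Proof.
move=> k0; set k := size es in k0 *; pose q := (j %/ k)%N; pose r := (j %% k)%N.
have jE : j = (k * q + r)%N by rewrite mulnC -divn_eq.
have -> : (j + k = k * q + k + r)%N by lia.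
have -> : iter j A v = iter (k * q) A (iter r A v) by rewrite jE iterD.
rewrite iterD.
have le1 : iter (k * q + k) A (sq (iter r A v)) x <=
    iter (k * q + k) A (iter r A (sq v)) x.
  by apply: iter_walk_le => y; exact: iter_walk_sq.
apply: le_trans le1; apply: le_trans (walk_gradients q es (iter r A v) x).
rewrite -/k ler_wpM2r ?sqr_ge0// lerXn2r ?nnegrE ?mulr_ge0 ?invr_ge0//.
rewrite mulrAC ler_wpM2r// ler_pdivrMr ?ltr0n// -natrM ler_nat.
exact: ltn_ceil.
Qed.

End Walk.

(** * The discrete torus and its distance *)

Section Lattice.
Variables (n N : nat).
Hypothesis N0 : (0 < N)%N.

Lemma modNE (k : int) : modN N k = `|(k %% N%:Z)%Z|%N :> nat.
Proof.
rewrite /modN /= prednK// modn_small// -ltz_nat gez0_abs ?modz_ge0 ?ltz_pmod//.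
by rewrite -lt0n.
Qed.

Lemma modN_eq (k l : int) : (k = l %[mod N%:Z])%Z -> modN N k = modN N l.
Proof. by rewrite /modN => ->. Qed.

Lemma modN_ord (x : 'I_N.-1.+1) : modN N (x : nat)%:Z = x.
Proof.
apply: ord_inj; rewrite modNE.
by rewrite modz_small//= ltz_nat -{2}(prednK N0) ltn_ord.
Qed.

Lemma modND : {morph modN N : k l / k + l}.
Proof.
move=> k l; rewrite -[RHS]modN_ord; apply: modN_eq.
have -> : nat_of_ord (modN N k + modN N l) =
  ((modN N k + modN N l) %% N.-1.+1)%N by [].
rewrite !modNE prednK// -modz_nat PoszD.
have N1 : N%:Z != 0 by rewrite -lt0n.
by rewrite !gez0_abs ?modz_ge0// modzDm modz_mod.
Qed.

Lemma lattD : {morph @latt n N : k l / k + l}.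
Proof. by move=> k l; apply/rowP => i; rewrite !mxE modND. Qed.

Lemma latt0 : latt N 0 = 0 :> lattice n N.
Proof. by apply: (addrI (latt N 0)); rewrite -lattD !addr0. Qed.

Lemma lattN : {morph @latt n N : k / - k}.
Proof. by move=> k; apply: (addrI (latt N k)); rewrite -lattD !subrr latt0. Qed.

Lemma dvec_dopp (e : dir n) : dvec (dopp e) = - dvec e.
Proof.
apply/rowP => i; rewrite !mxE; case: ifP => _; last by rewrite oppr0.
by case: e => ? [].
Qed.

(** The representative in (-N/2, N/2]. Its minimality, [lrep_min], is what bounds [sqdist] by the
    square of any lift. *)
Definition lrep (x : 'I_N.-1.+1) : int :=
  if (x.*2 <= N)%N then (x : nat)%:Z else (x : nat)%:Z - N%:Z.

Lemma lrepK : cancel lrep (modN N).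
Proof.
move=> x; rewrite -[RHS]modN_ord /lrep; case: ifP => // _; apply: modN_eq.
by rewrite addrC -mulN1r modzMDl.
Qed.

Lemma lrep_min (z : int) : `|lrep (modN N z)| <= `|z|.
Proof.
have := divz_eq z N; set q := (z %/ N)%Z => zE.
have r0 : 0 <= (z %% N)%Z by rewrite modz_ge0 -?lt0n.
have rN : (z %% N)%Z < N by rewrite ltz_pmod.
rewrite /lrep modNE; move: r0 rN zE; case: (z %% N)%Z => // r _ rN zE.
have : 0 <= q * N \/ q * N <= - N%:Z.
  by have [q0|q0] := leP 0 q; [left|right]; nia.
by move: zE; move: (q * N) => w -> hw /=; case: ifP => h; lia.
Qed.

Definition lvec (x : lattice n N) : 'rV[int]_n := map_mx lrep x.

Lemma lvecK : cancel lvec (@latt n N).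
Proof. by move=> x; apply/rowP => i; rewrite !mxE lrepK. Qed.

End Lattice.

Section SquaredDistance.
Variables (R : realType) (n N : nat).
Hypothesis N0 : (0 < N)%N.

Local Notation E e := (@latt n N (dvec e)).

Lemma lshift_dopp (e : dir n) : E (dopp e) = - E e.
Proof. by rewrite dvec_dopp lattN. Qed.

Lemma lshiftVK (x : lattice n N) e : lat_shift (lat_shift x (dopp e)) e = x.
Proof. by rewrite /lat_shift lshift_dopp subrK. Qed.

Definition sqdist (y : lattice n N) : R :=
  \sum_i ((lrep (y 0 i))%:~R / N%:R) ^+ 2.

Lemma sqdist_ge0 y : 0 <= sqdist y.
Proof. by apply: sumr_ge0 => i _; rewrite sqr_ge0. Qed.

Lemma sqdist_latt (z : 'rV[int]_n) :
  sqdist (latt N z) <= \sum_i ((z 0 i)%:~R / N%:R) ^+ 2.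
Proof.
apply: ler_sum => i _; rewrite !expr_div_n ler_wpM2r ?invr_ge0 ?sqr_ge0//.
rewrite mxE -[leLHS]real_normK ?num_real// -[leRHS]real_normK ?num_real//.
rewrite lerXn2r ?nnegrE//.
by rewrite -!intr_norm ler_int lrep_min.
Qed.

Lemma sqdist0 : sqdist 0 = 0.
Proof.
apply/le_anti; rewrite sqdist_ge0 andbT -(latt0 n N0).
apply: le_trans (sqdist_latt _) _.
by rewrite big1// => i _; rewrite mxE mul0r expr0n.
Qed.

Lemma sqdistE y : sqdist y = \sum_i ((lvec y 0 i)%:~R / N%:R) ^+ 2.
Proof. by apply: eq_bigr => i _; rewrite mxE. Qed.

Lemma sum_dvec (e : dir n) : \sum_i ((dvec e 0 i)%:~R : R) ^+ 2 = 1.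
Proof.
rewrite (bigD1 e.1)//= !mxE eqxx big1 ?addr0 => [|i /negbTE ie].
  by case: e.2; rewrite /= ?rmorphN ?sqrrN expr1n.
by rewrite mxE ie expr0n.
Qed.

(* The square of the distance to [0] is a minimum of quadratic functions, one
   for each lift, hence semiconcave; this bounds its discrete Laplacian. *)
Lemma sqdist_semiconcave y e :
  sqdist (y + E e) + sqdist (y - E e) <= 2 * sqdist y + 2 / N%:R ^+ 2.
Proof.
have := sqdist_latt (lvec y + dvec e); have := sqdist_latt (lvec y - dvec e).
rewrite !lattD// lattN// lvecK// => H1 H2.
apply: le_trans (lerD H2 H1) _; rewrite -big_split/= sqdistE mulr_sumr.
have -> : 2 / N%:R ^+ 2 = \sum_i 2 / N%:R ^+ 2 * ((dvec e 0 i)%:~R : R) ^+ 2.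
  by rewrite -mulr_sumr sum_dvec mulr1.
rewrite -big_split/=.
apply: ler_sum => i _.
rewrite [(lvec y + _) _ _]mxE [(lvec y - _) _ _]mxE [(- dvec e) _ _]mxE.
by rewrite !rmorphD rmorphN/= !expr_div_n; lra.
Qed.

Lemma sqdistD y z : sqdist (y + z) <= 2 * (sqdist y + sqdist z).
Proof.
have := sqdist_latt (lvec y + lvec z); rewrite lattD// !lvecK//.
move=> /le_trans; apply; rewrite !sqdistE -big_split mulr_sumr/=.
apply: ler_sum => i _; rewrite [(lvec y + _) _ _]mxE rmorphD/=.
set p := (lvec y 0 i)%:~R; set q := (lvec z 0 i)%:~R; rewrite mulrDl.
have := sqr_ge0 (p / N%:R - q / N%:R); lra.
Qed.

Lemma lshiftMn (e : dir n) k : E e *+ k = latt N (dvec e *+ k).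
Proof. by elim: k => [|k IH]; rewrite ?mulr0n ?latt0// !mulrS lattD// IH. Qed.

Lemma sqdist_line e k : sqdist (E e *+ k) <= (k%:R / N%:R) ^+ 2.
Proof.
rewrite lshiftMn; apply: le_trans (sqdist_latt _) _.
rewrite -[leRHS]mulr1 -[X in _ * X](sum_dvec e) mulr_sumr; apply: ler_sum => i _.
by rewrite mulmxnE rmorphMn/= -exprMn -mulr_natl mulrAC.
Qed.

Lemma tdist_ge0 (p q : torus R n) : 0 <= tdist p q.
Proof.
rewrite /tdist; set S := [set _ | _ in _]%classic.
have [S0|/set0P S0] := eqVneq S set0; first by rewrite S0 inf0.
by apply: lb_le_inf => // _ [? _ <-]; rewrite sqrtr_ge0.
Qed.

Lemma tdist_le (p q : 'rV[R]_n) : tdist (to_torus p) (to_torus q) <= enorm (p - q).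
Proof.
apply: ge_inf; last by exists (p, q).
by exists 0 => _ [? _ <-]; rewrite sqrtr_ge0.
Qed.

Lemma to_torus_eq (p q : 'rV[R]_n) (k : 'rV[int]_n) :
  p = q + map_mx intr k -> to_torus p = to_torus q.
Proof. by move=> pq; apply/eqmodP/asboolP; exists k. Qed.

Lemma tdist_lpoint (x y : lattice n N) :
  tdist (lpoint R x) (lpoint R (x + y)) <= Num.sqrt (sqdist y).
Proof.
pose p : 'rV[R]_n := \row_i ((x 0 i : nat)%:R / N%:R).
(* A lift of [x + y] reached from [p] by the shortest displacement; it differs from the lift by
   residues by an integer vector. *)
pose q : 'rV[R]_n := \row_i (p 0 i + (lrep (y 0 i))%:~R / N%:R).
have Nn0 : N%:R != 0 :> R by rewrite pnatr_eq0 -lt0n.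
have -> : lpoint R (x + y) = to_torus q.
  pose z i : int := (x 0 i : nat)%:Z + lrep (y 0 i).
  apply: (@to_torus_eq _ _ (\row_i - (z i %/ N%:Z)%Z)).
  apply/rowP => i; rewrite !mxE.
  have -> : x 0 i + y 0 i = modN N (z i) by rewrite modND// lrepK// modN_ord.
  rewrite modNE// pmulrn gez0_abs ?modz_ge0 -?lt0n//.
  have -> : (z i %% N)%Z = z i - (z i %/ N)%Z * N by rewrite {2}(divz_eq (z i) N) addrC addKr.
  by rewrite /z !rmorphD rmorphN rmorphM/= !mulrDl mulNr mulfK//  rmorphN.
apply: le_trans (tdist_le _ _) _; rewrite /enorm ler_sqrt ?sqdist_ge0//.
apply: ler_sum => i _; rewrite !mxE.
by rewrite opprD addrA subrr add0r sqrrN.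
Qed.

End SquaredDistance.

(** * Frozen coefficients *)

Section Powers.
Variable R : realType.
Implicit Types x y al : R.

Lemma powR_le1D x al : 0 <= x -> 0 <= al <= 1 -> x `^ al <= 1 + x.
Proof.
move=> x0 /andP[al0 al1]; have [x1|x1] := leP x 1.
  apply: (@le_trans _ _ 1); last by rewrite lerDl.
  by have := ge0_ler_powR al0 x0 ler01 x1; rewrite powR1.
apply: (@le_trans _ _ x); last by rewrite lerDr.
by apply: ler1_powR => //; exact: ltW.
Qed.

Lemma powR_half_sq x al : (x `^ (al / 2)) ^+ 2 = x `^ al.
Proof. by rewrite -powR_mulrn ?powR_ge0// -powRrM divfK. Qed.

Lemma powR_sqr_half x al : 0 <= x -> (x ^+ 2) `^ (al / 2) = x `^ al.
Proof. by move=> x0; rewrite -powR_mulrn// -powRrM mulrC divfK. Qed.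

End Powers.

Section Frozen.
Variables (R : realType) (n N : nat) (cm cp : R) (c : dir n -> R) (h : R).
Hypothesis N0 : (0 < N)%N.
Hypothesis cm0 : 0 < cm.
Hypothesis c_sym : forall e, c (dopp e) = c e.
Hypothesis c_ge : forall e, cm <= c e.
Hypothesis c_le : forall e, c e <= cp.
Hypothesis h0 : 0 < h.
Hypothesis h_small : h * (4 * n%:R * cp * N%:R ^+ 2) <= 1.

Local Notation E e := (@latt n N (dvec e)).

(* An explicit Euler step of the heat equation with constant coefficients [c];
   for small [h] it is a lazy random walk. *)
Definition step : (lattice n N -> R) -> lattice n N -> R :=
  walk (fun e : dir n => E e) (fun e => h * N%:R ^+ 2 * c e).

Lemma stepE v x : step v x = v x + h * LN (fun=> c) v x.
Proof.
rewrite /step /walk /LN !mulr_sumr; congr (_ + _).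
by apply: eq_bigr => e _; rewrite !mulrA.
Qed.

Lemma NN_gt0 : 0 < N%:R :> R. Proof. by rewrite ltr0n. Qed.

Let p_ge0 e : 0 <= h * N%:R ^+ 2 * c e.
Proof.
by rewrite !mulr_ge0 ?exprn_ge0// ?(ltW h0)// (le_trans _ (c_ge e))// ltW.
Qed.

Lemma sum_p_le : \sum_(e : dir n) h * N%:R ^+ 2 * c e <= h * (2 * n%:R * cp * N%:R ^+ 2).
Proof.
apply: (@le_trans _ _ (\sum_(e : dir n) h * N%:R ^+ 2 * cp)).
  by apply: ler_sum => e _; rewrite ler_wpM2l// mulr_ge0 ?exprn_ge0// ltW.
by rewrite sumr_const card_prod card_ord card_bool -[leLHS]mulr_natr natrM; lra.
Qed.

Let p_half : \sum_(e : dir n) h * N%:R ^+ 2 * c e <= 2^-1.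
Proof. by have := sum_p_le; have := h_small; lra. Qed.

Let kappa : R := h * cm / 2.

Let kappa_ge0 : 0 <= kappa.
Proof. by rewrite /kappa !mulr_ge0 ?invr_ge0// ltW. Qed.

Let kappa_le (e : dir n) : kappa * N%:R ^+ 2 <= h * N%:R ^+ 2 * c e / 2.
Proof.
have -> : kappa * N%:R ^+ 2 = h * N%:R ^+ 2 * cm / 2 by rewrite /kappa; lra.
by rewrite ler_pM2r ?invr_gt0// ler_wpM2l// mulr_ge0 ?exprn_ge0// ltW.
Qed.

Lemma step_le v w x j : (forall y, v y <= w y) -> iter j step v x <= iter j step w x.
Proof. exact: iter_walk_le. Qed.

Lemma iter_step_bounded v k j x :
  (forall y, `|v y| <= k) -> `|iter j step v x| <= k.
Proof.
move=> vk; have const := @iter_walkC R _ _ (fun e : dir n => E e)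
  (fun e => h * N%:R ^+ 2 * c e) j.
have lo := @step_le (fun=> - k) v x j; have up := @step_le v (fun=> k) x j.
rewrite ler_norml; move: lo up; rewrite /step !const => lo up.
by rewrite lo ?up// => y; have := vk y; rewrite ler_norml => /andP[].
Qed.

(** One step raises the mean of [sqdist] by at most 2 n cp h: pairing [e] with [dopp e], which carry
    equal coefficients, turns the increment into second differences, and semiconcavity bounds
    these. *)
Lemma moment j x :
  iter j step (fun y => sqdist R (y - x)) x <= 2 * n%:R * cp * h * j%:R.
Proof.
rewrite iter_walkT subrr; elim: j => [|j IH].
  by rewrite mulr0 /= sqdist0.
apply: (@le_trans _ _ (iter j step (fun y => sqdist R y + 2 * n%:R * cp * h) 0)).
  rewrite iterSr; apply: step_le => y; rewrite /step /walk lerD2l.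
  set p := fun e : dir n => h * N%:R ^+ 2 * c e.
  set S := \sum_i _.
  have S2 : S + S <= \sum_e p e * (2 / N%:R ^+ 2).
    rewrite {2}/S (reindex_inj (inv_inj (_ : involutive (@dopp n)))); last first.
      by move=> [i b]; rewrite /dopp/= negbK.
    rewrite -big_split/=; apply: ler_sum => e _.
    rewrite c_sym -/(p e) -mulrDr ler_wpM2l//; first exact: p_ge0.
    have := sqdist_semiconcave R N0 y e; rewrite lshift_dopp//; lra.
  have : \sum_e p e * (2 / N%:R ^+ 2) <= 2 * (2 * n%:R * cp * h).
    rewrite -mulr_suml [leLHS]mulrA ler_pdivrMr ?exprn_gt0 ?NN_gt0//; have := sum_p_le; rewrite -/p; lra.
  lra.
rewrite (iter_walkD _ _ _ _ (fun=> 2 * n%:R * cp * h)) iter_walkC -[j.+1%:R]natr1.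
by rewrite mulrDr mulr1 lerD2r.
Qed.

Lemma foldr_lgrad_shift (v : lattice n N -> R) (es : seq (dir n)) cst :
  (0 < size es)%N ->
  foldr (@lgrad R n N) (fun x => v x - cst) es = foldr (@lgrad R n N) v es.
Proof.
case/lastP: es => // es e _; rewrite !foldr_rcons; congr foldr.
by apply/funext => x; rewrite /lgrad; ring.
Qed.

(** The factor (2 k / cm)^k inverts the weight in [walk_gradients_all] for kappa = h cm / 2. The
    factor 2 (2 + 2 n cp k) bounds the mean square of the data, its last summand being the moment
    after j + k <= k (j + 1) steps. *)
Definition Kgrad (k : nat) : R :=
  Num.sqrt ((2 * k%:R / cm) ^+ k * (2 * (2 + 2 * n%:R * cp * k%:R))).

Lemma Kgrad_ge0 k : 0 <= Kgrad k. Proof. exact: sqrtr_ge0. Qed.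

(** Within time [tau] the walk spreads over a distance of order sqrt tau, so data of this form have
    mean square of order K^2 tau^al, a gain of tau^(al/2) over bounded data. A constant [cst] may be
    subtracted because at least one difference is taken. Counting j + 1 steps keeps [tau] positive
    at j = 0. *)
Lemma frozen_gradient (es : seq (dir n)) j (b : lattice n N -> R) (x : lattice n N) (cst K al : R) : (0 < size es)%N ->
  0 <= al <= 1 -> 0 <= K ->
  let tau := j.+1%:R * h in
  (forall y, `|b y - cst| <= K * (sqdist R (y - x) `^ (al / 2) + tau `^ (al / 2))) ->
  `|foldr (@lgrad R n N) (iter j step b) es x| <=
    Kgrad (size es) * K * tau `^ ((al - (size es)%:R) / 2).
Proof.
move=> k0 al01 K0 tau bK; set k := size es in k0 *.
have tau0 : 0 < tau by rewrite mulr_gt0 ?ltr0n.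
have tauE : tau = j.+1%:R * h by []; clearbody tau.
have cp0 : 0 <= 2 * n%:R * cp.
  have [->|n0] := posnP n; first by rewrite mulr0 mul0r.
  rewrite !mulr_ge0//; apply: le_trans (c_le (Ordinal n0, true)).
  exact: le_trans (ltW cm0) (c_ge _).
pose b' := fun y => b y - cst.
have -> : foldr (@lgrad R n N) (iter j step b) es x =
          foldr (@lgrad R n N) (iter j step b') es x.
  rewrite /b' (iter_walkD _ _ _ _ (fun=> - cst)) iter_walkC.
  by rewrite (foldr_lgrad_shift _ cst).
have H := @walk_gradients_all R _ _ (fun e : dir n => E e) _ _ _ p_ge0 p_half
  kappa_ge0 kappa_le j es b' x k0.
rewrite -ler_sqr ?nnegrE ?mulr_ge0 ?powR_ge0 ?Kgrad_ge0// -normrX ger0_norm ?sqr_ge0//.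
rewrite !exprMn powR_half_sq /Kgrad sqr_sqrtr; last first.
  by rewrite mulr_ge0 ?exprn_ge0 ?divr_ge0 ?mulr_ge0// ?(ltW cm0)// addr_ge0// mulr_ge0.
have tauD : tau `^ (al - k%:R) = tau `^ al / tau ^+ k.
  by rewrite powRB ?(gt_eqF tau0) ?implybT// powR_mulrn// ltW.
have M : iter (j + k) step (fun y => b' y ^+ 2) x <=
    2 * K ^+ 2 * tau `^ al * (2 + 2 * n%:R * cp * k%:R).
  have C0 : 0 <= 2 * K ^+ 2 * tau `^ al.
    by rewrite !mulr_ge0 ?exprn_ge0 ?powR_ge0.
  apply: (@le_trans _ _ (iter (j + k) step (fun y => 2 * K ^+ 2 * tau `^ al *
     (2 + tau^-1 * sqdist R (y - x))) x)).
    apply: step_le => y; set D := sqdist R (y - x).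
    have D0 : 0 <= D by exact: sqdist_ge0.
    (* The power is replaced by an affine function of [D], so that the second moment suffices. *)
    have Dal : D `^ al <= tau `^ al * (1 + tau^-1 * D).
      rewrite -{1}[D](mulVKf (lt0r_neq0 tau0)) powRM ?mulr_ge0 ?invr_ge0 ?(ltW tau0)//.
      by rewrite ler_wpM2l ?powR_ge0// powR_le1D// mulr_ge0// invr_ge0 ltW.
    have b2 : b' y ^+ 2 <= (K * (D `^ (al / 2) + tau `^ (al / 2))) ^+ 2.
      rewrite -[leLHS]real_normK ?num_real// lerXn2r ?nnegrE//; last exact: bK.
      by rewrite mulr_ge0// addr_ge0 ?powR_ge0.
    apply: le_trans b2 _; rewrite exprMn.
    apply: (@le_trans _ _ (K ^+ 2 * (2 * (D `^ al + tau `^ al)))).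
      rewrite ler_wpM2l ?sqr_ge0// -(powR_half_sq D al) -(powR_half_sq tau al).
      by have := sqr_ge0 (D `^ (al / 2) - tau `^ (al / 2)); lra.
    rewrite mulrA [K ^+ 2 * 2]mulrC -[leRHS]mulrA ler_wpM2l ?mulr_ge0 ?sqr_ge0//.
    by move: Dal; lra.
  rewrite iter_walkZ ler_wpM2l// (iter_walkD _ _ _ (fun=> 2)) iter_walkC lerD2l.
  rewrite iter_walkZ; apply: (@le_trans _ _ (tau^-1 * (2 * n%:R * cp * h * (j + k)%:R))).
    by rewrite ler_wpM2l ?moment// invr_ge0 ltW.
  rewrite mulrC ler_pdivrMr// -[leLHS]mulrA -[leRHS]mulrA ler_wpM2l//.
  rewrite tauE mulrC mulrA ler_wpM2r ?(ltW h0)// -natrM ler_nat mulnS addnC.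
  by rewrite leq_add2l leq_pmull.
have q0 : 0 < tau * cm / (2 * k%:R) by rewrite divr_gt0 ?mulr_gt0 ?ltr0n.
have -> : (2 * k%:R / cm) ^+ k * (2 * (2 + 2 * n%:R * cp * k%:R)) * K ^+ 2 * tau `^ (al - k%:R) =
   (2 * K ^+ 2 * tau `^ al * (2 + 2 * n%:R * cp * k%:R)) / (tau * cm / (2 * k%:R)) ^+ k.
  rewrite tauD -[X in _ = _ * X]exprVn invf_div.
  have -> : 2 * k%:R / (tau * cm) = 2 * k%:R / cm / tau.
    by rewrite invfM mulrA mulrAC.
  by rewrite [(_ / tau) ^+ k]exprMn exprVn; ring.
rewrite ler_pdivlMr ?exprn_gt0// mulrC; apply: le_trans M.
suff <- : j.+1%:R * kappa / k%:R = tau * cm / (2 * k%:R) by [].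
by rewrite tauE /kappa invfM; ring.
Qed.

End Frozen.

(** * Sums of powers of the time *)

Section PowerSums.
Variable R : realType.
Implicit Types x y h r beta : R.

(** Young's inequality for the product of x^beta and 1, with weights beta and 1 - beta. *)
Lemma powR_bernoulli x beta : 0 <= x -> 0 < beta < 1 ->
  x `^ beta <= 1 - beta * (1 - x).
Proof.
move=> x0 /andP[b0 b1].
have b1' : 0 < 1 - beta by lra.
have := @conjugate_powR R (x `^ beta) 1 beta^-1 (1 - beta)^-1 (powR_ge0 _ _) ler01.
rewrite !invr_gt0 !invrK => /(_ b0 b1').
rewrite -powRrM divff ?gt_eqF// powRr1// powR1 mulr1 mul1r.
have E : beta + (1 - beta) = 1 by lra.
by move=> /(_ E); lra.
Qed.

Lemma powR_inv x beta : 0 <= x -> x^-1 `^ beta = (x `^ beta)^-1.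
Proof.
by move=> x0; rewrite -(powR_inv1 x0) powRAC powR_inv1 ?powR_ge0.
Qed.

(** The rectangle at the right end lies below the integral of the decreasing function t^(beta - 1)
    over [a, b]; the Bernoulli inequality at a / b replaces the integral. The case a = 0 is the
    first term of the sums below. *)
Lemma powR_tangent beta a b : 0 < beta < 1 -> 0 <= a <= b -> 0 < b ->
  (b - a) * b `^ (beta - 1) <= (b `^ beta - a `^ beta) / beta.
Proof.
move=> b01 /andP[a0 ab] b0.
have /andP[be0 be1] := b01.
rewrite ler_pdivlMr//.
have := powR_bernoulli (divr_ge0 a0 (ltW b0)) b01.
rewrite powRM ?invr_ge0// ?(ltW b0)// powR_inv ?(ltW b0)//.
have B0 : 0 < b `^ beta by rewrite powR_gt0.
rewrite ler_pdivrMr// => H.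
rewrite powRB ?(gt_eqF b0) ?implybT// powRr1 ?(ltW b0)//.
set P := b `^ beta in B0 H *.
have -> : (b - a) * (P / b) * beta = beta * (1 - a / b) * P.
  have -> : 1 - a / b = (b - a) / b by rewrite mulrBl divff ?gt_eqF.
  by ring.
by move: H; lra.
Qed.

Lemma powRN_tangent beta a b : 0 < beta < 1 -> 0 < a <= b ->
  (b - a) * b `^ (- beta - 1) <= (a `^ (- beta) - b `^ (- beta)) / beta.
Proof.
move=> b01 /andP[a0 ab].
have b0 : 0 < b by exact: lt_le_trans ab.
have /andP[be0 be1] := b01.
have A0 : 0 < a `^ beta by rewrite powR_gt0.
have B0 : 0 < b `^ beta by rewrite powR_gt0.
have := powR_bernoulli (ltW (divr_gt0 a0 b0)) b01.
rewrite powRM ?invr_ge0 ?(ltW b0) ?(ltW a0)// powR_inv ?(ltW b0)// => H.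
rewrite powRB ?(gt_eqF b0) ?implybT// powRr1 ?(ltW b0)// !powRN ler_pdivlMr//.
set P := b `^ beta in B0 H *; set Q := a `^ beta in A0 H *.
pose y := beta * (1 - a / b).
have -> : (b - a) * (P^-1 / b) * beta = y / P.
  have -> : y = beta * ((b - a) / b) by rewrite /y mulrBl divff ?gt_eqF.
  by ring.
have y0 : 0 <= y.
  by rewrite mulr_ge0 ?(ltW be0)// subr_ge0 ler_pdivrMr ?mul1r.
have Q1 : Q <= P * (1 - y) by rewrite mulrC -ler_pdivrMr.
suff : (1 + y) / P <= Q^-1 by rewrite mulrDl mul1r; lra.
rewrite ler_pdivrMr// mulrC ler_pdivlMr//.
apply: (@le_trans _ _ ((1 + y) * (P * (1 - y)))).
  by rewrite ler_wpM2l// addr_ge0.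
have : 0 <= y ^+ 2 * P by rewrite mulr_ge0 ?sqr_ge0// ltW.
by lra.
Qed.

(** The primitive truncated at [r] is still monotone, so the excluded indices contribute nonnegative
    increments and the whole sum telescopes. *)
Lemma powR_sum_low beta h r m : 0 < beta < 1 -> 0 < h -> 0 <= r ->
  \sum_(j < m | j.+1%:R * h <= r) h * (j.+1%:R * h) `^ (beta - 1) <= r `^ beta / beta.
Proof.
move=> b01 h0 r0; have /andP[be0 _] := b01.
pose F (j : nat) := (Num.min (j%:R * h) r) `^ beta / beta.
rewrite big_mkcond -(big_mkord xpredT (fun j => if j.+1%:R * h <= r
  then h * (j.+1%:R * h) `^ (beta - 1) else 0)).
apply: (@le_trans _ _ (\sum_(0 <= j < m) (F j.+1 - F j))).
  apply: ler_sum => j _.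
  have jh : j%:R * h <= j.+1%:R * h by rewrite ler_wpM2r ?(ltW h0)// ler_nat.
  have j0 : 0 <= j%:R * h by rewrite mulr_ge0 ?(ltW h0).
  rewrite /F -mulrBl; case: ifPn => jr.
    have := @powR_tangent beta (j%:R * h) (j.+1%:R * h) b01.
    rewrite j0 jh => /(_ isT); rewrite mulr_gt0 ?ltr0n// => /(_ isT).
    rewrite !min_l//; last exact: le_trans jr.
    by rewrite -mulrBl -natrB// subSnn mul1r.
  rewrite divr_ge0 ?(ltW be0)// subr_ge0 ge0_ler_powR ?nnegrE ?(ltW be0)//.
  - by rewrite le_min j0.
  - by rewrite le_min r0 (le_trans j0).
  - by rewrite le_min !ge_min lexx orbT jh.
rewrite telescope_sumr// /F mul0r [Num.min 0 r]min_l// powR0 ?gt_eqF// mul0r subr0.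
rewrite ler_wpM2r ?invr_ge0 ?(ltW be0)// ge0_ler_powR ?nnegrE ?(ltW be0)//.
  by rewrite le_min r0 mulr_ge0 ?(ltW h0).
by rewrite ge_min lexx orbT.
Qed.

Lemma powR_sum beta h m : 0 < beta < 1 -> 0 < h ->
  \sum_(j < m) h * (j.+1%:R * h) `^ (beta - 1) <= (m%:R * h) `^ beta / beta.
Proof.
move=> b01 h0; have := powR_sum_low m b01 h0 (mulr_ge0 (ler0n R m) (ltW h0)).
rewrite (eq_bigl xpredT)// => j.
by rewrite ler_wpM2r ?(ltW h0)// ler_nat.
Qed.

(** The half of [r] is the cost of an off-by-one: the first time beyond [r] ends an interval that
    starts only above r - h >= r / 2, and the decreasing primitive is evaluated at that start. *)
Lemma powR_sum_high beta h r m : 0 < beta < 1 -> 0 < h -> 2 * h <= r ->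
  \sum_(j < m | ~~ (j.+1%:R * h <= r)) h * (j.+1%:R * h) `^ (- beta - 1) <=
    (r / 2) `^ (- beta) / beta.
Proof.
move=> b01 h0 hr; have /andP[be0 _] := b01.
have r0 : 0 < r / 2 by lra.
pose F (j : nat) := (Num.max (j%:R * h) (r / 2)) `^ (- beta) / beta.
rewrite big_mkcond -(big_mkord xpredT (fun j => if ~~ (j.+1%:R * h <= r)
  then h * (j.+1%:R * h) `^ (- beta - 1) else 0)).
have F0 j : 0 <= F j by rewrite /F divr_ge0 ?powR_ge0// ltW.
apply: (@le_trans _ _ (- \sum_(0 <= j < m) (F j.+1 - F j))).
  rewrite -sumrN; apply: ler_sum => j _; rewrite opprB.
  have jh : j%:R * h <= j.+1%:R * h by rewrite ler_wpM2r ?(ltW h0)// ler_nat.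
  have jhE : j.+1%:R * h = j%:R * h + h by rewrite -natr1 mulrDl mul1r.
  rewrite /F -mulrBl; case: ifPn => jr.
    have jr' : r / 2 <= j%:R * h by move: jr; rewrite -ltNge jhE; lra.
    have := @powRN_tangent beta (j%:R * h) (j.+1%:R * h) b01.
    rewrite (lt_le_trans r0 jr') jh => /(_ isT).
    rewrite !max_l//; last exact: le_trans jh.
    by rewrite -mulrBl -natrB// subSnn mul1r.
  rewrite divr_ge0 ?(ltW be0)// subr_ge0 !powRN lef_pV2 ?posrE ?powR_gt0 ?lt_max ?r0 ?orbT//.
  have max0 x : 0 <= Num.max x (r / 2) by rewrite le_max (ltW r0) orbT.
  rewrite ge0_ler_powR ?nnegrE ?(ltW be0)//.
  by rewrite ge_max !le_max jh lexx orbT.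
have -> : (r / 2) `^ (- beta) / beta = F 0%N by rewrite /F mul0r max_r// ltW.
by rewrite telescope_sumr// opprB gerBl.
Qed.

(** The implication is applied to the supremum of [S], finite by the boundedness hypothesis, and
    yields sup S <= sup S / 2 + K. *)
Lemma absorb (S : set R) (K : R) : 0 <= K ->
  (forall M, 0 <= M -> (forall y, S y -> y <= M) -> forall y, S y -> y <= M / 2 + K) ->
  (exists M, forall y, S y -> y <= M) ->
  forall y, S y -> y <= 2 * K.
Proof.
move=> K0 H [M0 M0S] y Sy.
have [y0|y0] := leP y 0; first by rewrite (le_trans y0)// mulr_ge0.
have hs : has_sup S by split; [exists y|exists M0 => z /M0S].
have yS z : S z -> z <= sup S by move=> Sz; apply: sup_upper_bound.
have s0 : 0 <= sup S by rewrite (le_trans (ltW y0))// yS.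
have : sup S <= sup S / 2 + K.
  by apply: ge_sup => [|z Sz]; [exists y|exact: H].
have := yS _ Sy; lra.
Qed.

End PowerSums.

(** * Difference quotients and Duhamel's formula *)

Section Gradients.
Variables (R : realType) (n N : nat).
Hypothesis N0 : (0 < N)%N.
Implicit Types (v w : lattice n N -> R) (x : lattice n N) (es : seq (dir n)).

Local Notation E e := (@latt n N (dvec e)).
Local Notation grads v es := (foldr (@lgrad R n N) v es).

Lemma sum_dir (V : nmodType) (F : dir n -> V) :
  \sum_e F e = \sum_i (F (i, true) + F (i, false)).
Proof.
rewrite (eq_bigr (fun e => F (e.1, e.2))); last by case.
rewrite -(pair_bigA _ (fun i b => F (i, b)))/=.
by apply: eq_bigr => i _; rewrite big_bool.
Qed.

(** Symmetry rewrites the conductance of the negative direction at [x] as that of the positive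
    direction at the neighbour of [x]; [lgrad (i, false)] is then the adjoint difference. *)
Lemma LN_divergence (a : lattice n N -> dir n -> R) v x :
  (forall x e, a x e = a (lat_shift x e) (dopp e)) ->
  LN a v x = - \sum_i lgrad (i, false)
    (fun y => a y (i, true) * lgrad (i, true) v y) x.
Proof.
move=> asym; rewrite /LN sum_dir mulr_sumr -sumrN; apply: eq_bigr => i _.
rewrite (asym x (i, false)) /lgrad /dopp/=.
have -> : lat_shift (lat_shift x (i, false)) (i, true) = x.
  exact: (lshiftVK N0 x (i, true)).
ring.
Qed.

Lemma gradsD v w es x : grads (fun y => v y + w y) es x = grads v es x + grads w es x.
Proof.
elim: es x => [//|e es IH] x /=; rewrite /lgrad !IH; ring.
Qed.

Lemma gradsZ k v es x : grads (fun y => k * v y) es x = k * grads v es x.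
Proof.
elim: es x => [//|e es IH] x /=; rewrite /lgrad !IH; ring.
Qed.

Lemma grads_sum (I : finType) (F : I -> lattice n N -> R) es x :
  grads (fun y => \sum_i F i y) es x = \sum_i grads (F i) es x.
Proof.
elim: es x => [//|e es IH] x /=; rewrite /lgrad !IH -sumrB mulr_sumr.
by [].
Qed.

(** The factor grows with N; the bound serves to make a supremum finite before it is absorbed. *)
Lemma grads_le v es L : (forall y, `|v y| <= L) ->
  forall x, `|grads v es x| <= (2 * N%:R) ^+ size es * L.
Proof.
move=> vL; elim: es => [|e es IH] x; first by rewrite mul1r.
rewrite [size _]/= exprS /= /lgrad normrM normr_nat.
have -> : 2 * N%:R * (2 * N%:R) ^+ size es * L =
  N%:R * (2 * ((2 * N%:R) ^+ size es * L)) by ring.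
rewrite ler_wpM2l//.
apply: le_trans (ler_normB _ _) _.
have := IH (lat_shift x e); have := IH x; lra.
Qed.

Lemma lgrad_path_le v x e k L : (forall i, (i < k)%N -> `|lgrad e v (x + E e *+ i)| <= L) ->
  `|v (x + E e *+ k) - v x| <= k%:R / N%:R * L.
Proof.
elim: k => [|k IH] vL; first by rewrite mulr0n addr0 subrr normr0 !mul0r.
have -> : v (x + E e *+ k.+1) - v x = N%:R^-1 * lgrad e v (x + E e *+ k) +
    (v (x + E e *+ k) - v x).
  rewrite /lgrad mulrA mulVf ?pnatr_eq0 -?lt0n// mul1r.
  by rewrite /lat_shift mulrSr addrA addrA subrK.
rewrite -natr1 !mulrDl mul1r addrC; apply: le_trans (ler_normD _ _) _.
rewrite lerD//.
  by rewrite IH// => i ik; apply: vL; exact: ltnW.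
by rewrite normrM ger0_norm ?invr_ge0// ler_wpM2l ?invr_ge0// vL.
Qed.

(* Join the two points by [n] segments parallel to the axes. *)
Lemma line_to_all (v : lattice n N -> R) M al : 0 <= al ->
  (forall x e k, `|v (x + E e *+ k) - v x| <= M * (k%:R / N%:R) `^ al) ->
  forall x y, `|v (x + y) - v x| <= n%:R * M * sqdist R y `^ (al / 2).
Proof.
move=> al0 vM x y; set D := sqdist R y.
have M0 : 0 <= M \/ n = 0%N.
  have [n0|n0] := posnP n; [by right|left].
  have := vM x (Ordinal n0, true) N.
  rewrite divff ?powR1 ?pnatr_eq0 -?lt0n// mulr1; exact: le_trans.
pose z (i : 'I_n) : lattice n N := \row_j (if j == i then y 0 i else 0).
have yE : y = \sum_i z i.
  apply/rowP => j; rewrite summxE (bigD1 j)//= mxE eqxx big1 ?addr0//.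
  by move=> i ij; rewrite mxE eq_sym (negbTE ij).
have zM i x' : `|v (x' + z i) - v x'| <= M * D `^ (al / 2).
  have [M0'|n0] := M0; last first.
    by have := leq_ltn_trans (leq0n i) (ltn_ord i); lia.
  (* The walk along axis [i] follows the sign of the shortest lift, for as many steps as its
     absolute value. *)
  have [e zE] : exists e : dir n, z i = E e *+ absz (lrep (y 0 i)).
    exists (i, 0 <= lrep (y 0 i)); rewrite lshiftMn//; apply/rowP => j.
    rewrite mxE [RHS]mxE mulmxnE mxE/=; case: (eqVneq j i) => [_|_]; last first.
      by rewrite mul0rn; apply: ord_inj; rewrite modNE// mod0z.
    rewrite -[LHS](lrepK N0); congr modN.
    by case: ifP => h; rewrite ?mulNrn ?natz; lia.
  rewrite zE; apply: le_trans (vM _ _ _) _; rewrite ler_wpM2l//.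
  rewrite [al / 2]mulrC powRrM powR12_sqrt ?sqdist_ge0//.
  rewrite ge0_ler_powR ?nnegrE ?sqrtr_ge0//.
  rewrite -[leLHS]ger0_norm ?divr_ge0// -sqrtr_sqr ler_sqrt ?sqdist_ge0//.
  rewrite /D /sqdist (bigD1 i)//= !expr_div_n.
  have -> : ((absz (lrep (y 0 i)))%:R : R) ^+ 2 = (lrep (y 0 i))%:~R ^+ 2.
    by rewrite pmulrn abszE intr_norm real_normK ?num_real.
  by rewrite lerDl sumr_ge0// => k _; rewrite sqr_ge0.
rewrite yE -[n in n%:R]card_ord -sum1_card natr_sum !mulr_suml.
elim/big_rec2: _ => [|i y1 y2 _ IH]; first by rewrite addr0 subrr normr0.
rewrite [z i + _]addrC addrA.
have -> : v (x + y2 + z i) - v x = (v (x + y2 + z i) - v (x + y2)) + (v (x + y2) - v x).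
  ring.
by rewrite (le_trans (ler_normD _ _))// lerD// mul1r zM.
Qed.

End Gradients.

Section Duhamel.
Variables (R : realType) (n N : nat) (c : dir n -> R) (h : R).
Hypothesis N0 : (0 < N)%N.
Hypothesis c_sym : forall e, c (dopp e) = c e.
Hypothesis h0 : 0 < h.

Local Notation A := (@step R n N c h).
Local Notation grads v es := (foldr (@lgrad R n N) v es).

Lemma iter_step_grads j (v : lattice n N -> R) es :
  iter j A (grads v es) = grads (iter j A v) es.
Proof.
exact: (@iter_walk_foldr R _ _ (fun e => latt N (dvec e)) _ N%:R).
Qed.

Lemma iter_stepD j (v w : lattice n N -> R) x :
  iter j A (fun y => v y + w y) x = iter j A v x + iter j A w x.
Proof. by rewrite /step iter_walkD. Qed.

Lemma iter_stepZ j k (v : lattice n N -> R) x :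
  iter j A (fun y => k * v y) x = k * iter j A v x.
Proof. by rewrite /step iter_walkZ. Qed.

Lemma iter_step_sum (I : finType) (F : I -> lattice n N -> R) j x :
  iter j A (fun y => \sum_i F i y) x = \sum_i iter j A (F i) x.
Proof. by rewrite /step iter_walk_sum. Qed.

Lemma step_telescope (w : nat -> lattice n N -> R) m x :
  w 0%N x = iter m A (w m) x +
    \sum_(j < m) iter j A (fun y => w j y - A (w j.+1) y) x.
Proof.
elim: m => [|m IH]; first by rewrite big_ord0 addr0.
rewrite big_ord_recr/= IH.
have -> : (fun y => w m y - A (w m.+1) y) = (fun y => w m y + -1 * A (w m.+1) y).
  by apply/funext => y; rewrite mulN1r.
rewrite iter_stepD iter_stepZ -iterSr iterS; ring.
Qed.

Lemma step_sub_iter (v : lattice n N -> R) m x :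
  iter m A v x - v x =
  - \sum_(j < m) h * \sum_i c (i, true) * grads (iter j A v) [:: (i, false); (i, true)] x.
Proof.
have /= := step_telescope (fun=> v) m x; set S := \sum_(j < m) _ => ->.
rewrite opprD addrA subrr add0r; congr (- _); apply: eq_bigr => j _.
have -> : (fun y => v y - A v y) =
    (fun y => h * \sum_i c (i, true) * grads v [:: (i, false); (i, true)] y).
  apply/funext => y; rewrite stepE LN_divergence//.
  rewrite mulrN opprD opprK addrA subrr add0r; congr (_ * _).
  apply: eq_bigr => i _; rewrite /= /lgrad; ring.
rewrite iter_stepZ iter_step_sum; congr (_ * _); apply: eq_bigr => i _.
by rewrite iter_stepZ iter_step_grads.
Qed.

(** The index counts steps backwards in time. Each defect [w j - A (w j.+1)] is h times a source
    minus the divergence of the flux caused by replacing [a] with [c]. Since differences commute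
    with [A], that divergence becomes one more difference of the smoothed flux, and the coefficients
    are never differentiated. *)
Lemma duhamel (w : nat -> lattice n N -> R) (a : nat -> lattice n N -> dir n -> R)
    m es x :
  (forall j x e, a j x e = a j (lat_shift x e) (dopp e)) ->
  let b i j y := (a j y (i, true) - c (i, true)) * lgrad (i, true) (w j.+1) y in
  let g j y := (w j y - w j.+1 y) / h - LN (a j) (w j.+1) y in
  grads (w 0%N) es x = grads (iter m A (w m)) es x +
    \sum_(j < m) h * (grads (iter j A (g j)) es x -
      \sum_i grads (iter j A (b i j)) (rcons es (i, false)) x).
Proof.
move=> asym b g.
have -> : w 0%N = (fun x => iter m A (w m) x +
    \sum_(j < m) iter j A (fun y => w j y - A (w j.+1) y) x).
  by apply/funext => y; exact: step_telescope.
rewrite gradsD grads_sum; congr (_ + _); apply: eq_bigr => j _.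
have -> : (fun y => w j y - A (w j.+1) y) =
    (fun y => h * (g j y + -1 * \sum_i lgrad (i, false) (b i j) y)).
  apply/funext => y; rewrite stepE LN_divergence//.
  rewrite /g LN_divergence// /b.
  rewrite mulrDr mulrBr mulrCA divff ?gt_eqF// mulr1 mulN1r !mulrN !opprK.
  have -> : \sum_i lgrad (i, false) (fun y0 => (a j y0 (i, true) - c (i, true)) *
      lgrad (i, true) (w j.+1) y0) y =
    \sum_i lgrad (i, false) (fun y0 => a j y0 (i, true) * lgrad (i, true) (w j.+1) y0) y -
    \sum_i lgrad (i, false) (fun y0 => c (i, true) * lgrad (i, true) (w j.+1) y0) y.
    rewrite -sumrB; apply: eq_bigr => i _; rewrite /lgrad; ring.
  ring.
have -> : iter j A (fun y => h * (g j y + -1 * \sum_i lgrad (i, false) (b i j) y)) =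
   (fun y => h * (iter j A (g j) y +
      -1 * \sum_i lgrad (i, false) (iter j A (b i j)) y)).
  apply/funext => y; rewrite iter_stepZ iter_stepD iter_stepZ iter_step_sum.
  congr (h * (_ + -1 * _)); apply: eq_bigr => i _.
  by rewrite (iter_step_grads j (b i j) [:: (i, false)]).
rewrite gradsZ gradsD gradsZ grads_sum mulN1r; congr (_ * (_ - _)).
by apply: eq_bigr => i _; rewrite foldr_rcons.
Qed.

End Duhamel.

(** * Interior Schauder estimates *)

Section Interior.
Variables (R : realType) (n N : nat) (cm cp alpha T U G B : R).
Variables (a : R -> lattice n N -> dir n -> R) (u : R -> lattice n N -> R).
Hypothesis N0 : (0 < N)%N.
Hypothesis cm0 : 0 < cm.
Hypothesis alpha0 : 0 < alpha.
Hypothesis alpha1 : alpha < 1.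
Hypothesis U0 : 0 <= U.
Hypothesis G0 : 0 <= G.
Hypothesis B0 : 0 <= B.
Hypothesis a_ell : forall t, t <= T -> elliptic_class cm cp (a t).
Hypothesis a_hol : forall t1 t2 x y e, t1 <= T -> t2 <= T ->
  `|a t1 (x + y) e - a t2 x e| <=
  B * (sqdist R y `^ (alpha / 2) + `|t1 - t2| `^ (alpha / 2)).
Hypothesis u_le : forall t x, t <= T -> `|u t x| <= U.
Hypothesis u_euler : exists2 eta, 0 < eta & forall h, 0 < h <= eta ->
  forall t x, t + h <= T -> `|u (t + h) x - u t x - h * LN (a t) (u t) x| <= h * G.

Local Notation E e := (@latt n N (dvec e)).
Local Notation grads v es := (foldr (@lgrad R n N) v es).
Local Notation K k := (@Kgrad R n cm cp k).

(* Taking the conductance of the positive direction for both [e] and [-e] makes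
   the frozen coefficients symmetric. *)
Definition frozen t x : dir n -> R := fun e => a t x (e.1, true).

(** The step is small enough for a lazy walk, for 2 h to lie below the square of every distance k /
    N with k > 0, as [powR_sum_high] asks, and for the Euler inequality. *)
Definition fine_step h :=
  [/\ 0 < h, h * (4 * n%:R * cp * N%:R ^+ 2) <= 1, 2 * h <= N%:R ^- 2 &
  forall t x, t + h <= T -> `|u (t + h) x - u t x - h * LN (a t) (u t) x| <= h * G].

Lemma fine_step_exists (s : R) : 0 < s -> exists m h, m%:R * h = s /\ fine_step h.
Proof.
move=> s0; have [eta eta0 Heta] := u_euler.
pose Q := 4 * n%:R * cp * N%:R ^+ 2.
(* [C] dominates the reciprocal of each upper bound imposed on [h]. *)
pose C := 1 + `|Q| + N%:R ^+ 2 * 2 + eta^-1.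
have NN : 0 < N%:R :> R by rewrite ltr0n.
have ei : 0 <= eta^-1 by rewrite invr_ge0 ltW.
have N2 : 0 <= N%:R ^+ 2 * 2 :> R by rewrite mulr_ge0 ?sqr_ge0.
have Q0 := normr_ge0 Q.
have C1 : 1 <= C by rewrite /C; lra.
have C0 : 0 < C by rewrite (lt_le_trans ltr01).
pose m := (Num.truncn (s * C)).+1.
have m0 : 0 < m%:R :> R by rewrite ltr0n.
have sm : s * C <= m%:R by apply/ltW; rewrite truncnS_gt.
have hC : s / m%:R * C <= 1 by rewrite mulrAC ler_pdivrMr// mul1r.
have h0 : 0 < s / m%:R by rewrite divr_gt0.
exists m, (s / m%:R); split; first by rewrite mulrC divfK ?gt_eqF.
have hle q : 0 <= q -> q <= C -> s / m%:R * q <= 1.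
  by move=> q0 qC; apply: le_trans hC; rewrite ler_wpM2l// ltW.
split=> //.
- apply: (@le_trans _ _ (s / m%:R * `|Q|)); first by rewrite ler_wpM2l ?ler_norm// ltW.
  by apply: hle => //; rewrite /C; lra.
- rewrite -[leRHS]mul1r ler_pdivlMr ?exprn_gt0//.
  have -> : 2 * (s / m%:R) * N%:R ^+ 2 = s / m%:R * (N%:R ^+ 2 * 2) by ring.
  by apply: hle => //; rewrite /C; lra.
- move=> t x; apply: Heta; rewrite h0/= -[leRHS]mul1r -ler_pdivrMr//.
  by apply: hle => //; rewrite /C; lra.
Qed.

Lemma powR_double (x y p : R) : 0 <= x -> 0 <= y -> 0 <= p <= 1 ->
  (2 * (x + y)) `^ p <= 4 * (x `^ p + y `^ p).
Proof.
move=> x0 y0 /andP[p0 p1].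
have m0 : 0 <= Num.max x y by rewrite le_max x0.
apply: (@le_trans _ _ ((4 * Num.max x y) `^ p)).
  rewrite ge0_ler_powR ?nnegrE ?mulr_ge0 ?addr_ge0//.
  have : x <= Num.max x y by rewrite le_max lexx.
  have : y <= Num.max x y by rewrite le_max lexx orbT.
  lra.
rewrite powRM//; apply: ler_pM; rewrite ?powR_ge0//.
  by apply: ler1_powR => //; lra.
by case: (leP x y) => _; rewrite ?lerDl ?lerDr powR_ge0.
Qed.

(** * Terms of the Duhamel sum for coefficients frozen at one point *)

Section Frozen.
Variables (t h : R) (x0 : lattice n N).
Hypothesis tT : t <= T.
Hypothesis h_fine : fine_step h.

Local Notation c := (frozen t x0).
Local Notation A := (@step R n N c h).

Let h0 : 0 < h. Proof. by case: h_fine. Qed.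

Let frozen_dopp e : c (dopp e) = c e. Proof. by []. Qed.

Lemma frozen_gradients es j (b : lattice n N -> R) x cst k al :
  (0 < size es)%N -> 0 <= al <= 1 -> 0 <= k ->
  let tau := j.+1%:R * h in
  (forall y, `|b y - cst| <= k * (sqdist R (y - x) `^ (al / 2) + tau `^ (al / 2))) ->
  `|grads (iter j A b) es x| <= K (size es) * k * tau `^ ((al - (size es)%:R) / 2).
Proof.
have [_ hs _ _] := h_fine; have [_ ab] := a_ell tT.
apply: frozen_gradient => // e; by have /andP[] := ab x0 (e.1, true).
Qed.

Lemma frozen_bounded es j (b : lattice n N -> R) x k : (0 < size es)%N -> 0 <= k ->
  (forall y, `|b y| <= k) ->
  `|grads (iter j A b) es x| <=
    K (size es) * k * (j.+1%:R * h) `^ (- (size es)%:R / 2).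
Proof.
move=> es0 k0 bk.
(* At exponent 0 both powers equal 1, so two halves of [k] make up the bound. *)
have := @frozen_gradients es j b x 0 (k / 2) 0 es0.
rewrite lexx ler01 divr_ge0// => /(_ isT isT) H.
have {}H : `|grads (iter j A b) es x| <=
    K (size es) * (k / 2) * (j.+1%:R * h) `^ ((0 - (size es)%:R) / 2).
  apply: H => y; rewrite mul0r !powRr0 subr0; have := bk y; lra.
apply: le_trans H _; rewrite sub0r ler_wpM2r ?powR_ge0// ler_wpM2l ?Kgrad_ge0//.
lra.
Qed.

(** Time runs backwards from [t]. An explicit Euler step from [traj j.+1] to [traj j] uses the
    coefficients at its start, hence the shifted index in [coef]; their distance to [t] is exactly
    the time (j + 1) h of the gradient estimates. *)
Definition traj j := u (t - j%:R * h).
Definition coef j := a (t - j.+1%:R * h).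
Definition flux i j y := (coef j y (i, true) - c (i, true)) * lgrad (i, true) (traj j.+1) y.
Definition source j y := (traj j y - traj j.+1 y) / h - LN (coef j) (traj j.+1) y.

Let past j : t - j%:R * h <= T.
Proof. by rewrite lerBlDr (le_trans tT)// lerDl mulr_ge0 ?(ltW h0). Qed.

Lemma source_le j y : `|source j y| <= G.
Proof.
have [_ _ _ /(_ (t - j.+1%:R * h) y)] := h_fine.
have -> : t - j.+1%:R * h + h = t - j%:R * h by rewrite -natr1; ring.
move=> /(_ (past j)) H; rewrite -(ler_pM2l h0) -{1}(gtr0_norm h0) -normrM.
apply: le_trans H; rewrite /source mulrBr mulrCA divff ?gt_eqF// mulr1.
exact: lexx.
Qed.

Lemma duhamel_frozen m es x :
  grads (u t) es x = grads (iter m A (traj m)) es x +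
    \sum_(j < m) h * (grads (iter j A (source j)) es x -
      \sum_i grads (iter j A (flux i j)) (rcons es (i, false)) x).
Proof.
have <- : traj 0 = u t by rewrite /traj mul0r subr0.
apply: (duhamel N0 frozen_dopp h0) => j x' e.
have [sym _] := a_ell (past j.+1); exact: sym.
Qed.

Variable L : R.
Hypothesis L0 : 0 <= L.
Hypothesis grad_le : forall t' e x, t' <= T -> `|lgrad e (u t') x| <= L.

Lemma flux_le i j y :
  `|flux i j y| <= B * L * (sqdist R (y - x0) `^ (alpha / 2) +
                              (j.+1%:R * h) `^ (alpha / 2)).
Proof.
rewrite /flux normrM mulrAC; apply: ler_pM => //; last exact: (grad_le _ _ (past j.+1)).
have := @a_hol (t - j.+1%:R * h) t x0 (y - x0) (i, true) (past _) tT.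
rewrite subrKC => H; apply: le_trans H _.
by rewrite addrAC subrr add0r normrN ger0_norm// mulr_ge0 ?(ltW h0).
Qed.

Lemma path_grads_le es j (b : lattice n N -> R) x e k X :
  (forall i, (i < k)%N -> `|grads (iter j A b) (e :: es) (x + E e *+ i)| <= X) ->
  `|grads (iter j A b) es (x + E e *+ k) - grads (iter j A b) es x| <=
    k%:R / N%:R * X.
Proof. exact: (@lgrad_path_le R n N N0 (grads (iter j A b) es) x e k X). Qed.

(** Two bounds meet at tau = rho^2: before it, two first differences of order tau^(-1/2); after it,
    rho times a second difference, of order rho / tau. Both are at most rho^alpha
    tau^((1-alpha)/2-1), whose sum over small times converges because alpha < 1. *)
Lemma source_diff j e e1 k (rho : R) : (0 < k)%N -> rho = k%:R / N%:R ->
  `|grads (iter j A (source j)) [:: e] (x0 + E e1 *+ k) -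
    grads (iter j A (source j)) [:: e] x0| <=
  (2 * K 1 + K 2) * G * rho `^ alpha * (j.+1%:R * h) `^ ((1 - alpha) / 2 - 1).
Proof.
move=> k0 rhoE; set tau := j.+1%:R * h.
have tau0 : 0 < tau by rewrite mulr_gt0 ?ltr0n.
have rho0 : 0 < rho by rewrite rhoE divr_gt0 ?ltr0n.
have K1 : 0 <= K 1 by exact: Kgrad_ge0.
have K2 : 0 <= K 2 by exact: Kgrad_ge0.
have S1 x : `|grads (iter j A (source j)) [:: e] x| <= K 1 * G * tau `^ (- 1 / 2).
  by apply: frozen_bounded => // y; exact: source_le.
have S2 x : `|grads (iter j A (source j)) [:: e1; e] x| <= K 2 * G * tau `^ (- 2 / 2).
  by apply: frozen_bounded => // y; exact: source_le.
have P0 := powR_ge0 rho alpha; have P1 := powR_ge0 tau ((1 - alpha) / 2 - 1).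
have a0 := alpha0; have a1 := alpha1.
have KG1 : 0 <= K 1 * G * rho `^ alpha * tau `^ ((1 - alpha) / 2 - 1).
  by rewrite !mulr_ge0.
have KG2 : 0 <= K 2 * G * rho `^ alpha * tau `^ ((1 - alpha) / 2 - 1).
  by rewrite !mulr_ge0.
have [tr|tr] := leP tau (rho ^+ 2).
  have H : tau `^ (- 1 / 2) <= rho `^ alpha * tau `^ ((1 - alpha) / 2 - 1).
    have -> : - 1 / 2 = alpha / 2 + ((1 - alpha) / 2 - 1) :> R by lra.
    rewrite powRD ?(gt_eqF tau0) ?implybT// ler_wpM2r//.
    rewrite -(powR_sqr_half alpha (ltW rho0)).
    by rewrite ge0_ler_powR ?nnegrE ?(ltW tau0) ?sqr_ge0//; lra.
  have {}H : K 1 * G * tau `^ (- 1 / 2) <=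
      K 1 * G * (rho `^ alpha * tau `^ ((1 - alpha) / 2 - 1)).
    by apply: ler_wpM2l => //; rewrite mulr_ge0.
  apply: le_trans (ler_normB _ _) _.
  have := S1 (x0 + E e1 *+ k); have := S1 x0; move: H KG1 KG2.
  rewrite !mulrA !mulrDl -!mulrA; lra.
apply: le_trans (path_grads_le (fun i _ => S2 _)) _; rewrite -rhoE.
have H : rho * tau `^ (- 2 / 2) <= rho `^ alpha * tau `^ ((1 - alpha) / 2 - 1).
  have -> : - 2 / 2 = - ((1 - alpha) / 2) + ((1 - alpha) / 2 - 1) :> R by lra.
  rewrite powRD ?(gt_eqF tau0) ?implybT// mulrA ler_wpM2r//.
  rewrite powRN ler_pdivrMr ?powR_gt0//.
  have E : rho = rho `^ alpha * rho `^ (1 - alpha).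
    rewrite -powRD ?(gt_eqF rho0) ?implybT// addrC subrK.
    by rewrite powRr1 ?ltW.
  rewrite [leLHS]E.
  rewrite ler_wpM2l// -(powR_sqr_half _ (ltW rho0)).
  by rewrite ge0_ler_powR ?nnegrE ?(ltW tau0) ?sqr_ge0//; lra.
have {}H : K 2 * G * (rho * tau `^ (- 2 / 2)) <=
    K 2 * G * (rho `^ alpha * tau `^ ((1 - alpha) / 2 - 1)).
  by apply: ler_wpM2l => //; rewrite mulr_ge0.
move: H KG1 KG2; rewrite !mulrA !mulrDl -!mulrA; lra.
Qed.

Lemma flux_diff_low i j e e1 k (rho M : R) : 0 <= M -> rho = k%:R / N%:R ->
  (forall t e x y, t <= T ->
     `|lgrad e (u t) (x + y) - lgrad e (u t) x| <= M * sqdist R y `^ (alpha / 2)) ->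
  `|grads (iter j A (flux i j)) [:: e; (i, false)] (x0 + E e1 *+ k) -
    grads (iter j A (flux i j)) [:: e; (i, false)] x0| <=
  K 2 * (2 * (B * L) + B * rho `^ alpha * M) * (j.+1%:R * h) `^ (alpha / 2 - 1).
Proof.
move=> M0 rhoE uM; set tau := j.+1%:R * h; set x' := x0 + _.
have a0 := alpha0; have a1 := alpha1.
have al01 : 0 <= alpha <= 1 by rewrite !ltW.
have rho0 : 0 <= rho by rewrite rhoE divr_ge0.
have BL : 0 <= B * L by rewrite mulr_ge0.
have BM : 0 <= B * rho `^ alpha * M by rewrite !mulr_ge0// powR_ge0.
have -> : alpha / 2 - 1 = (alpha - 2) / 2 by lra.
have F0 : `|grads (iter j A (flux i j)) [:: e; (i, false)] x0| <=
    K 2 * (B * L) * tau `^ ((alpha - 2) / 2).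
  apply: (@frozen_gradients _ _ _ _ 0) => // y.
  by rewrite subr0; exact: flux_le.
suff F1 : `|grads (iter j A (flux i j)) [:: e; (i, false)] x'| <=
    K 2 * (B * L + B * rho `^ alpha * M) * tau `^ ((alpha - 2) / 2).
  apply: le_trans (ler_normB _ _) _; apply: le_trans (lerD F1 F0) _.
  by rewrite -!mulrDl -mulrDr ler_wpM2r ?powR_ge0// ler_wpM2l ?Kgrad_ge0//; lra.
(* The flux need not vanish at [x'], but it differs from the constant [dc] times the gradient at
   [x'] by terms of order alpha there, and the differences remove the constant. The term with [M]
   carries the factor B rho^alpha that allows its absorption. *)
pose dc := a t x' (i, true) - c (i, true).
have dcle : `|dc| <= B * rho `^ alpha.
  apply: le_trans (a_hol _ _ _ tT tT) _.
  rewrite subrr normr0 powR0 ?gt_eqF ?divr_gt0// addr0 ler_wpM2l//.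
  rewrite -(powR_sqr_half alpha rho0).
  rewrite ge0_ler_powR ?nnegrE ?sqr_ge0 ?sqdist_ge0 ?divr_ge0 ?(ltW a0)//.
  by rewrite rhoE; exact: sqdist_line.
apply: (@frozen_gradients _ _ _ _ (dc * lgrad (i, true) (traj j.+1) x')) => //.
  exact: addr_ge0.
move=> y; rewrite -/tau.
have -> : flux i j y - dc * lgrad (i, true) (traj j.+1) x' =
   (coef j y (i, true) - a t x' (i, true)) * lgrad (i, true) (traj j.+1) y +
   dc * (lgrad (i, true) (traj j.+1) (x' + (y - x')) - lgrad (i, true) (traj j.+1) x').
  by rewrite subrKC /flux /dc; ring.
apply: le_trans (ler_normD _ _) _.
rewrite [X in X + _]normrM [X in _ + X]normrM.
have Q1 := powR_ge0 tau (alpha / 2).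
have Q2 := powR_ge0 (sqdist R (y - x')) (alpha / 2).
rewrite mulrDl; apply: lerD.
  rewrite [leRHS]mulrAC; apply: ler_pM => //; last exact: (grad_le _ _ (past j.+1)).
  have := @a_hol (t - j.+1%:R * h) t x' (y - x') (i, true) (past _) tT.
  rewrite subrKC => H; apply: le_trans H _.
  by rewrite addrAC subrr add0r normrN ger0_norm// mulr_ge0 ?(ltW h0).
apply: (@le_trans _ _ (B * rho `^ alpha * (M * sqdist R (y - x') `^ (alpha / 2)))).
  by apply: ler_pM => //; exact: uM (past _).
by rewrite mulrA ler_wpM2l// lerDl.
Qed.

(** Once tau >= rho^2, each point of the segment is within sqrt tau of [x0], so around it the flux
    obeys the same bound as around [x0], up to the factor 5: 4 from [powR_double] and 1 from the
    time term. A third difference along the segment then gains rho tau^(-1/2). *)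
Lemma flux_diff_high i j e e1 k (rho : R) : rho = k%:R / N%:R ->
  rho ^+ 2 <= j.+1%:R * h ->
  `|grads (iter j A (flux i j)) [:: e; (i, false)] (x0 + E e1 *+ k) -
    grads (iter j A (flux i j)) [:: e; (i, false)] x0| <=
  5 * K 3 * (B * L) * (rho * (j.+1%:R * h) `^ (- ((1 - alpha) / 2) - 1)).
Proof.
move=> rhoE; set tau := j.+1%:R * h => rt.
have a0 := alpha0; have a1 := alpha1.
have rho0 : 0 <= rho by rewrite rhoE divr_ge0.
have tau0 : 0 <= tau by rewrite mulr_ge0 // ltW.
have BL : 0 <= B * L by rewrite mulr_ge0.
have -> : - ((1 - alpha) / 2) - 1 = (alpha - 3) / 2 by lra.
rewrite mulrCA rhoE; apply: path_grads_le => l lk.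
have -> : 5 * K 3 * (B * L) * tau `^ ((alpha - 3) / 2) =
   K 3 * (5 * (B * L)) * tau `^ ((alpha - 3) / 2) by ring.
set z := x0 + _.
apply: (@frozen_gradients _ _ _ _ 0) => //; [by rewrite !ltW|exact: mulr_ge0|].
move=> y; rewrite subr0 -/tau.
apply: le_trans (flux_le _ _ _) _; rewrite -/tau [5 * _]mulrC -[leRHS]mulrA ler_wpM2l//.
have yx : y - x0 = (y - z) + E e1 *+ l by rewrite /z opprD addrA subrK.
have Q1 := powR_ge0 tau (alpha / 2).
have Q2 := powR_ge0 (sqdist R (y - z)) (alpha / 2).
have p01 : 0 <= alpha / 2 <= 1 by apply/andP; split; lra.
have p0 : 0 <= alpha / 2 by lra.
have H1 : sqdist R (E e1 *+ l) `^ (alpha / 2) <= tau `^ (alpha / 2).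
  rewrite ge0_ler_powR ?nnegrE ?sqdist_ge0//.
  apply: le_trans (sqdist_line _ N0 _ _) _; apply: le_trans rt.
  rewrite rhoE lerXn2r ?nnegrE ?divr_ge0// ler_wpM2r ?invr_ge0// ler_nat.
  exact: ltnW.
have H2 : sqdist R (y - x0) `^ (alpha / 2) <=
    (2 * (sqdist R (y - z) + sqdist R (E e1 *+ l))) `^ (alpha / 2).
  apply: ge0_ler_powR => //; rewrite ?nnegrE ?sqdist_ge0//.
    by rewrite mulr_ge0// addr_ge0 ?sqdist_ge0.
  by rewrite yx; exact: sqdistD.
have H3 := powR_double (sqdist_ge0 R (y - z)) (sqdist_ge0 R (E e1 *+ l)) p01.
move: H1 H2 H3 Q1 Q2; lra.
Qed.

End Frozen.

(** * Summation over the time s, and absorption *)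

Lemma powR_decr (x y p : R) : 0 < x -> x <= y -> p <= 0 -> y `^ p <= x `^ p.
Proof.
move=> x0 xy p0; have y0 : 0 < y by exact: lt_le_trans xy.
rewrite -[p]opprK !(powRN _ (- p)) lef_pV2 ?posrE ?powR_gt0//.
by rewrite ge0_ler_powR ?nnegrE ?oppr_ge0 ?(ltW x0) ?(ltW y0).
Qed.

(** Freezing at the point of evaluation turns the divergent 1 / tau of two differences of the flux
    into the summable tau^(alpha/2-1). The initial value costs s^(-1/2), and the source sums
    tau^(-1/2). *)
Lemma gradient_step (L s t : R) e x : 0 <= L ->
  (forall t' e' x', t' <= T -> `|lgrad e' (u t') x'| <= L) -> 0 < s -> t <= T ->
  `|lgrad e (u t) x| <= K 1 * U * s `^ (- 1 / 2) + K 1 * G * (2 * s `^ (1 / 2)) +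
    n%:R * K 2 * B * L * (2 / alpha * s `^ (alpha / 2)).
Proof.
move=> L0 Lle s0 tT; have [m [h [mh hf]]] := fine_step_exists s0.
have [h0 _ _ _] := hf.
have -> : lgrad e (u t) x = grads (u t) [:: e] x by [].
rewrite (duhamel_frozen x tT hf m [:: e] x).
have K1 : 0 <= K 1 by exact: Kgrad_ge0.
have K2 : 0 <= K 2 by exact: Kgrad_ge0.
have past k : t - k%:R * h <= T.
  by rewrite lerBlDr (le_trans tT)// lerDl mulr_ge0 ?(ltW h0).
rewrite -addrA; apply: le_trans (ler_normD _ _) _; apply: lerD.
  have H := @frozen_bounded t h x tT hf [:: e] m (traj t h m) x U isT U0
    (fun y => u_le y (past m)).
  apply: le_trans H _; rewrite ler_wpM2l ?mulr_ge0// powR_decr//; last lra.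
have S1 : \sum_(j < m) h * (j.+1%:R * h) `^ (1 / 2 - 1) <= s `^ (1 / 2) * 2.
  have b01 : 0 < (1 : R) / 2 < 1 by lra.
  by have := powR_sum m b01 h0; rewrite mh div1r invrK.
have S2 : \sum_(j < m) h * (j.+1%:R * h) `^ (alpha / 2 - 1) <= s `^ (alpha / 2) * (2 / alpha).
  have b01 : 0 < alpha / 2 < 1 by have := alpha0; have := alpha1; lra.
  by have := powR_sum m b01 h0; rewrite mh invf_div.
apply: le_trans (ler_norm_sum _ _ _) _.
apply: (@le_trans _ _ (\sum_(j < m) (K 1 * G * (h * (j.+1%:R * h) `^ (1 / 2 - 1)) +
   n%:R * K 2 * B * L * (h * (j.+1%:R * h) `^ (alpha / 2 - 1))))); last first.
  rewrite big_split/= -[X in X + _]mulr_sumr -[X in _ + X]mulr_sumr [2 * _]mulrC [2 / _ * _]mulrC.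
  by apply: lerD; apply: ler_wpM2l => //; rewrite !mulr_ge0.
apply: ler_sum => j _; rewrite normrM gtr0_norm//.
have G1 := @frozen_bounded t h x tT hf [:: e] j (source t h j) x G isT G0
  (fun y => source_le tT hf j y).
have F1 i : `|grads (iter j (step (frozen t x) h) (flux t h x i j)) [:: e; (i, false)] x| <=
    K 2 * (B * L) * (j.+1%:R * h) `^ (alpha / 2 - 1).
  have -> : alpha / 2 - 1 = (alpha - 2) / 2 by lra.
  apply: (@frozen_gradients t h x tT hf [:: e; (i, false)] j _ x 0) => //.
  - by rewrite !ltW.
  - by rewrite mulr_ge0.
  - by move=> y; rewrite subr0; exact: flux_le.
have -> : forall p q : R, K 1 * G * (h * p) + n%:R * K 2 * B * L * (h * q) =
   h * (K 1 * G * p + \sum_(i < n) K 2 * (B * L) * q).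
  by move=> p q; rewrite sumr_const card_ord -mulr_natl; ring.
rewrite ler_pM2l//; apply: le_trans (ler_normB _ _) _; rewrite lerD//.
  have -> : 1 / 2 - 1 = - 1 / 2 :> R by lra.
  exact: G1.
by apply: le_trans (ler_norm_sum _ _ _) _; apply: ler_sum.
Qed.

Lemma gradient_bound s t e x : 0 < s ->
  n%:R * K 2 * B * (2 / alpha * s `^ (alpha / 2)) <= 1 / 2 -> t <= T ->
  `|lgrad e (u t) x| <=
    2 * (K 1 * U * s `^ (- 1 / 2) + K 1 * G * (2 * s `^ (1 / 2))).
Proof.
move=> s0 hs tT.
pose S : set R := [set y | exists t' e' x', t' <= T /\ y = `|lgrad e' (u t') x'|]%classic.
have Kn k : 0 <= K k by exact: Kgrad_ge0.
apply: (@absorb R S); last by exists t, e, x.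
- by rewrite addr_ge0 ?mulr_ge0 ?powR_ge0.
- move=> L L0 LS y [t' [e' [x' [tT' ->]]]].
  have H := @gradient_step L s t' e' x' L0 (fun t e x h => LS _ (ex_intro _ t
    (ex_intro _ e (ex_intro _ x (conj h erefl))))) s0 tT'.
  apply: le_trans H _; rewrite addrC lerD2r.
  have := ler_wpM2r L0 hs; lra.
- exists ((2 * N%:R) ^+ 1 * U) => y [t' [e' [x' [tT' ->]]]].
  exact: (@grads_le R n N (u t') [:: e'] U (fun y => u_le y tT') x').
Qed.

(* In the Duhamel sum, the flux vanishes to order [alpha] at the freezing point
   and, up to an additive constant, at the other point: this controls the times
   up to [rho ^+ 2].  For the later ones a further derivative is used. *)
Lemma holder_step (L M s t : R) e e1 x k (rho : R) : 0 <= L -> 0 <= M -> (0 < k)%N ->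
  rho = k%:R / N%:R -> rho ^+ 2 <= s -> t <= T ->
  (forall t' e' x', t' <= T -> `|lgrad e' (u t') x'| <= L) ->
  (forall t e x y, t <= T ->
     `|lgrad e (u t) (x + y) - lgrad e (u t) x| <= M * sqdist R y `^ (alpha / 2)) ->
  `|lgrad e (u t) (x + E e1 *+ k) - lgrad e (u t) x| <=
  (K 2 * U * s `^ ((1 - alpha) / 2 - 1) +
   (2 * K 1 + K 2) * G * (2 / (1 - alpha) * s `^ ((1 - alpha) / 2)) +
   n%:R * (4 / alpha * K 2 * (B * L) + 20 / (1 - alpha) * K 3 * (B * L)) +
   n%:R * K 2 * B * (2 / alpha * s `^ (alpha / 2)) * M) * rho `^ alpha.
Proof.
move=> L0 M0 k0 rhoE rs tT Lle Mle.
have a0 := alpha0; have a1 := alpha1.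
have rho0 : 0 < rho by rewrite rhoE divr_gt0 ?ltr0n.
have r20 : 0 < rho ^+ 2 by rewrite exprn_gt0.
have s0 : 0 < s by exact: lt_le_trans rs.
have [m [h [mh hf]]] := fine_step_exists s0.
have [h0 _ hN _] := hf.
have Kn l : 0 <= K l by exact: Kgrad_ge0.
have past l : t - l%:R * h <= T.
  by rewrite lerBlDr (le_trans tT)// lerDl mulr_ge0 ?(ltW h0).
have BL : 0 <= B * L by rewrite mulr_ge0.
have P0 := powR_ge0 rho alpha.
pose A := @step R n N (frozen t x) h.
pose df (v : lattice n N -> R) es := grads v es (x + E e1 *+ k) - grads v es x.
have -> : lgrad e (u t) (x + E e1 *+ k) - lgrad e (u t) x = df (u t) [:: e] by [].
have -> : df (u t) [:: e] = df (iter m A (traj t h m)) [:: e] +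
    (\sum_(j < m) h * df (iter j A (source t h j)) [:: e] -
     \sum_(j < m) \sum_(i < n) h * df (iter j A (flux t h x i j)) [:: e; (i, false)]).
  rewrite /df (duhamel_frozen x tT hf m [:: e] x).
  rewrite (duhamel_frozen x tT hf m [:: e] (x + E e1 *+ k)).
  rewrite opprD addrACA; congr (_ + _); rewrite -!sumrB; apply: eq_bigr => j _.
  have sumE (p q : R) (F F' : 'I_n -> R) : h * (p - \sum_i F i) - h * (q - \sum_i F' i) =
      h * (p - q) - \sum_i h * (F i - F' i) by rewrite -mulr_sumr sumrB; ring.
  exact: sumE.
have I1 : `|df (iter m A (traj t h m)) [:: e]| <=
    K 2 * U * s `^ ((1 - alpha) / 2 - 1) * rho `^ alpha.
  have H y : `|grads (iter m A (traj t h m)) [:: e1; e] y| <= K 2 * U * s `^ (- 1).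
    have H := @frozen_bounded t h x tT hf [:: e1; e] m (traj t h m) y U isT U0
      (fun y => u_le y (past m)).
    apply: le_trans H _; rewrite ler_wpM2l ?mulr_ge0//.
    have -> : - (size [:: e1; e])%:R / 2 = -1 :> R by rewrite /=; lra.
    by rewrite powR_decr// -mh ler_wpM2r ?(ltW h0)// ler_nat.
  apply: le_trans (path_grads_le (fun i _ => H _)) _; rewrite -rhoE.
  rewrite mulrCA -[leRHS]mulrA ler_wpM2l ?mulr_ge0//.
  have -> : s `^ ((1 - alpha) / 2 - 1) = s `^ ((1 - alpha) / 2) * s `^ (- 1).
    by rewrite -powRD ?(gt_eqF s0) ?implybT.
  rewrite mulrC -[leRHS]mulrA [leRHS]mulrCA ler_wpM2l ?powR_ge0//.
  have E : rho = rho `^ (1 - alpha) * rho `^ alpha.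
    rewrite -powRD ?(gt_eqF rho0) ?implybT// subrK.
    by rewrite powRr1 ?ltW.
  rewrite [leLHS]E ler_wpM2r// -(powR_sqr_half _ (ltW rho0)).
  apply: ge0_ler_powR => //; rewrite ?nnegrE ?(ltW r20) ?(ltW s0)//; lra.
have b01 : 0 < (1 - alpha) / 2 < 1 by apply/andP; split; lra.
have I2 : `|\sum_(j < m) h * df (iter j A (source t h j)) [:: e]| <=
    (2 * K 1 + K 2) * G * (2 / (1 - alpha) * s `^ ((1 - alpha) / 2)) * rho `^ alpha.
  apply: le_trans (ler_norm_sum _ _ _) _.
  apply: (@le_trans _ _ (\sum_(j < m) (2 * K 1 + K 2) * G * rho `^ alpha *
      (h * (j.+1%:R * h) `^ ((1 - alpha) / 2 - 1)))).
    apply: ler_sum => j _; rewrite normrM gtr0_norm// [leRHS]mulrCA ler_wpM2l ?(ltW h0)//.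
    exact: source_diff.
  rewrite -mulr_sumr [leRHS]mulrAC ler_wpM2l//.
    by rewrite !mulr_ge0// addr_ge0 ?mulr_ge0.
  by have := powR_sum m b01 h0; rewrite mh invf_div [X in _ -> _ <= X]mulrC.
have c01 : 0 < alpha / 2 < 1 by apply/andP; split; lra.
have I3 i : `|\sum_(j < m) h * df (iter j A (flux t h x i j)) [:: e; (i, false)]| <=
    (4 / alpha * K 2 * (B * L) + 20 / (1 - alpha) * K 3 * (B * L) +
      K 2 * B * (2 / alpha * s `^ (alpha / 2)) * M) * rho `^ alpha.
  rewrite (bigID (fun j : 'I_m => j.+1%:R * h <= rho ^+ 2))/=.
  have Low : `|\sum_(j < m | j.+1%:R * h <= rho ^+ 2)
      h * df (iter j A (flux t h x i j)) [:: e; (i, false)]| <=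
      (4 / alpha * K 2 * (B * L) + K 2 * B * (2 / alpha * s `^ (alpha / 2)) * M) *
      rho `^ alpha.
    pose Q := K 2 * (2 * (B * L) + B * rho `^ alpha * M).
    have Q0 : 0 <= Q by rewrite mulr_ge0 ?addr_ge0 ?mulr_ge0.
    apply: (@le_trans _ _ (Q * (\sum_(j < m | j.+1%:R * h <= rho ^+ 2)
        h * (j.+1%:R * h) `^ (alpha / 2 - 1)))).
      rewrite mulr_sumr; apply: le_trans (ler_norm_sum _ _ _) _; apply: ler_sum => j _.
      rewrite normrM gtr0_norm// [leRHS]mulrCA ler_wpM2l ?(ltW h0)//.
      exact: flux_diff_low.
    apply: (@le_trans _ _ (Q * (2 / alpha * rho `^ alpha))).
      apply: ler_wpM2l => //.
      have := powR_sum_low m c01 h0 (ltW r20).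
      by rewrite (powR_sqr_half _ (ltW rho0)) invf_div [X in _ -> _ <= X]mulrC.
    (* Of the two factors rho^alpha in the [M] term one is kept, and the other is traded for
       s^(alpha/2), the smallness needed to absorb it. *)
    have rs' : rho `^ alpha <= s `^ (alpha / 2).
      rewrite -(powR_sqr_half _ (ltW rho0)); apply: ge0_ler_powR => //.
      - lra.
      - by rewrite nnegrE ltW.
      - by rewrite nnegrE ltW.
    have : K 2 * B * (2 / alpha) * M * rho `^ alpha * rho `^ alpha <=
        K 2 * B * (2 / alpha) * M * rho `^ alpha * s `^ (alpha / 2).
      by rewrite ler_wpM2l// !mulr_ge0// invr_ge0 ltW.
    by rewrite /Q; lra.
  have High : `|\sum_(j < m | ~~ (j.+1%:R * h <= rho ^+ 2))
      h * df (iter j A (flux t h x i j)) [:: e; (i, false)]| <=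
      20 / (1 - alpha) * K 3 * (B * L) * rho `^ alpha.
    pose Q := 5 * K 3 * (B * L) * rho.
    have Q0 : 0 <= Q by rewrite !mulr_ge0// ltW.
    apply: (@le_trans _ _ (Q * (\sum_(j < m | ~~ (j.+1%:R * h <= rho ^+ 2))
        h * (j.+1%:R * h) `^ (- ((1 - alpha) / 2) - 1)))).
      rewrite mulr_sumr; apply: le_trans (ler_norm_sum _ _ _) _; apply: ler_sum => j.
      rewrite -ltNge => /ltW jr.
      rewrite normrM gtr0_norm// [leRHS]mulrCA ler_wpM2l ?(ltW h0)// -[leRHS]mulrA.
      exact: flux_diff_high.
    have hr : 2 * h <= rho ^+ 2.
      apply: le_trans hN _; rewrite rhoE expr_div_n -[leLHS]mul1r.
      by rewrite ler_wpM2r ?invr_ge0 ?sqr_ge0// exprn_ege1// ler1n.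
    have H := ler_wpM2l Q0 (powR_sum_high m b01 h0 hr).
    apply: le_trans H _.
    have E : rho * (rho ^+ 2 / 2) `^ (- ((1 - alpha) / 2)) <= 2 * rho `^ alpha.
      rewrite powRN -powR_inv ?divr_ge0 ?(ltW r20)// invf_div powRM ?invr_ge0 ?(ltW r20)//.
      rewrite powR_inv ?(ltW r20)// (powR_sqr_half _ (ltW rho0)).
      rewrite mulrCA; apply: ler_pM; rewrite ?mulr_ge0 ?invr_ge0 ?powR_ge0 ?(ltW rho0)//.
        by apply: ler1_powR => //; lra.
      rewrite ler_pdivrMr ?powR_gt0// -powRD ?(gt_eqF rho0) ?implybT// addrC subrK.
      by rewrite powRr1// ltW.
    rewrite invf_div.
    have a1' : 0 < 1 - alpha by lra.
    have : 0 <= 5 * K 3 * (B * L) * (2 / (1 - alpha)).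
      by rewrite !mulr_ge0// invr_ge0 ltW.
    by move=> /ler_wpM2l /(_ _ _ E); rewrite /Q; lra.
  apply: le_trans (ler_normD _ _) _; apply: le_trans (lerD Low High) _; lra.
apply: le_trans (ler_normD _ _) _.
have I4 : `|\sum_(j < m) \sum_(i < n) h * df (iter j A (flux t h x i j)) [:: e; (i, false)]| <=
   n%:R * ((4 / alpha * K 2 * (B * L) + 20 / (1 - alpha) * K 3 * (B * L) +
      K 2 * B * (2 / alpha * s `^ (alpha / 2)) * M) * rho `^ alpha).
  rewrite exchange_big/=; apply: le_trans (ler_norm_sum _ _ _) _.
  apply: le_trans (ler_sum _ (fun i _ => I3 i)) _.
  by rewrite sumr_const card_ord [leRHS]mulr_natl.
have := ler_normB (\sum_(j < m) h * df (iter j A (source t h j)) [:: e])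
  (\sum_(j < m) \sum_(i < n) h * df (iter j A (flux t h x i j)) [:: e; (i, false)]).
move: I1 I2 I4; lra.
Qed.

(** The supremum absorbed concerns increments along the axes, while [holder_step] takes arbitrary
    ones: [line_to_all] replaces M by n M, which puts the second factor n into the condition on [s].
    Distances with rho^2 > s follow from the gradient bound, at the price of 2 L s^(-alpha/2). *)
Lemma holder_bound (L s t : R) e e1 x k : 0 <= L ->
  (forall t' e' x', t' <= T -> `|lgrad e' (u t') x'| <= L) -> 0 < s ->
  n%:R * n%:R * K 2 * B * (2 / alpha * s `^ (alpha / 2)) <= 1 / 2 -> t <= T ->
  `|lgrad e (u t) (x + E e1 *+ k) - lgrad e (u t) x| <=
  2 * (K 2 * U * s `^ ((1 - alpha) / 2 - 1) +
   (2 * K 1 + K 2) * G * (2 / (1 - alpha) * s `^ ((1 - alpha) / 2)) +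
   n%:R * (4 / alpha * K 2 * (B * L) + 20 / (1 - alpha) * K 3 * (B * L)) +
   2 * L * s `^ (- (alpha / 2))) * (k%:R / N%:R) `^ alpha.
Proof.
move=> L0 Lle s0 hs tT.
set H := K 2 * U * _ + _ + _; set Z := 2 * L * _.
have a0 := alpha0; have a1 := alpha1.
have Kn l : 0 <= K l by exact: Kgrad_ge0.
have a1' : 0 < 1 - alpha by lra.
have H0 : 0 <= H.
  rewrite /H; repeat first [done | exact: powR_ge0 | by rewrite invr_ge0 ltW
    | apply: addr_ge0 | apply: mulr_ge0].
have Z0 : 0 <= Z by rewrite !mulr_ge0 ?powR_ge0.
case: k => [|k]; first by rewrite mulr0n addr0 subrr normr0 mul0r powR0 ?gt_eqF// mulr0.
have rho0 l : 0 < l.+1%:R / N%:R :> R by rewrite divr_gt0 ?ltr0n.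
rewrite -ler_pdivrMr ?powR_gt0//.
pose S : set R := [set y | exists t' e' e1' x' l, t' <= T /\
  y = `|lgrad e' (u t') (x' + E e1' *+ l.+1) - lgrad e' (u t') x'| /
      (l.+1%:R / N%:R) `^ alpha]%classic.
have triv t' e' e1' x' l : t' <= T ->
    `|lgrad e' (u t') (x' + E e1' *+ l.+1) - lgrad e' (u t') x'| <= 2 * L.
  move=> tT'; apply: le_trans (ler_normB _ _) _.
  by have := Lle t' e' x' tT'; have := Lle t' e' (x' + E e1' *+ l.+1) tT'; lra.
apply: (@absorb R S); last by exists t, e, e1, x, k.
- by rewrite addr_ge0.
- move=> M M0 MS y [t' [e' [e1' [x' [l [tT' ->]]]]]].
  rewrite ler_pdivrMr ?powR_gt0//.
  have uM t2 e2 x2 y2 : t2 <= T ->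
      `|lgrad e2 (u t2) (x2 + y2) - lgrad e2 (u t2) x2| <=
      n%:R * M * sqdist R y2 `^ (alpha / 2).
    move=> tT2; apply: line_to_all => //; first exact: ltW.
    move=> x3 e3 [|l3].
      by rewrite mulr0n addr0 subrr normr0 mul0r powR0 ?gt_eqF// mulr0.
    rewrite -ler_pdivrMr ?powR_gt0//; apply: MS.
    by exists t2, e2, e3, x3, l3.
  have [rs|rs] := leP ((l.+1%:R / N%:R) ^+ 2) s.
    have nM : 0 <= n%:R * M by rewrite mulr_ge0.
    have := @holder_step L (n%:R * M) s t' e' e1' x' l.+1 _ L0 nM isT erefl rs tT' Lle uM.
    move=> /le_trans; apply; rewrite ler_wpM2r ?powR_ge0// -/H.
    have := ler_wpM2r M0 hs; move: Z0; lra.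
  apply: le_trans (triv _ _ _ _ _ tT') _.
  apply: (@le_trans _ _ (Z * (l.+1%:R / N%:R) `^ alpha)).
    rewrite /Z -mulrA -[leLHS]mulr1 ler_wpM2l ?mulr_ge0//.
    rewrite powRN mulrC ler_pdivlMr ?powR_gt0// mul1r.
    rewrite -(powR_sqr_half _ (ltW (rho0 l))); apply: ge0_ler_powR; rewrite ?nnegrE ?sqr_ge0 ?(ltW s0) ?(ltW rs)//.
    by lra.
  by rewrite ler_wpM2r ?powR_ge0//; move: M0 H0; lra.
(* Finiteness for fixed N: nonzero steps along an axis have length at least 1 / N. *)
- exists (2 * L * (N%:R `^ alpha)) => y [t' [e' [e1' [x' [l [tT' ->]]]]]].
  rewrite ler_pdivrMr ?powR_gt0// -[leRHS]mulrA -[leLHS]mulr1.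
  apply: ler_pM => //; first exact: triv.
  rewrite -powRM// ?(ltW (rho0 l))// mulrC divfK ?pnatr_eq0 -?lt0n//.
  have := @ge0_ler_powR R alpha (ltW a0) 1 l.+1%:R; rewrite !nnegrE powR1.
  by move=> /(_ ler01 (ler0n _ _)); apply; rewrite ler1n.
Qed.

(** [u t] is compared with the walk applied to [u (t - r)], and the latter with [u (t - r)] itself.
    In that second comparison one difference stays on [u (t - r)], whose gradient is Hoelder
    continuous with constant M, and the other acts on the walk; like the flux, this leaves
    tau^((alpha-1)/2). *)
Lemma time_step (L M r t : R) x : 0 <= L -> 0 <= M -> 0 < r -> t <= T ->
  (forall t' e' x', t' <= T -> `|lgrad e' (u t') x'| <= L) ->
  (forall t e x y, t <= T ->
     `|lgrad e (u t) (x + y) - lgrad e (u t) x| <= M * sqdist R y `^ (alpha / 2)) ->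
  `|u t x - u (t - r) x| <=
  n%:R * K 1 * (cp * M + B * L) * (2 / (1 + alpha) * r `^ ((1 + alpha) / 2)) + r * G.
Proof.
move=> L0 M0 r0 tT Lle Mle.
have a0 := alpha0; have a1 := alpha1.
have [m [h [mh hf]]] := fine_step_exists r0.
have [h0 hs _ _] := hf.
have Kn l : 0 <= K l by exact: Kgrad_ge0.
have past l : t - l%:R * h <= T.
  by rewrite lerBlDr (le_trans tT)// lerDl mulr_ge0 ?(ltW h0).
have BL : 0 <= B * L by rewrite mulr_ge0.
have [_ ab] := a_ell tT.
have cge e : cm <= frozen t x e by have /andP[] := ab x (e.1, true).
have cle e : frozen t x e <= cp by have /andP[] := ab x (e.1, true).
have b01 : 0 < (1 + alpha) / 2 < 1 by apply/andP; split; lra.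
have al01 : 0 <= alpha <= 1 by rewrite !ltW.
have S : \sum_(j < m) h * (j.+1%:R * h) `^ ((1 + alpha) / 2 - 1) <=
    2 / (1 + alpha) * r `^ ((1 + alpha) / 2).
  by have := powR_sum m b01 h0; rewrite mh invf_div [X in _ -> _ <= X]mulrC.
have -> : u (t - r) x = traj t h m x by rewrite /traj mh.
have -> : u t x = grads (u t) [::] x by [].
rewrite (duhamel_frozen x tT hf m [::] x) [grads _ [::] _]/=.
rewrite addrAC step_sub_iter// -sumrN.
rewrite -big_split/=.
pose Q := n%:R * K 1 * (cp * M + B * L).
have cp0 i : 0 <= frozen t x (i, true) by rewrite (le_trans (ltW cm0)).
apply: (@le_trans _ _ (\sum_(j < m) (Q * (h * (j.+1%:R * h) `^ ((1 + alpha) / 2 - 1)) +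
  h * G))); last first.
  rewrite big_split/= -mulr_sumr sumr_const card_ord -[_ *+ m]mulr_natl mulrA mh lerD2r.
  case: (posnP n) => [n0|n0]; first by rewrite /Q n0 !mul0r.
  apply: ler_wpM2l S; rewrite !mulr_ge0// addr_ge0// mulr_ge0//.
  exact: le_trans (cp0 (Ordinal n0)) (cle _).
apply: le_trans (ler_norm_sum _ _ _) _; apply: ler_sum => j _.
set tau := j.+1%:R * h.
have -> : (1 + alpha) / 2 - 1 = (alpha - 1) / 2 by lra.
have F1 i : `|frozen t x (i, true) * grads (iter j (step (frozen t x) h) (traj t h m))
     [:: (i, false); (i, true)] x| <= K 1 * (cp * M) * tau `^ ((alpha - 1) / 2).
  have -> : K 1 * (cp * M) * tau `^ ((alpha - 1) / 2) =
    cp * (K 1 * M * tau `^ ((alpha - 1) / 2)) by ring.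
  rewrite normrM ger0_norm//; apply: ler_pM => //.
  have <- : grads (iter j (step (frozen t x) h) (lgrad (i, true) (traj t h m))) [:: (i, false)] x =
     grads (iter j (step (frozen t x) h) (traj t h m)) [:: (i, false); (i, true)] x.
    rewrite -[lgrad (i, true) (traj t h m)]/(grads (traj t h m) [:: (i, true)]).
    by rewrite iter_step_grads.
  apply: (@frozen_gradients t h x tT hf [:: (i, false)] j _ x (lgrad (i, true) (traj t h m) x)) => //.
  move=> y; rewrite -[y in lgrad _ _ y](subrKC x).
  apply: le_trans (Mle _ _ _ _ (past m)) _; rewrite ler_wpM2l// lerDl powR_ge0//.
have F2 i : `|grads (iter j (step (frozen t x) h) (flux t h x i j)) [:: (i, false)] x| <=
     K 1 * (B * L) * tau `^ ((alpha - 1) / 2).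
  apply: (@frozen_gradients t h x tT hf [:: (i, false)] j _ x 0) => //.
  by move=> y; rewrite subr0; exact: flux_le.
have F3 : `|iter j (step (frozen t x) h) (source t h j) x| <= G.
  have sG y := source_le tT hf j y.
  by apply: (@iter_step_bounded R n N cm cp (frozen t x) h).
have sumE (p : R) (F F' : 'I_n -> R) :
  - (h * \sum_i F i) + h * (p - \sum_i F' i) = h * (p - \sum_i (F i + F' i)).
  by rewrite big_split/=; ring.
rewrite sumE normrM gtr0_norm// [Q * _]mulrCA -mulrDr ler_wpM2l ?(ltW h0)//.
apply: le_trans (ler_normB _ _) _; rewrite addrC; apply: lerD => //.
apply: le_trans (ler_norm_sum _ _ _) _.
apply: (@le_trans _ _ (\sum_(i < n) (K 1 * (cp * M) * tau `^ ((alpha - 1) / 2) +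
   K 1 * (B * L) * tau `^ ((alpha - 1) / 2)))).
  by apply: ler_sum => i _; apply: le_trans (ler_normD _ _) _; apply: lerD;
    [exact: F1|exact: F2].
by rewrite sumr_const card_ord [leRHS](_ : _ = n%:R * (K 1 * (cp * M) * tau `^ ((alpha - 1) / 2) +
   K 1 * (B * L) * tau `^ ((alpha - 1) / 2))) ?mulr_natl// /Q; ring.
Qed.

(** For r > s the trivial bound 2 U is enough; for r <= s, the condition s <= 1 turns r G into
    r^((1+alpha)/2) G. *)
Lemma time_bound (L M s r t : R) x : 0 <= L -> 0 <= M -> 0 < s <= 1 -> 0 < r -> t <= T ->
  0 <= cp ->
  (forall t' e' x', t' <= T -> `|lgrad e' (u t') x'| <= L) ->
  (forall t e x y, t <= T ->
     `|lgrad e (u t) (x + y) - lgrad e (u t) x| <= M * sqdist R y `^ (alpha / 2)) ->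
  `|u t x - u (t - r) x| <=
  (2 * n%:R * K 1 * (cp * M + B * L) + G + 2 * U * s `^ (- ((1 + alpha) / 2))) *
    r `^ ((1 + alpha) / 2).
Proof.
move=> L0 M0 /andP[s0 s1] r0 tT cp0 Lle Mle.
have a0 := alpha0; have a1 := alpha1.
have Kn l : 0 <= K l by exact: Kgrad_ge0.
have Z0 : 0 <= 2 * U * s `^ (- ((1 + alpha) / 2)) by rewrite !mulr_ge0 ?powR_ge0.
pose Q := n%:R * K 1 * (cp * M + B * L).
have Q0 : 0 <= Q by rewrite !mulr_ge0// addr_ge0 ?mulr_ge0.
have P0 := powR_ge0 r ((1 + alpha) / 2).
have [rs|rs] := leP r s.
  apply: le_trans (time_step _ L0 M0 r0 tT Lle Mle) _; rewrite -/Q.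
  have rr : r <= r `^ ((1 + alpha) / 2).
    by apply: ger1_powR; [rewrite r0 (le_trans rs)|lra].
  have H1 : r * G <= r `^ ((1 + alpha) / 2) * G by rewrite ler_wpM2r.
  have H2 : Q * (2 / (1 + alpha) * r `^ ((1 + alpha) / 2)) <= Q * (2 * r `^ ((1 + alpha) / 2)).
    apply: ler_wpM2l => //; apply: ler_wpM2r => //.
    rewrite ler_pdivrMr; lra.
  have H3 := mulr_ge0 Z0 P0.
  by move: H1 H2 H3; rewrite /Q; lra.
apply: (@le_trans _ _ (2 * U * s `^ (- ((1 + alpha) / 2)) * r `^ ((1 + alpha) / 2))); last first.
  by apply: ler_wpM2r => //; move: Q0; rewrite /Q; have := G0; lra.
apply: (@le_trans _ _ (2 * U)).
  have tr : t - r <= T by rewrite lerBlDr (le_trans tT)// lerDl ltW.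
  apply: le_trans (ler_normB _ _) _.
  by have := u_le x tT; have := u_le x tr; lra.
rewrite -[2 * U * _ * _]mulrA -[leLHS]mulr1 ler_wpM2l ?mulr_ge0//.
rewrite powRN mulrC ler_pdivlMr ?powR_gt0// mul1r.
by apply: ge0_ler_powR; rewrite ?nnegrE ?(ltW s0) ?(ltW r0) ?(ltW rs)//; lra.
Qed.

(* Interpolation: average [lgrad e] of [u t - u (t - r)] along about
   [N * sqrt r] steps in the direction [e]. *)
Lemma gradient_time_bound (W M r t : R) e x : 0 < r -> t <= T -> 0 <= M -> 0 <= W ->
  (forall x, `|u t x - u (t - r) x| <= W * r `^ ((1 + alpha) / 2)) ->
  (forall t' x' k, t' <= T -> `|lgrad e (u t') (x' + E e *+ k) - lgrad e (u t') x'| <=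
     M * (k%:R / N%:R) `^ alpha) ->
  `|lgrad e (u t) x - lgrad e (u (t - r)) x| <= (2 * W + 2 * M) * r `^ (alpha / 2).
Proof.
move=> r0 tT M0 W0 uW uM.
have a0 := alpha0; have a1 := alpha1.
have tr : t - r <= T by rewrite lerBlDr (le_trans tT)// lerDl ltW.
have NN : 0 < N%:R :> R by rewrite ltr0n.
pose rho := Num.sqrt r; have rho0 : 0 < rho by rewrite sqrtr_gt0.
have rE : rho ^+ 2 = r by rewrite sqr_sqrtr// ltW.
(* With the successor, rho N <= k while j / N <= rho for every j < k; moreover k > 0 even when rho
   is smaller than the mesh. *)
pose k := (Num.truncn (rho * N%:R)).+1.
have kge : rho * N%:R <= k%:R by apply/ltW; rewrite truncnS_gt.
have k0 : 0 < k%:R :> R by rewrite ltr0n.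
have jle j : (j < k)%N -> j%:R / N%:R <= rho.
  move=> jk; rewrite ler_pdivrMr//.
  by rewrite -truncn_ge_nat ?mulr_ge0 ?(ltW rho0)// -ltnS.
pose w y := u t y - u (t - r) y.
have lw y : lgrad e w y = lgrad e (u t) y - lgrad e (u (t - r)) y by rewrite /lgrad /w; ring.
rewrite -lw.
have tel : \sum_(j < k) lgrad e w (x + E e *+ j) = N%:R * (w (x + E e *+ k) - w x).
  elim: (k) => [|l IH]; first by rewrite big_ord0 mulr0n addr0 subrr mulr0.
  by rewrite big_ord_recr/= IH /lgrad /lat_shift mulrSr addrA; ring.
have wW y : `|w y| <= W * (rho * r `^ (alpha / 2)).
  have -> : rho * r `^ (alpha / 2) = r `^ ((1 + alpha) / 2).
    rewrite /rho -powR12_sqrt ?(ltW r0)// -powRD ?(gt_eqF r0) ?implybT//.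
    by congr (_ `^ _); lra.
  exact: uW.
have wM j : (j < k)%N -> `|lgrad e w (x + E e *+ j) - lgrad e w x| <= 2 * M * r `^ (alpha / 2).
  move=> jk; rewrite !lw.
  have P : (j%:R / N%:R) `^ alpha <= r `^ (alpha / 2).
    rewrite -{1}rE powR_sqr_half ?(ltW rho0)//.
    by apply: ge0_ler_powR; rewrite ?nnegrE ?divr_ge0 ?(ltW a0) ?(ltW rho0) ?jle.
  have H1 := uM t x j tT; have H2 := uM (t - r) x j tr.
  have := ler_wpM2l M0 P.
  have := ler_normB (lgrad e (u t) (x + E e *+ j) - lgrad e (u t) x)
    (lgrad e (u (t - r)) (x + E e *+ j) - lgrad e (u (t - r)) x).
  have -> : lgrad e (u t) (x + E e *+ j) - lgrad e (u (t - r)) (x + E e *+ j) -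
    (lgrad e (u t) x - lgrad e (u (t - r)) x) =
    lgrad e (u t) (x + E e *+ j) - lgrad e (u t) x -
    (lgrad e (u (t - r)) (x + E e *+ j) - lgrad e (u (t - r)) x) by ring.
  move: H1 H2; lra.
have kE : k%:R * lgrad e w x = N%:R * (w (x + E e *+ k) - w x) -
    \sum_(j < k) (lgrad e w (x + E e *+ j) - lgrad e w x).
  by rewrite sumrB tel sumr_const card_ord -[_ *+ k]mulr_natl; ring.
rewrite -(ler_pM2l k0) -{1}(gtr0_norm k0) -normrM kE.
apply: le_trans (ler_normB _ _) _; rewrite mulrDl [leRHS]mulrDr; apply: lerD.
  rewrite normrM gtr0_norm//.
  apply: (@le_trans _ _ (N%:R * (2 * (W * (rho * r `^ (alpha / 2)))))).
    rewrite ler_wpM2l ?(ltW NN)//; apply: le_trans (ler_normB _ _) _.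
    by have := wW (x + E e *+ k); have := wW x; lra.
  have := ler_wpM2r (mulr_ge0 (mulr_ge0 (ler0n _ 2) W0) (powR_ge0 r (alpha / 2))) kge.
  lra.
apply: le_trans (ler_norm_sum _ _ _) _.
apply: le_trans (ler_sum _ (fun (j : 'I_k) _ => wM j (ltn_ord j))) _.
by rewrite sumr_const card_ord [leRHS]mulr_natl.
Qed.

End Interior.

(** * Choice of the time scale and of the constants *)

Lemma interior_estimates (R : realType) (n : nat) (cm cp alpha : R) :
  0 < cm -> 0 <= cp -> 0 < alpha -> alpha < 1 ->
  exists2 C : R, 0 < C & forall (N : nat) (T U G B : R)
    (a : R -> lattice n N -> dir n -> R) (u : R -> lattice n N -> R),
  (0 < N)%N -> 0 <= U -> 0 <= G -> 0 <= B ->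
  (forall t, t <= T -> elliptic_class cm cp (a t)) ->
  (forall t1 t2 x y e, t1 <= T -> t2 <= T -> `|a t1 (x + y) e - a t2 x e| <=
     B * (sqdist R y `^ (alpha / 2) + `|t1 - t2| `^ (alpha / 2))) ->
  (forall t x, t <= T -> `|u t x| <= U) ->
  (exists2 eta, 0 < eta & forall h, 0 < h <= eta -> forall t x, t + h <= T ->
     `|u (t + h) x - u t x - h * LN (a t) (u t) x| <= h * G) ->
  let V := (B + 1) `^ (1 + alpha^-1) * U + G in
  forall t, t <= T ->
  [/\ forall e x, `|lgrad e (u t) x| <=
        C * ((B + 1) `^ alpha^-1 * U + (B + 1)^-1 * G),
      forall e e1 x k, `|lgrad e (u t) (x + latt N (dvec e1) *+ k) - lgrad e (u t) x| <=
        C * V * (k%:R / N%:R) `^ alpha,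
      forall x r, 0 < r -> `|u t x - u (t - r) x| <= C * V * r `^ ((1 + alpha) / 2) &
      forall e x r, 0 < r -> `|lgrad e (u t) x - lgrad e (u (t - r)) x| <=
        C * V * r `^ (alpha / 2)].
Proof.
move=> cm0 cp0 a0 a1.
pose K k := @Kgrad R n cm cp k.
have Kn k : 0 <= K k by exact: Kgrad_ge0.
pose A := n%:R * n%:R * K 2 * (2 / alpha).
have ai0 : 0 < alpha^-1 by rewrite invr_gt0.
have A0 : 0 <= A by rewrite !mulr_ge0// ltW.
(* [s] below satisfies s^(alpha/2) = kappa / (B + 1), so [Ak] provides both absorption conditions at
   once. *)
pose kappa := (2 * (A + 1))^-1.
have kappa0 : 0 < kappa by rewrite invr_gt0 mulr_gt0// ltr_wpDl.
have kappa1 : kappa <= 1 by rewrite invf_le1 ?mulr_gt0 ?ltr_wpDl//; lra.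
have Ak : A * kappa <= 1 / 2.
  by rewrite /kappa ler_pdivrMr ?mulr_gt0 ?ltr_wpDl//; lra.
(* 1 + 1/alpha is the largest exponent of [q] that occurs, so [Th] serves for all of them in
   [qB]. *)
pose Th := kappa^-1 `^ (1 + alpha^-1).
have ki1 : 1 <= kappa^-1 by rewrite invf_ge1.
have Th0 : 0 <= Th by exact: powR_ge0.
pose b1 := 2 / (1 - alpha).
have b10 : 0 <= b1 by rewrite divr_ge0//; lra.
pose C1 := 4 * K 1 * (Th + 1).
have C10 : 0 <= C1 by rewrite !mulr_ge0// addr_ge0.
pose D := 4 / alpha * K 2 + 20 / (1 - alpha) * K 3.
have D0 : 0 <= D.
  rewrite addr_ge0 ?mulr_ge0// ?(ltW ai0)// invr_ge0; lra.
pose C2 := 2 * (K 2 * Th + (2 * K 1 + K 2) * b1 + n%:R * D * C1 + 2 * kappa^-1 * C1).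
have ki0 : 0 <= kappa^-1 by rewrite invr_ge0 ltW.
have C20 : 0 <= C2.
  rewrite /C2; repeat first [done | apply: addr_ge0 | apply: mulr_ge0].
pose C3 := 2 * n%:R * K 1 * (cp * (n%:R * C2) + C1) + 1 + 2 * Th.
have C30 : 0 < C3.
  rewrite /C3 -addrA addrCA addrC ltr_wpDl//.
    by repeat first [done | apply: addr_ge0 | apply: mulr_ge0].
pose C4 := 2 * C3 + 2 * C2.
pose C := C1 + C2 + C3 + C4.
have C40 : 0 <= C4 by rewrite /C4; lra.
exists C; first by rewrite /C; lra.
move=> N T U G B a u N0 U0 G0 B0 ell hol ule eul V t tT.
(* With B + 1 in place of B, the time [s] is defined and at most 1 even when B = 0. *)
pose B1 := B + 1; have B10 : 0 < B1 by rewrite /B1; lra.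
have B11 : 1 <= B1 by rewrite /B1; lra.
pose q := B1 / kappa; have q0 : 0 < q by rewrite divr_gt0.
have q1 : B1 <= q by rewrite /q -[leLHS]mulr1 ler_wpM2l// ltW.
pose s := q `^ (- (2 / alpha)).
have s0 : 0 < s by rewrite powR_gt0.
have sE p : s `^ p = q `^ (- (2 / alpha) * p) by rewrite powRrM.
have an0 : alpha != 0 by rewrite gt_eqF.
have qB p : 0 <= p -> p <= 1 + alpha^-1 -> q `^ p <= Th * B1 `^ p.
  move=> p0 p1; rewrite /q powRM ?(ltW B10)// mulrC ler_wpM2r ?powR_ge0//.
  exact: ler_powR.
have s1 : s <= 1.
  rewrite /s powRN invf_le1 ?powR_gt0//.
  have := @ge0_ler_powR R (2 / alpha); rewrite divr_ge0 ?(ltW a0)// => /(_ isT 1 q).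
  rewrite !nnegrE powR1 ler01 (ltW q0) => -> //; exact: le_trans q1.
have sa : s `^ (alpha / 2) = kappa / B1.
  rewrite sE (_ : - (2 / alpha) * (alpha / 2) = -1); last by field.
  by rewrite powR_inv1 ?(ltW q0)// invf_div.
have sa' : s `^ (- (alpha / 2)) = kappa^-1 * B1 by rewrite powRN sa invf_div mulrC.
have BB : B / B1 <= 1 by rewrite ler_pdivrMr// /B1; lra.
have hs : n%:R * n%:R * K 2 * B * (2 / alpha * s `^ (alpha / 2)) <= 1 / 2.
  have -> : n%:R * n%:R * K 2 * B * (2 / alpha * s `^ (alpha / 2)) = A * kappa * (B / B1).
    by rewrite sa /A; ring.
  apply: le_trans Ak; rewrite -[leRHS]mulr1; apply: ler_wpM2l => //.
  by rewrite mulr_ge0// ltW.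
have hs' : n%:R * K 2 * B * (2 / alpha * s `^ (alpha / 2)) <= 1 / 2.
  apply: le_trans hs; rewrite -!mulrA.
  have [n0|n0] := posnP n; first by rewrite n0 !mul0r.
  rewrite ler_wpM2l// -[leLHS]mul1r ler_wpM2r ?ler1n//.
  by rewrite !mulr_ge0 ?powR_ge0 ?(ltW ai0).
pose L := 2 * (K 1 * U * s `^ (- 1 / 2) + K 1 * G * (2 * s `^ (1 / 2))).
have L0 : 0 <= L by rewrite /L !(mulr_ge0, addr_ge0) ?powR_ge0.
have Lle t' e' x' : t' <= T -> `|lgrad e' (u t') x'| <= L.
  by move=> tT'; apply: (gradient_bound N0 cm0 a0 a1 U0 G0 B0 ell hol ule eul).
have LV : L <= C1 * (B1 `^ alpha^-1 * U + B1^-1 * G).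
  have H1 : s `^ (- 1 / 2) <= Th * B1 `^ alpha^-1.
    rewrite sE (_ : - (2 / alpha) * (- 1 / 2) = alpha^-1); last by field.
    by apply: qB; [exact: ltW|rewrite lerDr].
  (* Here s^(1/2) = q^(-1/alpha), and q >= 1 with 1/alpha >= 1 yields the exponent -1 of the source
     term. *)
  have H2 : s `^ (1 / 2) <= B1^-1.
    rewrite sE (_ : - (2 / alpha) * (1 / 2) = - alpha^-1); last by field.
    rewrite powRN lef_pV2 ?posrE ?powR_gt0//.
    apply: (le_trans q1); apply: le1r_powR; first exact: le_trans q1.
    by rewrite invf_ge1// ltW.
  have H3 : K 1 * U * s `^ (- 1 / 2) <= K 1 * U * (Th * B1 `^ alpha^-1).
    by apply: ler_wpM2l => //; rewrite mulr_ge0.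
  have H4 : K 1 * G * s `^ (1 / 2) <= K 1 * G * B1^-1.
    by apply: ler_wpM2l => //; rewrite mulr_ge0.
  have H5 : 0 <= K 1 * (B1 `^ alpha^-1 * U) by rewrite !mulr_ge0 ?powR_ge0.
  have H6 : 0 <= K 1 * Th * (B1 `^ alpha^-1 * U) by rewrite !mulr_ge0 ?powR_ge0.
  have H7 : 0 <= K 1 * Th * (B1^-1 * G) by rewrite !mulr_ge0 ?invr_ge0 ?(ltW B10).
  have H8 : 0 <= K 1 * (B1^-1 * G) by rewrite !mulr_ge0 ?invr_ge0 ?(ltW B10).
  by rewrite /L /C1; lra.
have B1p : B1 * B1 `^ alpha^-1 = B1 `^ (1 + alpha^-1).
  by rewrite powRD ?(gt_eqF B10) ?implybT// powRr1 ?(ltW B10).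
(* B + 1 times the gradient bound is a multiple of [V]; this brings every term in B L of the
   remaining estimates to the right size. *)
have B1L : B1 * L <= C1 * V.
  have := ler_wpM2l (ltW B10) LV.
  have -> : B1 * (C1 * (B1 `^ alpha^-1 * U + B1^-1 * G)) =
    C1 * (B1 * B1 `^ alpha^-1 * U + B1 / B1 * G) by ring.
  by rewrite B1p divff ?gt_eqF// mul1r.
have BL : B * L <= C1 * V.
  by apply: le_trans B1L; rewrite ler_wpM2r// lerDl.
have UV : B1 `^ (1 + alpha^-1) * U <= V by rewrite /V lerDl.
have GV : G <= V by rewrite /V lerDr mulr_ge0 ?powR_ge0.
have V0 : 0 <= V by exact: le_trans GV.
have sU : U * s `^ ((1 - alpha) / 2 - 1) <= Th * V.
  rewrite sE (_ : - (2 / alpha) * ((1 - alpha) / 2 - 1) = 1 + alpha^-1); last by field.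
  rewrite mulrC; apply: le_trans (ler_wpM2r U0 (qB _ _ _)) _ => //.
    by rewrite addr_ge0// ltW.
  by rewrite -mulrA ler_wpM2l.
have sG : G * s `^ ((1 - alpha) / 2) <= V.
  apply: le_trans GV; rewrite -[leRHS]mulr1 ler_wpM2l//.
  have p0 : 0 <= (1 - alpha) / 2 by lra.
  by have := @ge0_ler_powR R _ p0 s 1; rewrite !nnegrE powR1 ler01 (ltW s0) => ->.
have holder t' e e1 x k : t' <= T ->
  `|lgrad e (u t') (x + latt N (dvec e1) *+ k) - lgrad e (u t') x| <=
        C2 * V * (k%:R / N%:R) `^ alpha.
  move=> tT'.
  have := @holder_bound R n N cm cp alpha T U G B a u N0 cm0 a0 a1 U0 G0 B0 ell hol
    ule eul L s t' e e1 x k L0 Lle s0 hs tT'.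
  move=> /le_trans; apply; rewrite ler_wpM2r ?powR_ge0// -!/(K _) sa'.
  have H1 := ler_wpM2l (Kn 2) sU.
  have H2 : (2 * K 1 + K 2) * b1 * (G * s `^ ((1 - alpha) / 2)) <= (2 * K 1 + K 2) * b1 * V.
    by rewrite ler_wpM2l// mulr_ge0// addr_ge0// mulr_ge0.
  have H3 : n%:R * D * (B * L) <= n%:R * D * (C1 * V).
    by rewrite ler_wpM2l// mulr_ge0.
  have H4 : kappa^-1 * (B1 * L) <= kappa^-1 * (C1 * V) by rewrite ler_wpM2l.
  rewrite -/b1 /C2; move: H1 H2 H3 H4; rewrite /D; lra.
have holder_all t' e x y : t' <= T ->
    `|lgrad e (u t') (x + y) - lgrad e (u t') x| <= n%:R * (C2 * V) * sqdist R y `^ (alpha / 2).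
  move=> tT'; apply: line_to_all => //; first exact: ltW.
  by move=> x' e' k; exact: holder.
have C2V : 0 <= C2 * V by rewrite mulr_ge0.
have time x r : 0 < r -> `|u t x - u (t - r) x| <= C3 * V * r `^ ((1 + alpha) / 2).
  move=> r0; have s01 : 0 < s <= 1 by rewrite s0.
  have nC : 0 <= n%:R * (C2 * V) by rewrite mulr_ge0.
  have := @time_bound R n N cm cp alpha T U G B a u N0 cm0 a0 a1 U0 G0 B0 ell hol
    ule eul L (n%:R * (C2 * V)) s r t x L0 nC s01 r0 tT cp0 Lle holder_all.
  move=> /le_trans; apply; rewrite ler_wpM2r ?powR_ge0// -!/(K _).
  have -> : - ((1 + alpha) / 2) = (1 - alpha) / 2 - 1 by lra.
  have H1 : n%:R * K 1 * (B * L) <= n%:R * K 1 * (C1 * V).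
    by rewrite ler_wpM2l// mulr_ge0.
  rewrite /C3; move: H1 sU GV; lra.
have C3V : 0 <= C3 * V by rewrite mulr_ge0// ltW.
have CV (c : R) : 0 <= c -> c <= C -> c * V <= C * V by move=> *; rewrite ler_wpM2r.
split.
- move=> e x; apply: le_trans (Lle t e x tT) _; apply: le_trans LV _.
  rewrite ler_wpM2r ?addr_ge0 ?mulr_ge0 ?powR_ge0 ?invr_ge0 ?(ltW B10)//.
  by rewrite /C; lra.
- move=> e e1 x k; apply: le_trans (holder _ _ _ _ _ tT) _.
  by rewrite ler_wpM2r ?powR_ge0// CV// /C; lra.
- move=> x r r0; apply: le_trans (time x r r0) _.
  by rewrite ler_wpM2r ?powR_ge0// CV// /C; lra.
- move=> e x r r0.
  have tm x' := time x' r r0.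
  have := @gradient_time_bound R n N alpha T u N0 a0 a1 (C3 * V) (C2 * V) r t e x r0 tT
    C2V C3V tm (fun t' x' k h => holder t' e e x' k h).
  move=> /le_trans; apply; rewrite ler_wpM2r ?powR_ge0//.
  have -> : 2 * (C3 * V) + 2 * (C2 * V) = C4 * V by rewrite /C4; ring.
  by rewrite CV// /C; lra.
Qed.

(** * Polylinear interpolation *)

Section Interpolation.
Variables (R : realType) (n N : nat) (alpha : R).
Hypothesis N0 : (0 < N)%N.
Hypothesis alpha0 : 0 < alpha.
Hypothesis alpha1 : alpha < 1.
Implicit Types (w : lattice n N -> R) (p q : 'rV[R]_n) (x : lattice n N).

Local Notation E e := (@latt n N (dvec e)).

Lemma fracpart_itv (b : R) : 0 <= fracpart b < 1.
Proof.
rewrite /fracpart subr_ge0 floor_le_tmp /=.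
by have := floorD1_gt b; rewrite intrD; lra.
Qed.

Definition lerp (f : int -> R) (b : R) : R :=
  (1 - fracpart b) * f (Num.floor b) + fracpart b * f (Num.floor b + 1).

(** Between different cells one passes through the node above [b] and the node below [c]: three
    pieces, each at most K (|b - c| / N)^alpha. A partial cell of relative length y <= 1 is handled
    by y <= y^alpha. *)
Lemma lerp_holder (f : int -> R) K b c :
  0 <= K -> (forall k l : int, `|f k - f l| <= K * (`|k - l|%:~R / N%:R) `^ alpha) ->
  `|lerp f b - lerp f c| <= 3 * K * (`|b - c| / N%:R) `^ alpha.
Proof.
move=> K0 fK.
wlog bc : b c / b <= c => [H|].
  have [bc|cb] := leP b c; first exact: H.
  by rewrite distrC [`|b - c|]distrC; apply: H; exact: ltW.
have NN : 0 < N%:R :> R by rewrite ltr0n.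
have step1 k : `|f (k + 1) - f k| <= K * N%:R^-1 `^ alpha.
  by have := fK (k + 1) k; rewrite addrAC subrr add0r normr1 mul1r.
have scale (y z : R) : 0 <= y <= 1 -> y <= z -> y * (K * N%:R^-1 `^ alpha) <= K * (z / N%:R) `^ alpha.
  move=> /andP[y0 y1] yz; rewrite mulrCA ler_wpM2l//.
  have z0 : 0 <= z by exact: le_trans yz.
  rewrite powRM ?invr_ge0// ler_wpM2r ?powR_ge0//.
  apply: (@le_trans _ _ (y `^ alpha)).
    have [->|y0'] := eqVneq y 0; first exact: powR_ge0.
    by apply: ger1_powR; [rewrite lt0r y0' y0|exact: ltW].
  by apply: ge0_ler_powR => //; rewrite ?nnegrE ?(ltW alpha0).
have bc0 : 0 <= c - b by rewrite subr_ge0.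
rewrite [`|b - c|]distrC (ger0_norm bc0).
have /andP[fb0 fb1] := fracpart_itv b; have /andP[fc0 fc1] := fracpart_itv c.
set X := (_ / _) `^ _.
have X0 : 0 <= K * X by rewrite mulr_ge0 ?powR_ge0.
have bE : b = (Num.floor b)%:~R + fracpart b by rewrite /fracpart addrC subrK.
have cE : c = (Num.floor c)%:~R + fracpart c by rewrite /fracpart addrC subrK.
have [fbc|fbc] := eqVneq (Num.floor b) (Num.floor c).
  have -> : lerp f b - lerp f c =
      (fracpart b - fracpart c) * (f (Num.floor b + 1) - f (Num.floor b)).
    by rewrite /lerp -fbc; ring.
  have d : fracpart c - fracpart b = c - b by rewrite {2}bE {2}cE fbc; ring.
  rewrite normrM distrC d (ger0_norm bc0).
  apply: (@le_trans _ _ ((c - b) * (K * N%:R^-1 `^ alpha))); first by rewrite ler_wpM2l.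
  have := scale (c - b) (c - b); rewrite bc0 lexx -d => /(_ _ isT) H.
  have {}H : (fracpart c - fracpart b) * (K * N%:R^-1 `^ alpha) <= K * X.
    by rewrite /X -d; apply: H; lra.
  by lra.
have fl : Num.floor b + 1 <= Num.floor c.
  by rewrite lezD1 lt_neqAle fbc le_floor.
have -> : lerp f b - lerp f c =
  - ((1 - fracpart b) * (f (Num.floor b + 1) - f (Num.floor b))) -
  (f (Num.floor c) - f (Num.floor b + 1)) -
  fracpart c * (f (Num.floor c + 1) - f (Num.floor c)) by rewrite /lerp; ring.
have fl' : (Num.floor b)%:~R + 1 <= (Num.floor c)%:~R :> R.
  by rewrite -[1]/(1%:~R) -intrD ler_int.
have A1 : `|- ((1 - fracpart b) * (f (Num.floor b + 1) - f (Num.floor b)))| <= K * X.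
  rewrite normrN normrM ger0_norm; last lra.
  apply: le_trans (_ : (1 - fracpart b) * (K * N%:R^-1 `^ alpha) <= _).
    by rewrite ler_wpM2l//; lra.
  by apply: scale; [apply/andP; split; lra|move: bE cE fl'; lra].
have A2 : `|f (Num.floor c) - f (Num.floor b + 1)| <= K * X.
  apply: le_trans (fK _ _) _; rewrite ler_wpM2l//.
  apply: ge0_ler_powR => //; rewrite ?nnegrE ?divr_ge0 ?(ltW alpha0)//.
  rewrite ler_wpM2r ?invr_ge0//.
  rewrite ger0_norm ?subr_ge0// rmorphB/= intrD; move: bE cE; lra.
have A3 : `|fracpart c * (f (Num.floor c + 1) - f (Num.floor c))| <= K * X.
  rewrite normrM ger0_norm//.
  apply: le_trans (_ : fracpart c * (K * N%:R^-1 `^ alpha) <= _).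
    by rewrite ler_wpM2l.
  by apply: scale; [apply/andP; split; lra|move: bE cE fl'; lra].
apply: le_trans (ler_normB _ _) _; apply: le_trans (lerD (ler_normB _ _) A3) _.
by move: A1 A2; lra.
Qed.

Lemma theta_ge0 v (b : R) : 0 <= theta N v b.
Proof.
by rewrite /theta; have /andP[? ?] := fracpart_itv (N%:R * b); case: v; lra.
Qed.

Lemma sum_theta p : \sum_(v : {ffun 'I_n -> bool}) \prod_(i < n) theta N (v i) (p 0 i) = 1.
Proof.
rewrite -(bigA_distr_bigA (fun i b => theta N b (p 0 i))) big1// => i _.
by rewrite big_bool/= /theta; lra.
Qed.

Definition node p (v : {ffun 'I_n -> bool}) : lattice n N :=
  latt N (\row_i (Num.floor (N%:R * p 0 i) + (v i : nat)%:Z)).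

Lemma polylinE w p : polylin w p =
  \sum_(v : {ffun 'I_n -> bool}) (\prod_(i < n) theta N (v i) (p 0 i)) * w (node p v).
Proof. by []. Qed.

Lemma polylin_le w p k : (forall x, `|w x| <= k) -> `|polylin w p| <= k.
Proof.
move=> wk; rewrite polylinE -[leRHS]mul1r -[X in _ <= X * _](sum_theta p) mulr_suml.
apply: le_trans (ler_norm_sum _ _ _) _; apply: ler_sum => v _.
by rewrite normrM ger0_norm ?prodr_ge0 ?ler_wpM2l ?prodr_ge0// => i _; exact: theta_ge0.
Qed.

Lemma polylinB w w' p : polylin (fun x => w x - w' x) p = polylin w p - polylin w' p.
Proof. by rewrite !polylinE -sumrB; apply: eq_bigr => v _; rewrite mulrBr. Qed.

Lemma polylinZ k w p : polylin (fun x => k * w x) p = k * polylin w p.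
Proof. by rewrite !polylinE mulr_sumr; apply: eq_bigr => v _; rewrite mulrCA. Qed.

Definition flip (i : 'I_n) (v : {ffun 'I_n -> bool}) : {ffun 'I_n -> bool} :=
  [ffun j => if j == i then ~~ v j else v j].

Lemma flipK i : involutive (flip i).
Proof. by move=> v; apply/ffunP => j; rewrite !ffunE; case: eqP => // _; rewrite negbK. Qed.

Definition axis p (i : 'I_n) (v : {ffun 'I_n -> bool}) (k : int) : lattice n N :=
  latt N (\row_j (if j == i then k else Num.floor (N%:R * p 0 j) + (v j : nat)%:Z)).

(** Summation over all vertices [v] counts each edge in direction [i] twice, through [v] and
    [flip i v]; hence the factor 2. *)
Lemma polylin_axis i w p : 2 * polylin w p =
  \sum_(v : {ffun 'I_n -> bool}) (\prod_(j < n | j != i) theta N (v j) (p 0 j)) *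
    lerp (w \o axis p i v) (N%:R * p 0 i).
Proof.
rewrite mulrDl mul1r polylinE [X in _ + X = _](reindex_inj (inv_inj (flipK i))).
rewrite -big_split/=.
apply: eq_bigr => v _; rewrite (bigD1 i)//= [X in _ + X * _](bigD1 i)//=.
have -> : \prod_(j < n | j != i) theta N (flip i v j) (p 0 j) =
          \prod_(j < n | j != i) theta N (v j) (p 0 j).
  by apply: eq_bigr => j ji; rewrite ffunE (negbTE ji).
have nE (v' : {ffun 'I_n -> bool}) : (forall j, j != i -> v' j = v j) ->
    node p v' = axis p i v (Num.floor (N%:R * p 0 i) + (v' i : nat)%:Z).
  move=> v'v; congr latt; apply/rowP => j; rewrite !mxE.
  by case: (eqVneq j i) => [->//|ji]; rewrite v'v.
rewrite (nE v)// (nE (flip i v)); last by move=> j ji; rewrite ffunE (negbTE ji).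
rewrite ffunE eqxx /lerp /theta; case: (v i); rewrite /= ?addr0; ring.
Qed.

Lemma axis_line w p i v K :
  (forall (x : lattice n N) e k, `|w (x + E e *+ k) - w x| <= K * (k%:R / N%:R) `^ alpha) ->
  forall k l : int, `|(w \o axis p i v) k - (w \o axis p i v) l| <=
    K * (`|k - l|%:~R / N%:R) `^ alpha.
Proof.
move=> wK; have H (k : int) (m : nat) : `|w (axis p i v (k + m%:Z)) - w (axis p i v k)| <=
    K * (m%:R / N%:R) `^ alpha.
  have -> : axis p i v (k + m%:Z) = axis p i v k + E (i, true) *+ m; last exact: wK.
  rewrite lshiftMn// -lattD//; congr latt; apply/rowP => j.
  rewrite !mxE mulmxnE !mxE/=; case: eqP => _; last by rewrite mul0rn addr0.
  by rewrite natz.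
move=> k l /=.
have -> : `|k - l|%:~R = (absz (k - l))%:R :> R by rewrite pmulrn abszE.
have [kl|/ltW kl] := leP l k.
  by have := H l (absz (k - l)); rewrite gez0_abs ?subr_ge0// subrKC.
by have := H k (absz (l - k)); rewrite gez0_abs ?subr_ge0// subrKC distrC -abszN opprB.
Qed.

Lemma polylin_coord w p q i K : 0 <= K ->
  (forall (x : lattice n N) e k, `|w (x + E e *+ k) - w x| <= K * (k%:R / N%:R) `^ alpha) ->
  (forall j, j != i -> p 0 j = q 0 j) ->
  `|polylin w p - polylin w q| <= 3 * K * `|p 0 i - q 0 i| `^ alpha.
Proof.
move=> K0 wK pq; rewrite -(@ler_pM2l _ 2)// -[X in X * `|_|]gtr0_norm// -normrM mulrBr.
rewrite !(polylin_axis i) -sumrB.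
pose P (v : {ffun 'I_n -> bool}) := \prod_(j < n | j != i) theta N (v j) (p 0 j).
have P0 v : 0 <= P v by apply: prodr_ge0 => j _; exact: theta_ge0.
(* [polylin_axis] for the constant function 1. *)
have P1 : \sum_v P v = 2.
  have := polylin_axis i (fun=> 1) p; rewrite polylinE.
  under eq_bigr do rewrite mulr1.
  rewrite sum_theta mulr1 => ->; apply: eq_bigr => v _.
  by rewrite -/(P v) /lerp /=; ring.
rewrite -P1 mulr_suml; apply: le_trans (ler_norm_sum _ _ _) _; apply: ler_sum => v _.
have -> : \prod_(j < n | j != i) theta N (v j) (q 0 j) = P v.
  by apply: eq_bigr => j ji; rewrite pq.
have -> : axis q i v = axis p i v.
  apply/funext => k; congr latt; apply/rowP => j; rewrite !mxE.
  by case: eqVneq => // ji; rewrite pq.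
rewrite -/(P v) -mulrBr normrM ger0_norm// ler_wpM2l//.
apply: le_trans (lerp_holder _ _ K0 (axis_line _ _ _ wK)) _.
by rewrite -mulrBr normrM normr_nat [N%:R * _]mulrC mulfK// pnatr_eq0 -lt0n.
Qed.

Lemma enorm_ge0 p : 0 <= enorm p. Proof. exact: sqrtr_ge0. Qed.

Lemma enorm_coord p i : `|p 0 i| <= enorm p.
Proof.
rewrite -sqrtr_sqr /enorm ler_sqrt ?sumr_ge0// => [|j _]; last exact: sqr_ge0.
by rewrite (bigD1 i)//= lerDl sumr_ge0// => j _; rewrite sqr_ge0.
Qed.

(** The coordinates of [q] are exchanged for those of [p] one at a time, which gives the factor
    n. *)
Lemma polylin_holder w p q K : 0 <= K ->
  (forall (x : lattice n N) e k, `|w (x + E e *+ k) - w x| <= K * (k%:R / N%:R) `^ alpha) ->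
  `|polylin w p - polylin w q| <= n%:R * (3 * K) * enorm (p - q) `^ alpha.
Proof.
move=> K0 wK.
pose r (k : nat) : 'rV[R]_n := \row_j (if (j < k)%N then p 0 j else q 0 j).
have H k : (k <= n)%N -> `|polylin w (r k) - polylin w (r 0%N)| <=
    k%:R * (3 * K) * enorm (p - q) `^ alpha.
  elim: k => [|k IH] kn; first by rewrite subrr normr0 !mul0r.
  have -> : polylin w (r k.+1) - polylin w (r 0%N) =
    (polylin w (r k.+1) - polylin w (r k)) + (polylin w (r k) - polylin w (r 0%N)) by ring.
  apply: le_trans (ler_normD _ _) _; rewrite -natr1 addrC 2!mulrDl mul1r.
  apply: lerD; first by apply: IH; exact: ltnW.
  apply: le_trans (polylin_coord (i := Ordinal kn) K0 wK _) _.
    move=> j jk; rewrite !mxE ltnS leq_eqVlt.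
    by have /negbTE -> : (j : nat) != k by [].
  rewrite !mxE /= ltnSn ltnn ler_wpM2l ?mulr_ge0//.
  apply: ge0_ler_powR; rewrite ?nnegrE ?enorm_ge0 ?(ltW alpha0)//.
  by have := enorm_coord (p - q) (Ordinal kn); rewrite !mxE.
have := H n (leqnn n).
have -> : r n = p by apply/rowP => j; rewrite !mxE ltn_ord.
by have -> : r 0%N = q by apply/rowP => j; rewrite !mxE.
Qed.

Lemma polylin_shift w p e :
  polylin w (p + N%:R^-1 *: map_mx intr (dvec e)) = polylin (fun x => w (lat_shift x e)) p.
Proof.
have NN : N%:R != 0 :> R by rewrite pnatr_eq0 -lt0n.
have F i : N%:R * (p + N%:R^-1 *: map_mx intr (dvec e)) 0 i =
    N%:R * p 0 i + (dvec e 0 i)%:~R.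
  by rewrite !mxE mulrDr mulVKf.
have G i : Num.floor (N%:R * (p + N%:R^-1 *: map_mx intr (dvec e)) 0 i) =
    Num.floor (N%:R * p 0 i) + dvec e 0 i.
  by rewrite F floorDrz ?intr_int // intrKfloor.
apply: eq_bigr => v _; congr (_ * w _).
  apply: eq_bigr => i _; rewrite /theta /fracpart G F intrD.
  by rewrite opprD addrACA subrr addr0.
rewrite /lat_shift -lattD//; congr latt; apply/rowP => i.
rewrite mxE G !mxE; ring.
Qed.

(** A shift by one mesh width maps cells to cells with the same weights, so difference quotients
    commute with interpolation. *)
Lemma tgrad_interp (u : R -> lattice n N -> R) e t p :
  tgrad N e (interp u) (t, to_torus p) = polylin (lgrad e (u t)) p.
Proof.
by rewrite /tgrad /= tshiftE !interpE polylin_shift /lgrad polylinZ polylinB.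
Qed.

(** The hypothesis holds for every pair of lifts. Raised to the power 1/alpha it becomes a lower
    bound for all [enorm (p - q)], hence for their infimum. *)
Lemma torus_holder (F : torus R n -> R) K : 0 <= K ->
  (forall p q, `|F (to_torus p) - F (to_torus q)| <= K * enorm (p - q) `^ alpha) ->
  forall z y, `|F z - F y| <= K * tdist z y `^ alpha.
Proof.
move=> K0 FK z y; have lift (x : torus R n) : exists p : 'rV[R]_n, to_torus p = x.
  by exists (repr x); exact: reprK.
have [pz pzE] := lift z; have [py pyE] := lift y.
move: K0; rewrite le_eqVlt => /predU1P[K0|K0].
  by have := FK pz py; rewrite pzE pyE -K0 !mul0r.
rewrite mulrC -ler_pdivrMr//; set r := _ / K.
have r0 : 0 <= r by rewrite divr_ge0// ltW.
have rE : r = (r `^ alpha^-1) `^ alpha by rewrite -powRrM mulVf ?gt_eqF// powRr1.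
rewrite rE; apply: ge0_ler_powR; rewrite ?nnegrE ?powR_ge0 ?tdist_ge0 ?(ltW alpha0)//.
apply: lb_le_inf; first by exists (enorm (pz - py)); exists (pz, py).
move=> _ [[p q] /= [pE qE] <-].
have H : r <= enorm (p - q) `^ alpha.
  by rewrite /r ler_pdivrMr// mulrC -pE -qE; exact: FK.
have ai0 : 0 <= alpha^-1 by rewrite invr_ge0 ltW.
apply: (@le_trans _ _ ((enorm (p - q) `^ alpha) `^ alpha^-1)).
  by apply: ge0_ler_powR; rewrite ?nnegrE ?powR_ge0.
by rewrite -powRrM mulfV ?gt_eqF// powRr1// enorm_ge0.
Qed.

End Interpolation.

(** * Extension to negative times *)

Section OneSidedDerivative.
Variable R : realType.
Implicit Types (T t l e : R) (f F : R -> R).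

Lemma has_deriv_on_dist T f t l e : has_deriv_on T f t l -> 0 < e ->
  exists2 d, 0 < d & forall s, s \in `[0, T] -> s != t -> `|s - t| < d ->
    `|(f s - f t) / (s - t) - l| < e.
Proof.
move=> /cvgrPdist_lt H e0; have := H e e0; move=> /nbhs_ballP[d /= d0 dH].
exists d => // s sT st std; rewrite distrC; apply: dH => //.
by rewrite /ball /= distrC.
Qed.

Lemma has_deriv_on_continuous T f :
  (forall t, t \in `[0, T] -> exists l, has_deriv_on T f t l) ->
  forall a b, 0 <= a -> b <= T -> {within `[a, b], continuous f}.
Proof.
move=> df a b a0 bT; apply/subspace_continuousP => t /= tab.
have tT : t \in `[0, T].
  move: tab; rewrite !in_itv/= => /andP[at_ tb].
  by rewrite (le_trans a0)// (le_trans tb).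
have [l Hl] := df t tT.
have [d d0 dH] := has_deriv_on_dist Hl ltr01.
apply/cvgrPdist_lt => e e0.
have c0 : 0 < `|l| + 1 by rewrite ltr_wpDl.
pose m := Num.min d (e / (`|l| + 1)).
apply/nbhs_ballP; exists m; first by rewrite /= lt_min d0 divr_gt0.
move=> s /=; rewrite /ball /= distrC lt_min => /andP[sd se] sab.
have sT : s \in `[0, T].
  move: sab; rewrite !in_itv/= => /andP[as_ sb].
  by rewrite (le_trans a0)// (le_trans sb).
have [->|st] := eqVneq s t; first by rewrite subrr normr0.
have st0 : 0 < `|s - t| by rewrite normr_gt0 subr_eq0.
have := dH s sT st sd; set q := _ / _ => ql.
have -> : f t - f s = - (q * (s - t)).
  by rewrite /q divfK ?subr_eq0// opprB.
rewrite normrN normrM.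
have qb : `|q| < `|l| + 1.
  have := ler_normD (q - l) l; rewrite subrK; lra.
rewrite ltr_pdivlMr// in se.
apply: le_lt_trans se; rewrite [leRHS]mulrC; apply: ler_wpM2r => //; exact: ltW.
Qed.

(** At interior points the derivative relative to [0, T] is an ordinary one, and at the end points
    continuity is enough. *)
Lemma mean_value_on T f F :
  (forall t, t \in `[0, T] -> has_deriv_on T f t (F t)) ->
  forall a b, 0 <= a -> a <= b -> b <= T ->
  exists2 c, a <= c <= b & f b - f a = F c * (b - a).
Proof.
move=> df a b a0 ab bT.
have cf : {within `[a, b], continuous f}.
  by apply: (@has_deriv_on_continuous T) => // t tT; exists (F t); exact: df.
suff dF x : x \in `]a, b[ -> is_derive x 1 f (F x).
  by have [c cab E] := MVT_segment ab dF cf; exists c; rewrite ?in_itv// in cab *.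
rewrite in_itv/= => /andP[ax xb].
have xT : x \in `[0, T] by rewrite in_itv/= (le_trans a0) ?(ltW ax)// (le_trans (ltW xb)).
have cvg : h^-1 *: ((f \o shift x) (h *: 1) - f x) @[h --> 0^'] --> F x.
  apply/cvgrPdist_lt => e e0.
  have [d d0 dH] := has_deriv_on_dist (df x xT) e0.
  pose m := Num.min d (Num.min (x - a) (b - x)).
  apply/nbhs_ballP; exists m; first by rewrite /= !lt_min d0 !subr_gt0 ax xb.
  move=> h /=; rewrite /ball /= sub0r normrN !lt_min => /andP[hd /andP[ha hb]] h0.
  have hE : h *: (1 : R) = h by rewrite /GRing.scale /= mulr1.
  rewrite hE distrC; have := dH (h + x).
  rewrite addrK => H; rewrite /GRing.scale /= mulrC; apply: H => //.
  - move: ha hb; rewrite !ltr_norml in_itv/= => /andP[? _] /andP[_ ?].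
    by apply/andP; split; lra.
  - by rewrite -subr_eq0 addrK.
apply: DeriveDef; first by apply/cvg_ex; exists (F x).
exact: cvg_lim.
Qed.

End OneSidedDerivative.

Section Extension.
Variables (R : realType) (n N : nat).
Hypothesis N0 : (0 < N)%N.

Lemma LN_le (a : lattice n N -> dir n -> R) v x A V :
  (forall e, `|a x e| <= A) -> (forall y, `|v y| <= V) ->
  `|LN a v x| <= 4 * n%:R * N%:R ^+ 2 * A * V.
Proof.
move=> aA vV; rewrite /LN normrM ger0_norm ?exprn_ge0//.
have -> : 4 * n%:R * N%:R ^+ 2 * A * V = N%:R ^+ 2 * ((n * 2)%:R * (A * (2 * V))).
  by rewrite natrM; ring.
rewrite ler_wpM2l ?exprn_ge0//; apply: le_trans (ler_norm_sum _ _ _) _.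
apply: (@le_trans _ _ (\sum_(e : dir n) A * (2 * V))).
  apply: ler_sum => e _; rewrite normrM; apply: ler_pM => //.
  by apply: le_trans (ler_normB _ _) _; have := vV (lat_shift x e); have := vV x; lra.
by rewrite sumr_const card_prod card_ord card_bool [leRHS]mulr_natl.
Qed.

Lemma LN_sub (a b : lattice n N -> dir n -> R) v w x :
  LN a v x - LN b w x =
  LN (fun y e => a y e - b y e) v x + LN b (fun y => v y - w y) x.
Proof.
rewrite /LN -!mulrBr -mulrDr -sumrB -big_split/=; congr (_ * _).
by apply: eq_bigr => e _; ring.
Qed.

Lemma CkN2_gradient (v : lattice n N -> R) e x : `|lgrad e v x| <= CkN_norm 2 v.
Proof.
have bm0 (es : seq (dir n)) : 0 <= \big[Num.max/0]_x `|foldr (@lgrad R n N) v es x|.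
  exact: bigmax_ge_id.
rewrite /CkN_norm (bigD1 (inord 1))//= inordK//.
rewrite (bigD1 [tuple e])//= -addrA.
apply: le_trans (le_bigmax 0 (fun x => `|lgrad e v x|) x) _.
by rewrite lerDl addr_ge0// sumr_ge0// => i _; rewrite sumr_ge0.
Qed.

Lemma CkN2_hessian (v : lattice n N -> R) e1 e2 x :
  `|lgrad e1 (lgrad e2 v) x| <= CkN_norm 2 v.
Proof.
have bm0 (es : seq (dir n)) : 0 <= \big[Num.max/0]_x `|foldr (@lgrad R n N) v es x|.
  exact: bigmax_ge_id.
rewrite /CkN_norm (bigD1 (inord 2))//= inordK//.
rewrite (bigD1 [tuple e1; e2])//= -addrA.
apply: le_trans (le_bigmax 0 (fun x => `|lgrad e1 (lgrad e2 v) x|) x) _.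
by rewrite lerDl addr_ge0// sumr_ge0// => i _; rewrite sumr_ge0.
Qed.

(** The origin of C_2: in divergence form, the product rule yields for each of the n positive
    directions a difference of the coefficient times a gradient, plus a coefficient times a second
    difference. *)
Lemma LN_initial (a : lattice n N -> dir n -> R) v x cm cp C0 C1 : 0 < cm ->
  elliptic_class cm cp a -> CkN_norm 2 v <= C0 ->
  (forall x e, `|lgrad_star_coef a x e| <= C1) ->
  `|LN a v x| <= n%:R * (C1 * C0 + cp * C0).
Proof.
move=> cm0 [asym ab] vC aC; rewrite LN_divergence// normrN.
apply: le_trans (ler_norm_sum _ _ _) _.
apply: (@le_trans _ _ (\sum_(i < n) (C1 * C0 + cp * C0))); last first.
  by rewrite sumr_const card_ord [leRHS]mulr_natl.
apply: ler_sum => i _; set e := (i, true).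
have -> : lgrad (i, false) (fun y => a y e * lgrad e v y) x =
    lgrad_star_coef a x e * lgrad e v x +
    a (lat_shift x (i, false)) e * lgrad (i, false) (lgrad e v) x.
  by rewrite /lgrad_star_coef /lgrad /dopp /=; ring.
have g1 := le_trans (CkN2_gradient v e x) vC.
have g2 := le_trans (CkN2_hessian v (i, false) e x) vC.
apply: le_trans (ler_normD _ _) _; rewrite [X in X + _]normrM [X in _ + X]normrM.
apply: lerD; apply: ler_pM => //.
have /andP[a1 a2] := ab (lat_shift x (i, false)) e.
by rewrite ger0_norm// (le_trans (ltW cm0)).
Qed.

Variables (T cm cp alpha B U G C2 : R).
Variables (a : R -> lattice n N -> dir n -> R) (g u : R -> lattice n N -> R).
Hypothesis cm0 : 0 < cm.
Hypothesis alpha0 : 0 < alpha.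
Hypothesis alpha1 : alpha < 1.
Hypothesis U0 : 0 <= U.
Hypothesis G0 : 0 <= G.
Hypothesis B0 : 0 <= B.
Hypothesis C20 : 0 <= C2.
Hypothesis cp0 : 0 <= cp.
Hypothesis T0 : 0 < T.
Hypothesis u_sol : solves T a g u.
Hypothesis a_ell : forall t, t \in `[0, T] -> elliptic_class cm cp (a t).
Hypothesis a_hol : forall t1 t2 x e, t1 \in `[0, T] -> t2 \in `[0, T] ->
  `|a t1 x e - a t2 x e| <= B * `|t2 - t1| `^ (alpha / 2).
Hypothesis g_le : forall t x, t \in `[0, T] -> `|g t x| <= G.
Hypothesis u_le : forall t x, t \in `[0, T] -> `|u t x| <= U.
Hypothesis u_init : forall x, `|LN (a 0) (u 0) x| <= C2.

Lemma solution_mvt t1 t2 x : 0 <= t1 -> t1 <= t2 -> t2 <= T ->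
  exists2 c, t1 <= c <= t2 &
    u t2 x - u t1 x = (LN (a c) (u c) x + g c x) * (t2 - t1).
Proof.
move=> t10 t12 t2T.
by apply: (@mean_value_on R T (u ^~ x) (fun c => LN (a c) (u c) x + g c x)) => // t tT;
  exact: u_sol.
Qed.

(** The equation makes [u] Lipschitz in time, with a constant depending on N, and [a] is Hoelder
    continuous. The dependence of [eta] on N only limits the length of the Euler steps. *)
Lemma operator_modulus eps : 0 < eps -> exists2 eta, 0 < eta &
  forall t c x, 0 <= t -> t <= c -> c <= T -> c - t <= eta ->
    `|LN (a c) (u c) x - LN (a t) (u t) x| <= eps.
Proof.
move=> eps0.
have NN0 : 0 <= 4 * n%:R * N%:R ^+ 2 :> R by rewrite !mulr_ge0.
pose Lip := 4 * n%:R * N%:R ^+ 2 * cp * U + G.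
have Lip0 : 0 <= Lip by rewrite addr_ge0 ?mulr_ge0.
have inT t : 0 <= t -> t <= T -> t \in `[0, T] by move=> ? ?; rewrite in_itv/=; apply/andP.
have acp t y e : t \in `[0, T] -> `|a t y e| <= cp.
  move=> tT; have [_ /(_ y e) /andP[a1 a2]] := a_ell tT.
  by rewrite ger0_norm// (le_trans (ltW cm0)).
have lip t c y : 0 <= t -> t <= c -> c <= T -> `|u c y - u t y| <= Lip * (c - t).
  move=> t0 tc cT; have [d /andP[td dc] ->] := solution_mvt y t0 tc cT.
  have dT : d \in `[0, T] by apply: inT; [exact: le_trans td|exact: le_trans cT].
  rewrite normrM [X in _ * X]ger0_norm ?subr_ge0// ler_wpM2r ?subr_ge0//.
  apply: le_trans (ler_normD _ _) _; apply: lerD; last exact: g_le.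
  by apply: LN_le => [e|z]; [exact: acp|exact: u_le].
pose Q := 4 * n%:R * N%:R ^+ 2 * (B * U + cp * Lip) + 1.
have Q0 : 0 < Q by rewrite ltr_wpDl// mulr_ge0// addr_ge0 ?mulr_ge0.
(* For d <= 1 both moduli are at most d^(alpha/2), and then Q d^(alpha/2) <= eps. *)
pose eta := Num.min 1 ((eps / Q) `^ (2 / alpha)).
exists eta; first by rewrite lt_min ltr01 powR_gt0// divr_gt0.
move=> t c x t0 tc cT; rewrite le_min => /andP[ct1 ctQ].
have tT : t \in `[0, T] by apply: inT => //; exact: le_trans cT.
have cT' : c \in `[0, T] by apply: inT => //; exact: le_trans tc.
set d := c - t in ct1 ctQ *; have d0 : 0 <= d by rewrite subr_ge0.
have dE : d <= d `^ (alpha / 2).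
  have [->|dn] := eqVneq d 0; first exact: powR_ge0.
  by apply: ger1_powR; [rewrite lt0r dn d0|have := alpha1; lra].
have dQ : d `^ (alpha / 2) <= eps / Q.
  have -> : eps / Q = ((eps / Q) `^ (2 / alpha)) `^ (alpha / 2).
    rewrite -powRrM (_ : 2 / alpha * (alpha / 2) = 1) ?powRr1//.
      by rewrite divr_ge0 ?ltW.
    by rewrite mulrA divfK ?gt_eqF// divff.
  by apply: ge0_ler_powR; rewrite ?nnegrE ?powR_ge0 ?divr_ge0 ?(ltW alpha0).
rewrite LN_sub; apply: le_trans (ler_normD _ _) _.
have H1 : `|LN (fun y e => a c y e - a t y e) (u c) x| <=
    4 * n%:R * N%:R ^+ 2 * (B * d `^ (alpha / 2)) * U.
  apply: LN_le => [e|y]; last exact: u_le.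
  by apply: le_trans (a_hol _ _ cT' tT) _; rewrite distrC -/d (ger0_norm d0).
have H2 : `|LN (a t) (fun y => u c y - u t y) x| <=
    4 * n%:R * N%:R ^+ 2 * cp * (Lip * d).
  by apply: LN_le => [e|y]; [exact: acp|exact: lip].
have H3 : 4 * n%:R * N%:R ^+ 2 * cp * Lip * d <=
   4 * n%:R * N%:R ^+ 2 * cp * Lip * d `^ (alpha / 2).
  by rewrite ler_wpM2l// !mulr_ge0.
have H4 : Q * d `^ (alpha / 2) <= eps by rewrite mulrC -ler_pdivlMr.
have := powR_ge0 d (alpha / 2); move: H1 H2 H3 H4; rewrite /Q; lra.
Qed.

(* Extended by [u 0] to negative times, [u] solves the equation there with source
   [- LN (a 0) (u 0)], so that only interior estimates are needed. *)
Lemma euler_extension eps : 0 < eps -> exists2 eta, 0 < eta &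
  forall h, 0 < h <= eta -> forall t x, t + h <= T ->
  `|u (Num.max (t + h) 0) x - u (Num.max t 0) x -
     h * LN (a (Num.max t 0)) (u (Num.max t 0)) x| <= h * (G + C2 + eps).
Proof.
move=> eps0; have [eta eta0 mod] := operator_modulus eps0.
exists eta => // h /andP[h0 heta] t x thT.
set t1 := Num.max (t + h) 0; set t0 := Num.max t 0.
have t00 : 0 <= t0 by rewrite /t0 le_max lexx orbT.
have t01 : t0 <= t1 by rewrite /t0 /t1 ge_max !le_max lexx lerDl (ltW h0) !orbT.
have t1T : t1 <= T by rewrite /t1 ge_max thT ltW.
have th : t1 - t0 <= h.
  rewrite lerBlDr /t1 ge_max [h + t0]addrC lerD2r /t0 le_max lexx/=.
  by rewrite addr_ge0// ltW.
have [c /andP[tc ct] ->] := solution_mvt x t00 t01 t1T.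
have cT : c \in `[0, T] by rewrite in_itv/= (le_trans t00)// (le_trans ct).
set th1 := t1 - t0 in th *; have th0 : 0 <= th1 by rewrite subr_ge0.
have M : `|LN (a c) (u c) x - LN (a t0) (u t0) x| <= eps.
  apply: mod => //; first exact: le_trans t1T.
  by apply: le_trans heta; apply: le_trans th; rewrite /th1 lerD2r.
(* [h - th1] is the part of the step spent at negative times. It is nonzero only for t < 0, and then
   t0 = 0, where [u_init] applies. *)
have Z : `|(h - th1) * LN (a t0) (u t0) x| <= h * C2.
  have [tp|tn] := leP 0 t.
    have -> : h - th1 = 0.
      rewrite /th1 /t1 /t0 !max_l//; first by ring.
      by rewrite addr_ge0// ltW.
    by rewrite mul0r normr0 mulr_ge0// ltW.
  have -> : t0 = 0 by rewrite /t0 max_r// ltW.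
  rewrite normrM ger0_norm ?subr_ge0//; apply: ler_pM => //; first by rewrite subr_ge0.
  by rewrite gerBl.
have -> : (LN (a c) (u c) x + g c x) * th1 - h * LN (a t0) (u t0) x =
   th1 * (LN (a c) (u c) x - LN (a t0) (u t0) x) + th1 * g c x -
   (h - th1) * LN (a t0) (u t0) x by ring.
have H1 : `|th1 * (LN (a c) (u c) x - LN (a t0) (u t0) x)| <= h * eps.
  by rewrite normrM ger0_norm//; apply: ler_pM.
have H2 : `|th1 * g c x| <= h * G.
  by rewrite normrM ger0_norm//; apply: ler_pM => //; exact: g_le.
apply: le_trans (ler_normB _ _) _; apply: le_trans (lerD (ler_normD _ _) Z) _.
by move: H1 H2; lra.
Qed.

End Extension.

(** * Estimates on [0, T] as the Euler defect tends to zero *)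

Lemma le_add_vanishing (R : realType) (x y k : R) : 0 <= k ->
  (forall eps, 0 < eps -> x <= y + k * eps) -> x <= y.
Proof.
move=> k0 H; apply/ler_addgt0Pr => e e0.
have k1 : 0 < k + 1 by rewrite ltr_wpDl.
apply: le_trans (H (e / (k + 1)) (divr_gt0 e0 k1)) _; rewrite lerD2l.
by rewrite mulrA ler_pdivrMr// mulrC ler_wpM2l ?lerDl// ltW.
Qed.

(** The interior constant does not depend on the source bound, so the source G + C2 + eps may tend
    to G + C2. Clipping times at 0 is 1-Lipschitz and preserves the Hoelder bound on the
    coefficients. *)
Lemma lattice_estimates (R : realType) (n : nat) (cm cp alpha : R) :
  0 < cm -> 0 <= cp -> 0 < alpha -> alpha < 1 ->
  exists2 C : R, 0 < C & forall (N : nat) (T U G C2 B : R)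
    (a : R -> lattice n N -> dir n -> R) (g u : R -> lattice n N -> R),
  (0 < N)%N -> 0 <= U -> 0 <= G -> 0 <= B -> 0 <= C2 -> 0 < T ->
  solves T a g u ->
  (forall t, t \in `[0, T] -> elliptic_class cm cp (a t)) ->
  (forall t1 t2 : R, t1 \in `[0, T] -> t2 \in `[0, T] -> forall x1 x2 e,
     `|a t1 x1 e - a t2 x2 e| <=
     B * (`|t2 - t1| `^ (alpha / 2) + tdist (lpoint R x1) (lpoint R x2) `^ alpha)) ->
  (forall t x, t \in `[0, T] -> `|g t x| <= G) ->
  (forall t x, t \in `[0, T] -> `|u t x| <= U) ->
  (forall x, `|LN (a 0) (u 0) x| <= C2) ->
  let V := (B + 1) `^ (1 + alpha^-1) * U + (G + C2) in
  forall t, t \in `[0, T] ->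
  [/\ forall e x, `|lgrad e (u t) x| <=
        C * ((B + 1) `^ alpha^-1 * U + (B + 1)^-1 * (G + C2)),
      forall e x e1 k, `|lgrad e (u t) (x + latt N (dvec e1) *+ k) - lgrad e (u t) x| <=
        C * V * (k%:R / N%:R) `^ alpha,
      forall x s, s \in `[0, T] -> `|u t x - u s x| <= C * V * `|t - s| `^ ((1 + alpha) / 2) &
      forall e x s, s \in `[0, T] -> `|lgrad e (u t) x - lgrad e (u s) x| <=
        C * V * `|t - s| `^ (alpha / 2)].
Proof.
move=> cm0 cp0 a0 a1; have [C C0 HC] := interior_estimates n cm0 cp0 a0 a1.
exists C => // N T U G C2 B a g u N0 U0 G0 B0 C20 T0 sol ell hol gle ule uini V t tT.
have B1 : 0 < B + 1 by rewrite ltr_wpDl.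
pose p (t : R) := Num.max t 0.
have pT t' : t' <= T -> p t' \in `[0, T].
  by move=> h; rewrite in_itv/= /p le_max lexx orbT ge_max h ltW.
have pE t' : t' \in `[0, T] -> p t' = t'.
  by rewrite in_itv/= => /andP[h _]; rewrite /p max_l.
have pp t1 t2 : `|p t1 - p t2| <= `|t1 - t2|.
  rewrite /p; case: (leP t1 0) => h1; case: (leP t2 0) => h2.
  - by rewrite subrr normr0.
  - by rewrite sub0r normrN gtr0_norm// distrC; apply: le_trans (ler_norm _); lra.
  - by rewrite subr0 gtr0_norm//; apply: le_trans (ler_norm _); lra.
  - by [].
have holt t1 t2 x e : t1 \in `[0, T] -> t2 \in `[0, T] ->
    `|a t1 x e - a t2 x e| <= B * `|t2 - t1| `^ (alpha / 2).
  move=> h1 h2; apply: le_trans (hol _ _ h1 h2 _ _ _) _.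
  rewrite (_ : tdist _ _ = 0) ?powR0 ?gt_eqF ?addr0//.
  apply/le_anti; rewrite tdist_ge0 andbT.
  have := tdist_lpoint R N0 x 0; rewrite addr0 sqdist0// sqrtr0.
  by [].
have hol' t1 t2 x y e : t1 <= T -> t2 <= T ->
    `|a (p t1) (x + y) e - a (p t2) x e| <=
     B * (sqdist R y `^ (alpha / 2) + `|t1 - t2| `^ (alpha / 2)).
  move=> h1 h2; rewrite distrC; apply: le_trans (hol _ _ (pT _ h2) (pT _ h1) _ _ _) _.
  rewrite ler_wpM2l// addrC; apply: lerD.
    rewrite [alpha / 2]mulrC powRrM powR12_sqrt ?sqdist_ge0//.
    by apply: ge0_ler_powR; rewrite ?nnegrE ?tdist_ge0 ?sqrtr_ge0 ?(ltW a0)// tdist_lpoint.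
  by apply: ge0_ler_powR; rewrite ?nnegrE ?divr_ge0 ?(ltW a0).
have est eps : 0 < eps -> _ := fun eps0 => HC N T U (G + C2 + eps) B
  (fun t => a (p t)) (fun t => u (p t)) N0 U0
  (addr_ge0 (addr_ge0 G0 C20) (ltW eps0)) B0 (fun t h => ell _ (pT t h)) hol'
  (fun t x h => ule _ x (pT t h))
  (euler_extension cm0 a0 a1 U0 G0 B0 C20 cp0 T0 sol ell holt gle ule uini eps0).
have tT' : t <= T by move: tT; rewrite in_itv/= => /andP[].
have lim x (W : R) : 0 <= W ->
    (forall eps, 0 < eps -> x <= C * ((B + 1) `^ (1 + alpha^-1) * U + (G + C2 + eps)) * W) ->
    x <= C * V * W.
  move=> W0 H; apply: (@le_add_vanishing _ _ _ (C * W)); first by rewrite mulr_ge0// ltW.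
  by move=> eps /H; rewrite /V; lra.
split.
- move=> e x; apply: (@le_add_vanishing _ _ _ (C * (B + 1)^-1)).
    by rewrite mulr_ge0 ?invr_ge0 ?ltW.
  move=> eps eps0; have [+ _ _ _] := est eps eps0 t tT'.
  by move=> /(_ e x); rewrite pE//; lra.
- move=> e x e1 k; apply: lim => [|eps eps0]; first exact: powR_ge0.
  have [_ + _ _] := est eps eps0 t tT'.
  by move=> /(_ e e1 x k); rewrite pE.
- move=> x s sT; apply: lim => [|eps eps0]; first exact: powR_ge0.
  wlog ts : t s tT sT tT' / s <= t => [H|].
    have [st|/ltW st] := leP s t; first exact: H.
    rewrite distrC [`|t - s|]distrC; apply: H => //.
    by move: sT; rewrite in_itv/= => /andP[].
  have [->|st] := eqVneq s t.
    by rewrite !subrr normr0 powR0 ?mulr0// gt_eqF// divr_gt0// addr_gt0.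
  have r0 : 0 < t - s by rewrite subr_gt0 lt_neqAle st.
  have [_ _ + _] := est eps eps0 t tT'.
  by move=> /(_ x _ r0); rewrite subKr !pE// (gtr0_norm r0).
- move=> e x s sT; apply: lim => [|eps eps0]; first exact: powR_ge0.
  wlog ts : t s tT sT tT' / s <= t => [H|].
    have [st|/ltW st] := leP s t; first exact: H.
    rewrite distrC [`|t - s|]distrC; apply: H => //.
    by move: sT; rewrite in_itv/= => /andP[].
  have [->|st] := eqVneq s t.
    by rewrite !subrr normr0 powR0 ?mulr0// gt_eqF// divr_gt0.
  have r0 : 0 < t - s by rewrite subr_gt0 lt_neqAle st.
  have [_ _ _ +] := est eps eps0 t tT'.
  by move=> /(_ e x _ r0); rewrite subKr !pE// (gtr0_norm r0).
Qed.

(** * Norms of the interpolation *)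

Section TorusNorms.
Variables (R : realType) (n N : nat) (T alpha K U : R) (u : R -> lattice n N -> R).
Hypothesis N0 : (0 < N)%N.
Hypothesis alpha0 : 0 < alpha.
Hypothesis alpha1 : alpha < 1.
Hypothesis K0 : 0 <= K.
Hypothesis u_le : forall t x, t \in `[0, T] -> `|u t x| <= U.
Hypothesis u_space : forall t e x e1 k, t \in `[0, T] ->
  `|lgrad e (u t) (x + latt N (dvec e1) *+ k) - lgrad e (u t) x| <=
    K * (k%:R / N%:R) `^ alpha.
Hypothesis u_time : forall t s x, t \in `[0, T] -> s \in `[0, T] ->
  `|u t x - u s x| <= K * `|t - s| `^ ((1 + alpha) / 2).
Hypothesis u_grad_time : forall t s e x, t \in `[0, T] -> s \in `[0, T] ->
  `|lgrad e (u t) x - lgrad e (u s) x| <= K * `|t - s| `^ (alpha / 2).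

Lemma torus_repr (z : torus R n) : z = to_torus (repr z).
Proof. by symmetry; exact: reprK. Qed.

(** It includes y = 0, where the quotient is 0 by convention, so the Hoelder quotients are bounded
    without a case distinction on [pdist]. *)
Lemma div_le_of_le_mul (x k y : R) : 0 <= k -> 0 <= y -> x <= k * y -> x / y <= k.
Proof.
move=> k0; rewrite le_eqVlt => /predU1P[<-|y0 xy].
  by rewrite invr0 (mulr0 x) => _.
by rewrite ler_pdivrMr.
Qed.

Lemma tgrad_interp_holder e (X Y : R * torus R n) : Omega T X -> Omega T Y ->
  `|tgrad N e (interp u) X - tgrad N e (interp u) Y| <=
  (3 * n%:R + 1) * K * pdist X Y `^ alpha.
Proof.
case: X Y => t z [s y] /= tT sT; set F := tgrad N e (interp u).
have -> : F (t, z) - F (s, y) = (F (t, z) - F (t, y)) + (F (t, y) - F (s, y)) by ring.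
set P := pdist _ _.
have P1 : tdist z y <= P by rewrite /P /pdist le_max lexx orbT.
have P2 : `|t - s| `^ 2^-1 <= P by rewrite /P /pdist le_max lexx.
have P0 : 0 <= P by apply: le_trans P2; exact: powR_ge0.
have H1 : `|F (t, z) - F (t, y)| <= n%:R * (3 * K) * tdist z y `^ alpha.
  apply: (@torus_holder R n alpha alpha0 (fun z => F (t, z))).
    by rewrite !mulr_ge0.
  move=> p q; rewrite /F !tgrad_interp//.
  by apply: polylin_holder => // x e1 k; exact: u_space.
have H2 : `|F (t, y) - F (s, y)| <= K * `|t - s| `^ (alpha / 2).
  rewrite (torus_repr y) /F !tgrad_interp// -polylinB.
  by apply: polylin_le => x; exact: u_grad_time.
apply: le_trans (ler_normD _ _) _; apply: le_trans (lerD H1 H2) _.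
have Q1 : tdist z y `^ alpha <= P `^ alpha.
  by apply: ge0_ler_powR; rewrite ?nnegrE ?tdist_ge0 ?(ltW alpha0).
have Q2 : `|t - s| `^ (alpha / 2) <= P `^ alpha.
  rewrite [alpha / 2]mulrC powRrM.
  by apply: ge0_ler_powR; rewrite ?nnegrE ?powR_ge0 ?(ltW alpha0).
have := ler_wpM2l K0 Q2; have := ler_wpM2l (mulr_ge0 (mulr_ge0 (ler0n R 3) (ler0n R n)) K0) Q1.
lra.
Qed.

Lemma holder_tgrad_le e :
  (holder T alpha (tgrad N e (interp u)) <= ((3 * n%:R + 1) * K)%:E)%E.
Proof.
apply: ge_ereal_sup => _ [[X Y] /= [/= XT YT _] <-]; rewrite lee_fin.
apply: div_le_of_le_mul; rewrite ?powR_ge0//; last exact: tgrad_interp_holder.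
by rewrite mulr_ge0// addr_ge0// mulr_ge0.
Qed.

Lemma holder1_interp_le :
  (holder1 N T alpha (interp u) <= ((3 * n%:R + 1) * K)%:E)%E.
Proof.
apply: ge_ereal_sup => _ [[X Y] /= [/= XT YT _] <-]; rewrite lee_fin.
have K3 : 0 <= (3 * n%:R + 1) * K by rewrite mulr_ge0// addr_ge0// mulr_ge0.
apply: div_le_of_le_mul; rewrite ?powR_ge0//.
apply: bigmax_le => [|e _]; first by rewrite mulr_ge0 ?powR_ge0.
exact: tgrad_interp_holder.
Qed.

Lemma holder1_time_interp_le : (holder1_time T alpha (interp u) <= K%:E)%E.
Proof.
apply: ge_ereal_sup => _ [[[t z] [s y]] /= [[/= tT sT _] zy] <-]; rewrite lee_fin.
apply: div_le_of_le_mul; rewrite ?powR_ge0// -zy (torus_repr z) !interpE -polylinB.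
by apply: polylin_le => x; exact: u_time.
Qed.

Lemma sup_norm_interp_le : (sup_norm T (interp u) <= U%:E)%E.
Proof.
apply: ge_ereal_sup => _ [[t z] /= tT <-]; rewrite lee_fin.
by rewrite (torus_repr z) interpE; apply: polylin_le => x; exact: u_le.
Qed.

Lemma norm1_interp_le :
  (norm1 N T alpha (interp u) <= ((3 * n%:R + 2) * K + U)%:E)%E.
Proof.
apply: le_trans (leeD (leeD holder1_interp_le holder1_time_interp_le) sup_norm_interp_le) _.
by rewrite -!EFinD lee_fin; lra.
Qed.

End TorusNorms.

(** * Assembly in extended real norms *)

Lemma lsup_norm_ge (R : realType) (n N : nat) (T : R) (f : R -> lattice n N -> R) t x :
  t \in `[0, T] -> (`|f t x|%:E <= lsup_norm T f)%E.
Proof. by move=> tT; apply: ereal_sup_ubound; exists (t, x). Qed.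

Theorem theorem4p2 (R : realType) (n : nat) (cm cp T alpha : R)
    (hn : (0 < n)%N) (hcm : 0 < cm) (hcp : cm < cp) (hT : 0 < T)
    (halpha0 : 0 < alpha) (halpha1 : alpha < 1) :
  exists C : R, 0 < C /\
  forall (a : forall N : nat, R -> lattice n N -> dir n -> R)
         (g u : forall N : nat, R -> lattice n N -> R)
         (B Ginf C0 C1 : R),
    (forall N : nat, (0 < N)%N ->
       [/\ forall (x : lattice n N) (e : dir n),
             {within `[0, T], continuous (fun t : R => a N t x e)},
           forall x : lattice n N, {within `[0, T], continuous (fun t : R => g N t x)} &
           solves T (a N) (g N) (u N)]) ->
    (forall N : nat, (0 < N)%N -> forall t : R, t \in `[0, T] ->
       elliptic_class cm cp (a N t)) ->
    (forall N : nat, (0 < N)%N -> (lsup_norm T (g N) <= Ginf%:E)%E) ->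
    (ereal_sup [set lsup_norm T (u N) | N in [set N : nat | (0 < N)%N]]
       < +oo)%E ->
    (forall N : nat, (0 < N)%N -> CkN_norm 2 (u N 0) <= C0) ->
    (forall N : nat, (0 < N)%N -> forall t1 t2 : R,
       t1 \in `[0, T] -> t2 \in `[0, T] ->
       forall (x1 x2 : lattice n N) (e : dir n),
       `|a N t1 x1 e - a N t2 x2 e| <=
         B * (`|t2 - t1| `^ (alpha / 2)
              + tdist (lpoint R x1) (lpoint R x2) `^ alpha)) ->
    (forall N : nat, (0 < N)%N -> forall (x : lattice n N) (e : dir n),
       `|lgrad_star_coef (a N 0) x e| <= C1) ->
    let C2 := n%:R * (C1 * C0 + cp * C0) in
    forall N : nat, (0 < N)%N ->
      let bound :=
        (C%:E * (((B + 1) `^ (1 + alpha^-1))%:E * lsup_norm T (u N)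
                 + Ginf%:E + C2%:E))%E in
      [/\ (norm1 N T alpha (interp (u N)) <= bound)%E,
          (forall (e : dir n) (t : R) (x : lattice n N), t \in `[0, T] ->
             (`|lgrad e (u N t) x|%:E <=
              C%:E * (((B + 1) `^ alpha^-1)%:E * lsup_norm T (u N)
                      + ((B + 1)^-1 * (Ginf + C2))%:E))%E) &
          (forall e : dir n,
             (holder T alpha (tgrad N e (interp (u N))) <= bound)%E)].
Proof.
have cp0 : 0 <= cp by rewrite ltW// (lt_trans hcm).
have [C K0 HC] := lattice_estimates n hcm cp0 halpha0 halpha1.
have n0 : 0 <= n%:R :> R by [].
(* 3 n + 1 comes from the gradient of the interpolation, 1 from the time seminorm, and the final 1
   from the supremum norm, as U <= V. *)
exists ((3 * n%:R + 2) * C + 1); split; first by rewrite ltr_wpDl// mulr_ge0 ?addr_ge0 ?mulr_ge0// ltW.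
move=> a g u B Ginf C0 C1 hsol hell hg hu hC0 hhol hC1 C2 N N0 bound.
have [_ _ sol] := hsol N N0.
have T0 : 0 \in `[0, T] by rewrite in_itv/= lexx ltW.
have TT : T \in `[0, T] by rewrite in_itv/= lexx ltW.
pose e0 : dir n := (Ordinal hn, true).
(* The Hoelder condition between the times 0 and T forces this, its right-hand factor being
   positive. *)
have B0 : 0 <= B.
  have := hhol N N0 0 T T0 TT 0 0 e0.
  have P : 0 < `|T - 0| `^ (alpha / 2) + tdist (lpoint R (0 : lattice n N)) (lpoint R (0 : lattice n N)) `^ alpha.
    by rewrite ltr_wpDr ?powR_ge0// powR_gt0// subr0 normr_gt0 gt_eqF.
  by move=> /(le_trans (normr_ge0 _)); rewrite pmulr_lge0.
have Ufin : lsup_norm T (u N) \is a fin_num.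
  rewrite fin_real//; apply/andP; split.
    by apply: lt_le_trans (lsup_norm_ge (u N) 0 T0); rewrite ltNyr.
  by apply: le_lt_trans hu; apply: ereal_sup_ubound; exists N.
pose U := fine (lsup_norm T (u N)).
have UE : lsup_norm T (u N) = U%:E by rewrite fineK.
have ule t x : t \in `[0, T] -> `|u N t x| <= U.
  by move=> tT; rewrite -lee_fin -UE; exact: lsup_norm_ge.
have gle t x : t \in `[0, T] -> `|g N t x| <= Ginf.
  by move=> tT; rewrite -lee_fin; apply: le_trans (hg N N0); exact: lsup_norm_ge.
have U0 : 0 <= U by apply: le_trans (ule 0 0 T0).
have G0 : 0 <= Ginf by apply: le_trans (gle 0 0 T0).
have C00 : 0 <= C0.
  by apply: le_trans (hC0 N N0); apply: le_trans (CkN2_gradient (u N 0) e0 0).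
have C10 : 0 <= C1 by apply: le_trans (hC1 N N0 0 e0).
have C20 : 0 <= C2 by rewrite !(mulr_ge0, addr_ge0).
have ini x : `|LN (a N 0) (u N 0) x| <= C2.
  exact: (LN_initial N0 x hcm (hell N N0 0 T0) (hC0 N N0) (hC1 N N0)).
have := HC N T U Ginf C2 B (a N) (g N) (u N) N0 U0 G0 B0 C20 hT sol (hell N N0)
  (hhol N N0) gle ule ini.
set V := _ + _ => est.
have B1 : 1 <= B + 1 by rewrite lerDr.
have UV : U <= V.
  rewrite /V -[leLHS]addr0; apply: lerD; last exact: addr_ge0.
  rewrite -[leLHS]mul1r; apply: ler_wpM2r => //.
  have a0 : 0 <= 1 + alpha^-1 by rewrite addr_ge0// invr_ge0 ltW.
  by have := ler_powR B1 a0; rewrite powRr0.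
have V0 : 0 <= V by exact: le_trans UV.
have CV0 : 0 <= C * V by rewrite mulr_ge0// ltW.
have boundE : bound = (((3 * n%:R + 2) * C + 1) * V)%:E.
  by rewrite /bound UE -!EFinM; congr (_ * _)%:E; rewrite /V [RHS]addrA.
have space t e x e1 k : t \in `[0, T] -> _ := fun tT => let: And4 _ H _ _ := est t tT in H e x e1 k.
have time t s x : t \in `[0, T] -> s \in `[0, T] -> _ :=
  fun tT sT => let: And4 _ _ H _ := est t tT in H x s sT.
have gtime t s e x : t \in `[0, T] -> s \in `[0, T] -> _ :=
  fun tT sT => let: And4 _ _ _ H := est t tT in H e x s sT.
split.
- rewrite boundE; apply: le_trans (norm1_interp_le N0 halpha0 halpha1 CV0 ule space time gtime) _.
  by rewrite lee_fin; lra.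
- move=> e t x tT; rewrite UE -!EFinM lee_fin.
  have [H _ _ _] := est t tT; apply: le_trans (H e x) _.
  rewrite ler_wpM2r//.
    by rewrite addr_ge0// mulr_ge0 ?powR_ge0// ?invr_ge0 ?addr_ge0.
  have : 0 <= n%:R * C by rewrite mulr_ge0// ltW.
  by move: K0; lra.
- move=> e; rewrite boundE.
  apply: le_trans (holder_tgrad_le N0 halpha0 halpha1 CV0 space gtime e) _.
  by rewrite lee_fin; lra.
Qed.
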